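(* The following equalities hold: (i) for every $y_0\in Y$ and every $\epsilon\in(0,1)$, $\ \overline{\mathrm{co}}\,\Theta_\epsilon(y_0)=W(\epsilon,y_0)$; (ii) $\lim_{\epsilon\to0}\rho_H(\overline{\mathrm{co}}\,\Theta_\epsilon,W)=0$, where $\Theta_\epsilon:=\bigcup_{y_0\in Y}\Theta_\epsilon(y_0)$; (iii) $\lim_{T\to\infty}\rho_H(\overline{\mathrm{co}}\,\Gamma_T,W)=0$, where $\Gamma_T:=\bigcup_{y_0\in Y}\Gamma_T(y_0)$. Here $\overline{\mathrm{co}}$ denotes the (weak$^*$) closed convex hull.
   Context: Model. $Y\subset\mathbb R^n$ is a nonempty compact set, $\hat U$ is a compact metric space, $S$ is a Polish space. The function $f:Y\times\hat U\times S\to\mathbb R^n$ is bounded, continuous in $(y,u)$ on $Y\times\hat U$ and Borel measurable in $s$ on $S$. The $S$-valued random elements $s(0),s(1),\dots$ are independent and identically distributed on a common probability space; $s$ denotes a generic random element with the same distribution, and $E[\varphi(f(y,u,s))]$ is the expectation over $s$ with $(y,u)$ fixed. $U(\cdot)$ is an upper semicontinuous multivalued map from $Y$ to nonempty compact subsets of $\hat U$, and $f(y,u,s)\in Y$ for all $y\in Y$, $u\in U(y)$, $s\in S$. $G:=\{(y,u): y\in Y,\ u\in U(y)\}$ (a compact set). $\Pi$ is the set of control plans $\pi=\{\pi_t(\cdot)\}_{t=0,1,\dots}$, where each $\pi_t:Y\to\hat U$ is Borel measurable with $\pi_t(y)\in U(y)$ for all $y\in Y$. For $\pi\in\Pi$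 and $y_0\in Y$, the state-control trajectory $(y^{\pi,y_0}(\cdot),u^{\pi,y_0}(\cdot))$ is defined by $y(0)=y_0$, $u(t)=\pi_t(y(t))$, $y(t+1)=f(y(t),u(t),s(t))$. Occupational measures. $\mathcal P(G)$ is the set of probability measures on Borel subsets of $G$. For Borel $Q\subset G$, $$\gamma^{\pi,y_0,T}(Q):=\frac1T E\Big[\sum_{t=0}^{T-1}1_Q(y^{\pi,y_0}(t),u^{\pi,y_0}(t))\Big],\qquad \gamma_d^{\pi,y_0,\epsilon}(Q):=\epsilon E\Big[\sum_{t=0}^{\infty}(1-\epsilon)^t1_Q(y^{\pi,y_0}(t),u^{\pi,y_0}(t))\Big],$$ $\Gamma_T(y_0):=\{\gamma^{\pi,y_0,T}:\pi\in\Pi\}$, $\Theta_\epsilon(y_0):=\{\gamma_d^{\pi,y_0,\epsilon}:\pi\in\Pi\}$, for $T=1,2,\dots$, $\epsilon\in(0,1)$. Sets $W(\epsilon,y_0)$ and $W$. With $C(Y)$ the continuous functions on $Y$, $$W(\epsilon,y_0):=\Big\{\gamma\in\mathcal P(G):\int_G\big((1-\epsilon)(E[\varphi(f(y,u,s))]-\varphi(y))+\epsilon(\varphi(y_0)-\varphi(y))\big)\gamma(dy,du)=0\ \forall\varphi\in C(Y)\Big\},$$ $$W:=\Big\{\gamma\in\mathcal P(G):\int_G\big(E[\varphi(f(y,u,s))]-\varphi(y)\big)\gamma(dy,du)=0\ \forall\varphi\in C(Y)\Big\}.$$ Metric. $\rho(\gamma',\gamma''):=\sum_{j\ge1}2^{-j}\big|\int_G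 q_j\,d\gamma'-\int_G q_j\,d\gamma''\big|$, where $(q_j)_{j\ge1}$ is a fixed sequence of Lipschitz continuous functions dense in the unit ball of $C(G)$; it metrizes the weak$^*$ topology on $\mathcal P(G)$ (convergence of integrals of continuous functions). For $\Gamma_1,\Gamma_2\subset\mathcal P(G)$, $\rho(\gamma,\Gamma_i):=\inf_{\gamma'\in\Gamma_i}\rho(\gamma,\gamma')$ and $\rho_H(\Gamma_1,\Gamma_2):=\max\{\sup_{\gamma\in\Gamma_1}\rho(\gamma,\Gamma_2),\sup_{\gamma\in\Gamma_2}\rho(\gamma,\Gamma_1)\}$. *)

(* Defs.v *)
From HB Require Import structures.
From mathcomp Require Import all_boot all_order all_algebra finmap.
From mathcomp Require Import all_classical all_reals all_analysis.

Set Implicit Arguments.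
Unset Strict Implicit.
Unset Printing Implicit Defensive.

Import Order.TTheory GRing.Theory Num.Theory.
Import numFieldNormedType.Exports.

Local Open Scope classical_set_scope.
Local Open Scope ring_scope.

(* [measurableType] is built on [pointedType], so spaces carrying a Borel
   sigma-algebra must be pointed. *)
#[short(type="pmetricType")]
HB.structure Definition PMetric (K : numDomainType) :=
  {M of Metric K M & Pointed M}.

HB.instance Definition _ (X Z : ptopologicalType) := Pointed.on (X * Z)%type.

Definition borel (T : ptopologicalType) := g_sigma_algebraType (@open T).

Definition polish_space (R : realType) (S : topologicalType) : Prop :=
  (exists2 D : set S, countable D & dense D) /\
  exists d : S -> S -> R,
    [/\ (forall x y, d x y = 0 <-> x = y),
        (forall x y, d x y = d y x),
        (forall x y z, d x z <= d x y + d y z),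
        (forall x : S, nbhs x =
           filter_from [set e : R | 0 < e] (fun e => [set y | d x y < e])) &
        (forall v : nat -> S,
           (forall e, 0 < e -> exists N, forall i j,
              (N <= i)%N -> (N <= j)%N -> d (v i) (v j) < e) ->
           exists x : S, v @ \oo --> x)].

(* Upper semicontinuity on [Y] of a multivalued map. *)
Definition usc_multimap (X Z : topologicalType) (Y : set X) (F : X -> set Z)
    : Prop :=
  forall y, Y y -> forall O : set Z, open O -> F y `<=` O ->
    \forall y' \near within Y (nbhs y), F y' `<=` O.

Definition graph (X Z : Type) (Y : set X) (F : X -> set Z) : set (X * Z) :=
  [set z | Y z.1 /\ F z.1 z.2].

Section random_sequences.
Context {d d' : measure_display} {Omega : measurableType d}
  {E : measurableType d'} {R : realType}.

Definition independent_seq (P : probability Omega R)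
    (X : nat -> {RV P >-> E}) : Prop :=
  forall (J : {fset nat}) (B : nat -> set E), (forall t, measurable (B t)) ->
    P (\bigcap_(t in [set` J]) (X t @^-1` B t)) =
    (\prod_(t <- J) P (X t @^-1` B t))%E.

Definition identically_distributed (P : probability Omega R)
    (X : nat -> {RV P >-> E}) : Prop :=
  forall (t : nat) (B : set E), measurable B ->
    distribution P (X t) B = distribution P (X 0%N) B.

End random_sequences.

(* Functions on a subset [G] are represented by total functions, and
   probability measures on [G] by Borel probability measures [mu] of the ambient
   space with [mu G = 1]; [G] is always compact, hence Borel, below. *)
Section measures_on_a_subset.
Context {R : realType} {T : ptopologicalType}.
Implicit Types (G : set T) (A B : set (probability (borel T) R)).

Definition cont_on G : set (T -> R) :=
  [set phi | {within G, continuous phi}].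

Definition probs_on G : set (probability (borel T) R) :=
  [set mu | mu G = 1%E].

Definition integrals G (mu : probability (borel T) R) :
    {ptws set_type (cont_on G) -> R} :=
  fun phi => \int[mu]_(z in G) (set_val phi z).

Definition weak_star G := initial_topology (@integrals G).

Definition convex_hull A : set (probability (borel T) R) :=
  [set mu | exists (m : nat) (c : 'I_m -> R)
      (nu : 'I_m -> probability (borel T) R),
    [/\ (forall i, 0 <= c i), \sum_(i < m) c i = 1, (forall i, A (nu i)) &
        forall Q : set (borel T), measurable Q ->
          mu Q = (\sum_(i < m) (c i)%:E * nu i Q)%E]].

Definition closed_convex_hull G A : set (probability (borel T) R) :=
  probs_on G `&` closure (convex_hull A : set (weak_star G)).

(* The index [j >= 1] of the series is shifted to start from 0.  Distances are
   extended reals, so that an infimum over the empty set is [+oo]. *)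
Definition rho G (q : nat -> T -> R) (mu nu : probability (borel T) R)
    : \bar R :=
  (\sum_(0 <= j <oo)
    (2^-1 ^+ j.+1 *
     `|\int[mu]_(z in G) q j z - \int[nu]_(z in G) q j z|)%:E)%E.

Definition rho_to G q (mu : probability (borel T) R) B : \bar R :=
  ereal_inf [set rho G q mu nu | nu in B].

Definition rho_H G q A B : \bar R :=
  maxe (ereal_sup [set rho_to G q mu B | mu in A])
       (ereal_sup [set rho_to G q nu A | nu in B]).

Definition dense_in_unit_ball G (q : nat -> T -> R) : Prop :=
  (forall j z, G z -> `|q j z| <= 1) /\
  forall phi, cont_on G phi -> (forall z, G z -> `|phi z| <= 1) ->
  forall e, 0 < e -> exists j, forall z, G z -> `|phi z - q j z| <= e.

End measures_on_a_subset.

Definition lipschitz_in (R : realType) (V : normedModType R)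
    (Z : metricType R) (G : set (V * Z)) (q : V * Z -> R) : Prop :=
  exists L : R, forall z z', G z -> G z' ->
    `|q z - q z'| <= L * (`|z.1 - z'.1| + mdist z.2 z'.2).

Section controlled_system.
Context {R : realType} {n : nat} {Uhat : pmetricType R} {S : ptopologicalType}
  {d : measure_display} {Omega : measurableType d}.
Variables (P : probability Omega R) (s : nat -> {RV P >-> borel S}).
Variables (Y : set 'rV[R]_n) (U : 'rV[R]_n -> set Uhat)
  (f : 'rV[R]_n -> Uhat -> S -> 'rV[R]_n).

Definition plan := nat -> 'rV[R]_n -> Uhat.

Definition admissible (pi : plan) : Prop :=
  forall t, measurable_fun (Y : set (borel 'rV[R]_n))
              (pi t : borel 'rV[R]_n -> borel Uhat) /\
            forall y, Y y -> U y (pi t y).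

Fixpoint state (pi : plan) (y0 : 'rV[R]_n) (t : nat) (w : Omega) : 'rV[R]_n :=
  if t is t'.+1 then
    let y := state pi y0 t' w in f y (pi t' y) (s t' w)
  else y0.

Definition state_control (pi : plan) y0 t w : 'rV[R]_n * Uhat :=
  (state pi y0 t w, pi t (state pi y0 t w)).

Let G := graph Y U.
Let prob_XU := probability (borel ('rV[R]_n * Uhat)%type) R.

Definition occ (pi : plan) y0 (T : nat) (Q : set ('rV[R]_n * Uhat)) : \bar R :=
  ((T%:R^-1)%:E *
   \int[P]_w (\sum_(0 <= t < T) \1_Q (state_control pi y0 t w))%:E)%E.

Definition disc_occ (pi : plan) y0 (eps : R) (Q : set ('rV[R]_n * Uhat))
    : \bar R :=
  (eps%:E *
   \int[P]_w (\sum_(0 <= t <oo)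
     ((1 - eps) ^+ t * \1_Q (state_control pi y0 t w))%:E))%E.

(* A [probability] is a function of all sets, but only its values on
   measurable sets matter: membership below is up to those values. *)
Definition Gamma (T : nat) (y0 : 'rV[R]_n) : set prob_XU :=
  [set gamma | probs_on G gamma /\
    exists2 pi, admissible pi &
      forall Q : set (borel ('rV[R]_n * Uhat)%type), measurable Q -> Q `<=` G ->
        gamma Q = occ pi y0 T Q].

Definition Theta (eps : R) (y0 : 'rV[R]_n) : set prob_XU :=
  [set gamma | probs_on G gamma /\
    exists2 pi, admissible pi &
      forall Q : set (borel ('rV[R]_n * Uhat)%type), measurable Q -> Q `<=` G ->
        gamma Q = disc_occ pi y0 eps Q].

(* The generic random element is taken to be [s 0]. *)
Definition mean_next (phi : 'rV[R]_n -> R) (y : 'rV[R]_n) (u : Uhat) : R :=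
  \int[P]_w phi (f y u (s 0%N w)).

Definition W_disc (eps : R) (y0 : 'rV[R]_n) : set prob_XU :=
  [set gamma | probs_on G gamma /\
    forall phi, cont_on Y phi ->
      (\int[gamma]_(z in G)
        ((1 - eps) * (mean_next phi z.1 z.2 - phi z.1) +
         eps * (phi y0 - phi z.1))%:E = 0)%E].

Definition W : set prob_XU :=
  [set gamma | probs_on G gamma /\
    forall phi, cont_on Y phi ->
      (\int[gamma]_(z in G) (mean_next phi z.1 z.2 - phi z.1)%:E = 0)%E].

End controlled_system.

(* Main.v *)
(* By separation, a measure gamma lies in the closed convex hull of a set A of
   measures on the compact set G as soon as, for every continuous q >= 0, the
   infimum over A of the integral of q is at most the integral of q against gamma.
   When A consists of occupational measures that infimum is the value of a control
   problem with running cost q.  Value iteration with measurable minimisers gives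
   bounded lower semicontinuous functions V satisfying a Bellman inequality on G;
   integrating it against gamma, and using that the identities defining W(eps, y0)
   and W extend by monotone limits from continuous to lower semicontinuous test
   functions, bounds the value by the integral of q.  Hence W(eps, y0) is contained
   in co Theta_eps(y0), and W in co Theta_eps and in co Gamma_T, for every eps and T.

   Conversely, independence of s(t) from the past and a telescoping sum show that
   an occupational measure satisfies the identities defining W(eps, y0) exactly, and
   those defining W up to O(eps), resp. O(1/T).  By weak-star compactness of P(G),
   measures that almost satisfy the latter are close to W. *)
From HB Require Import structures.
Require Import Defs.
From mathcomp Require Import all_boot all_order all_algebra finmap.
From mathcomp Require Import all_classical all_reals all_analysis.
From mathcomp Require Import measurable_realfun ring lra.

Set Implicit Arguments.
Unset Strict Implicit.
Unset Printing Implicit Defensive.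

Import Order.TTheory GRing.Theory Num.Theory.
Import numFieldNormedType.Exports.

Local Open Scope classical_set_scope.
Local Open Scope ring_scope.


(** Since [U] is only upper semicontinuous, minimising a continuous cost over [U y] yields a
    function of [y] that is lower semicontinuous but in general not continuous; this forces the
    passage to monotone limits of test functions. Separation may be restricted to [q >= 0] because
    adding a constant to [q] shifts all integrals equally. Nonnegativity makes the value iterates
    increase, so that a finite iterate already satisfies the discounted Bellman inequality and no
    fixed point of the Bellman operator is constructed; the cost beyond the horizon is a geometric
    tail. For [W] no initial state is prescribed: invariance of a measure bounds only the mean of
    the value function, and the union over [y0] supplies a state whose value nearly reaches down to
    that mean. As [W] lies inside both hulls for every parameter, one half of the Hausdorff distance
    vanishes. Measurability in the product of states and controls is always reduced to finite nets
    of a compact set. *)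

(** * Borel sets and compactness *)

Section borel_sets.
Context {R : realType} {T : ptopologicalType}.
Implicit Types (D C : set T).

Lemma open_borel (O : set T) : open O -> measurable (O : set (borel T)).
Proof. by move=> oO; exact: sub_sigma_algebra. Qed.

Lemma closed_borel C : closed C -> measurable (C : set (borel T)).
Proof.
move=> cC; rewrite -(setCK C); apply: measurableC.
by apply: open_borel; exact: closed_openC.
Qed.

Lemma closed_preimage_within (T' : topologicalType) D (phi : T -> T')
    (B : set T') : closed D -> {within D, continuous phi} -> closed B ->
  closed (D `&` phi @^-1` B).
Proof.
move=> cD /subspace_continuousP cphi cB x xcl.
have Dx : D x by apply: cD; apply: closure_subset xcl; exact: subIsetl.
split=> //=; apply: contrapT => nB.
have nbB : nbhs (phi x) (~` B) by apply: open_nbhs_nbhs; split=> //; exact: closed_openC.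
have := cphi x Dx _ nbB; rewrite /= /within/= => nx.
by have [y [[Dy By] /(_ Dy)]] := xcl _ nx.
Qed.

Lemma measurable_fun_sublevel d (Om : measurableType d) (E : set Om)
    (g : Om -> R) : measurable E ->
  (forall r, measurable (E `&` [set x | g x <= r])) -> measurable_fun E g.
Proof.
move=> mE H; apply: (measurability _ (measurable_realfun.RGenOInfty.measurableE R)).
move=> _ [_ [r ->] <-].
rewrite (_ : _ `&` _ = E `\` (E `&` [set x | g x <= r])); first exact: measurableD.
apply/seteqP; split=> x /=.
  by rewrite in_itv/= andbT => -[Ex rx]; split=> // -[_]; rewrite leNgt rx.
move=> [Ex nx]; split=> //; rewrite in_itv/= andbT ltNge.
by apply/negP => gr; apply: nx.
Qed.

Lemma measurable_fun_cont_on D (phi : T -> R) : closed D ->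
  cont_on D phi -> measurable_fun (D : set (borel T)) phi.
Proof.
move=> cD cphi; apply: measurable_fun_sublevel => [|r]; first exact: closed_borel.
by apply: closed_borel; exact: (closed_preimage_within cD cphi (@closed_le _ r)).
Qed.

Lemma measurable_fun_borel d (Om : measurableType d) (E : set Om)
    (g : Om -> T) : (forall O, open O -> measurable (E `&` g @^-1` O)) ->
  measurable_fun E (g : Om -> borel T).
Proof.
move=> H; apply: (@measurability _ _ _ (borel T) _ _ (@open T)) => // _ [B oB <-].
exact: H.
Qed.

Lemma compact_nested (K : nat -> set T) : compact (K 0%N) ->
  (forall i, closed (K i)) -> (forall i, K i.+1 `<=` K i) ->
  (forall i, K i !=set0) -> \bigcap_i K i !=set0.
Proof.
move=> K0 cK dK nK.
have leK i j : (i <= j)%N -> K j `<=` K i.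
  move=> /subnK <-; elim: (j - i)%N => // m IH.
  by rewrite addSn; exact: subset_trans (dK _) IH.
pose F := filter_from [set: nat] K.
have FF : ProperFilter F.
  apply: filter_from_proper; last by move=> i _; exact: nK.
  apply: filter_from_filter; first by exists 0%N.
  move=> i j _ _; exists (maxn i j) => //; rewrite subsetI; split.
    by apply: leK; exact: leq_maxl.
  by apply: leK; exact: leq_maxr.
have [x [_ Fx]] := K0 F FF (ex_intro2 _ _ 0%N I (@subset_refl _ _)).
exists x => i _; apply: cK => B Bx.
by apply: Fx => //; exists i.
Qed.

End borel_sets.

(** * Weak-star compactness *)

Section content_extension.
Context {R : realType} {T : ptopologicalType}.
Variables (G : set T) (lam : set T -> R).
Hypotheses (hausT : hausdorff_space T) (normT : normal_space T) (cptG : compact G).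
Let pc K := compact K /\ K `<=` G.
Hypotheses (lam0 : lam set0 = 0)
  (le_lam : forall K K', pc K -> pc K' -> K `<=` K' -> lam K <= lam K')
  (lamU_le : forall K K', pc K -> pc K' -> lam (K `|` K') <= lam K + lam K')
  (lamU_ge : forall K K', pc K -> pc K' -> K `&` K' = set0 ->
     lam K + lam K' <= lam (K `|` K')).

(** Only compact subsets of [G] compete, which is why the resulting measure has no mass off [G]. *)
Let inner (O : set T) : \bar R := ereal_sup [set (lam K)%:E | K in [set K | pc K /\ K `<=` O]].

(* Caratheodory's restriction of this outer measure to Borel sets is the measure
   sought. *)
Definition compact_outer (A : set T) : \bar R :=
  ereal_inf [set inner O | O in [set O | open O /\ A `<=` O]].

Let pc0 : pc set0.
Proof. by split; [exact: compact0|exact: sub0set]. Qed.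

Let inner_ub K O : pc K -> K `<=` O -> ((lam K)%:E <= inner O)%E.
Proof. by move=> pK KO; apply: ereal_sup_ubound; exists K. Qed.

Let inner_ge0 O : (0 <= inner O)%E.
Proof.
by apply: (@le_trans _ _ (lam set0)%:E); [rewrite lam0|exact: inner_ub].
Qed.

Let le_inner O O' : O `<=` O' -> (inner O <= inner O')%E.
Proof.
move=> OO'; apply: ge_ereal_sup => _ [K [pK KO] <-].
by apply: inner_ub => //; exact: subset_trans OO'.
Qed.

Let outer_lb A O : open O -> A `<=` O -> (compact_outer A <= inner O)%E.
Proof. by move=> oO AO; apply: ereal_inf_lbound; exists O. Qed.

Let outer_ge0 A : (0 <= compact_outer A)%E.
Proof. by apply: le_ereal_inf_tmp => _ [V [oO AO] <-]. Qed.

Let outer_open O : open O -> compact_outer O = inner O.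
Proof.
move=> oO; apply/eqP; rewrite eq_le outer_lb//=.
by apply: le_ereal_inf_tmp => _ [V [oO' OO'] <-]; exact: le_inner.
Qed.

Let outer0 : compact_outer set0 = 0%E.
Proof.
apply/eqP; rewrite eq_le outer_ge0 andbT outer_open; last exact: open0.
apply: ge_ereal_sup => _ [K [_ K0] <-].
by move: K0; rewrite subset0 => ->; rewrite lam0.
Qed.

Let le_outer A B : A `<=` B -> (compact_outer A <= compact_outer B)%E.
Proof.
move=> AB; apply: le_ereal_inf_tmp => _ [V [oO BO] <-].
by apply: outer_lb => //; exact: subset_trans BO.
Qed.

Let pcD K W : pc K -> open W -> pc (K `\` W).
Proof.
move=> [cK KG] oW; split; last by move=> x [/KG].
have -> : K `\` W = ~` W `&` K by rewrite setIC.
rewrite setIC; apply: compact_closedI => //; exact: open_closedC.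
Qed.

Let pcU K K' : pc K -> pc K' -> pc (K `|` K').
Proof. by move=> [cK KG] [cK' KG']; split; [exact: compactU|rewrite subUset]. Qed.

Let pc_closed K : pc K -> closed K.
Proof. by move=> [cK _]; exact: compact_closed. Qed.

(** Induction on the number of open sets: the part of [K] outside the first [n] sets and the part
    outside [O n] are disjoint and closed. Normality puts them in disjoint open sets [U] and [V];
    then [K] minus [U] lies in the first [n] sets, [K] minus [V] lies in [O n], and together they
    make up [K]. *)
Let lam_cover (O : nat -> set T) n K : (forall i, open (O i)) -> pc K ->
  K `<=` \bigcup_(i in `I_n) O i -> ((lam K)%:E <= \sum_(i < n) inner (O i))%E.
Proof.
move=> oO; elim: n K => [|n IH] K pK KO.
  rewrite big_ord0; have -> : K = set0.
    by rewrite -subset0 => x /KO [].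
  by rewrite lam0.
pose A := K `\` \bigcup_(i in `I_n) O i; pose B := K `\` O n.
have oB : open (\bigcup_(i in `I_n) O i) by apply: bigcup_open.
have pA : pc A by exact: pcD.
have pB : pc B by exact: pcD.
have AB0 : A `&` B = set0.
  rewrite -subset0 => x [[Kx nx] [_ nOx]]; have [i /= + Ox] := KO x Kx.
  rewrite ltnS leq_eqVlt => /orP[/eqP ein|ltin]; first by apply: nOx; rewrite -ein.
  by apply: nx; exists i.
have [U [V [oU oV AU BV UV0]]] :=
  (@normal_openP R T).1 normT A B (pc_closed pA) (pc_closed pB) AB0.
have K12 : K = (K `\` U) `|` (K `\` V).
  apply/seteqP; split=> x; last by case=> -[].
  move=> Kx; have [Ux|Ux] := pselect (U x); last by left.
  right; split=> // Vx; suff : set0 x by [].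
  by rewrite -UV0.
rewrite K12 big_ord_recr/=.
apply: (@le_trans _ _ (lam (K `\` U) + lam (K `\` V))%:E).
  by rewrite lee_fin; apply: lamU_le; exact: pcD.
rewrite EFinD; apply: leeD.
  apply: IH; first exact: pcD.
  move=> x [Kx nUx]; apply: contrapT => nx.
  by apply: nUx; apply: AU.
apply: inner_ub; first exact: pcD.
move=> x [Kx nVx]; apply: contrapT => nx.
by apply: nVx; apply: BV.
Qed.

Let outer_subadd : sigma_subadditive compact_outer.
Proof.
move=> F; have [fin|] := pselect (\sum_(i <oo) compact_outer (F i) < +oo)%E; last first.
  by move=> /negP; rewrite -leNgt leye_eq => /eqP ->; rewrite leey.
apply/lee_addgt0Pr => e e0.
apply: le_trans (epsilon_trick _ (fun n => outer_ge0 (F n)) (ltW e0)).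
have lim1 i : (compact_outer (F i) < +oo)%E.
  apply: le_lt_trans fin; apply: le_trans (nneseries_lim_ge i.+1 _) => [|k _ _].
    by rewrite big_nat_recr//= leeDr// sume_ge0.
  exact: outer_ge0.
have exO i : exists O, [/\ open O, F i `<=` O &
    (inner O <= compact_outer (F i) + (e / (2 ^ i.+1)%:R)%:E)%E].
  have fi : compact_outer (F i) \is a fin_num by rewrite ge0_fin_numE.
  have [|_ [V [oO FO] <-] lt] := @lb_ereal_inf_adherent _
    [set inner O | O in [set O | open O /\ F i `<=` O]] (e / (2 ^ i.+1)%:R) _ fi.
    by rewrite divr_gt0// ltr0n expn_gt0.
  by exists V; split=> //; exact: ltW.
have [V HO] := choice exO.
have oO i : open (V i) by case: (HO i).
apply: (@le_trans _ _ (inner (\bigcup_i V i))).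
  apply: outer_lb; first by apply: bigcup_open => i _.
  by apply: subset_bigcup => i _; case: (HO i).
apply: (@le_trans _ _ (\sum_(i <oo) inner (V i))%E); last first.
  by apply: lee_nneseries => i *; [exact: inner_ge0|case: (HO i)].
apply: ge_ereal_sup => _ [K [pK KO] <-].
(* Compactness reduces the countable cover to its first [n] sets, where [lam_cover] applies. *)
have : compact K by case: pK.
rewrite compact_cover => /(_ _ [set: nat] V (fun i _ => oO i) KO) [D' _ KD].
pose n := (\max_(i <- D') i).+1.
apply: (le_trans (@lam_cover V n K oO pK _)).
  move=> x /KD [i /= iD Oix]; exists i => //=; rewrite ltnS.
  by rewrite (bigD1_seq i)//= leq_maxl.
rewrite -(big_mkord xpredT (fun i => inner (V i))).
by apply: nneseries_lim_ge => i _ _; exact: inner_ge0.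
Qed.

HB.instance Definition _ := isOuterMeasure.Build R T compact_outer
  outer0 outer_ge0 le_outer outer_subadd.

(** For compact [K] inside both [B] and [O], the set [B] minus [K] is open and contains [A] minus
    [O]; superadditivity of [lam] on [K] and on compact subsets of [B] minus [K] bounds the sum by
    [inner B]. The supremum over [K] gives Caratheodory's criterion for [O]. *)
Let inner_disj (O : set T) (A : set T) : open O -> 
  (compact_outer (A `&` O) + compact_outer (A `&` ~` O) <= compact_outer A)%E.
Proof.
move=> oO; apply: le_ereal_inf_tmp => _ [B [oB AB] <-].
apply: (@le_trans _ _ (inner (B `&` O) + compact_outer (A `&` ~` O))%E).
  rewrite leeD2r// outer_lb//; first exact: openI.
  exact: setSI.
have [/eqP ->|fin] := boolP (compact_outer (A `&` ~` O) == 0%E).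
  by rewrite adde0; apply: le_inner.
have key K : pc K -> K `<=` B `&` O ->
    ((lam K)%:E + compact_outer (A `&` ~` O) <= inner B)%E.
  move=> pK KBO.
  have oBK : open (B `\` K).
    by rewrite setDE; apply: openI => //; apply: closed_openC; exact: pc_closed.
  apply: (@le_trans _ _ ((lam K)%:E + inner (B `\` K))%E).
    rewrite leeD2l//; apply: outer_lb => // x [Ax nOx]; split; first exact: AB.
    by move=> /KBO [].
  rewrite addeC -leeBrDr//.
  apply: ge_ereal_sup => _ [K' [pK' K'B] <-].
  rewrite leeBrDr// -EFinD addrC.
  apply: (@le_trans _ _ (lam (K `|` K'))%:E).
    rewrite lee_fin; apply: lamU_ge => //.
    by rewrite -subset0 => x [Kx /K'B []].
  apply: inner_ub; first exact: pcU.
  by move=> x [/KBO[]|/K'B[]].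
have c_fin : compact_outer (A `&` ~` O) \is a fin_num \/ compact_outer (A `&` ~` O) = +oo%E.
  case: (compact_outer (A `&` ~` O)) (outer_ge0 (A `&` ~` O)) => [r _|_|//]; [by left|by right].
case: c_fin => [c_fin|coo]; last first.
  have := key set0 pc0 (@sub0set _ _); rewrite coo lam0 add0e leye_eq => /eqP ->.
  by rewrite leey.
rewrite -leeBrDr//; apply: ge_ereal_sup => _ [K [pK KBO] <-].
by rewrite leeBrDr//; exact: key.
Qed.

Let borel_cara (A : set T) : measurable (A : set (borel T)) ->
  (measurable : set (set (caratheodory_type compact_outer))) A.
Proof.
move=> mA; apply: (mA); split.
  exact: sigma_algebra_measurable.
move=> O oO; apply: le_caratheodory_measurable => X.
exact: inner_disj.
Qed.

Definition compact_measure (A : set (borel T)) : \bar R := compact_outer A.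

Let cm0 : compact_measure set0 = 0%E. Proof. exact: outer0. Qed.
Let cm_ge0 A : (0 <= compact_measure A)%E. Proof. exact: outer_ge0. Qed.
Let cm_sa : semi_sigma_additive compact_measure.
Proof.
move=> F mF tF mUF.
apply: (@caratheodory_measure_sigma_additive _ _ compact_outer) => //.
- by move=> i; exact: borel_cara.
- exact: borel_cara.
Qed.

HB.instance Definition _ := isMeasure.Build _ _ _ compact_measure cm0 cm_ge0 cm_sa.

(** [compact_measure K] is an infimum of [inner] over open neighbourhoods of [K] and may exceed
    [lam K], so only an inequality is asserted. Monotonicity of [lam] below [lam G] pins the total
    mass to 1. *)
Lemma content_extension : lam G = 1 -> exists2 mu : probability (borel T) R,
  mu G = 1%E & forall K, compact K -> K `<=` G -> ((lam K)%:E <= mu K)%E.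
Proof.
move=> lG1.
have ge_cm K : pc K -> ((lam K)%:E <= compact_measure K)%E.
  by move=> pK; apply: le_ereal_inf_tmp => _ [V [oV KV] <-]; exact: inner_ub.
have pG : pc G by split.
have muT : compact_measure setT = 1%E.
  apply/eqP; rewrite eq_le; apply/andP; split; last first.
    rewrite -lG1; apply: le_trans (ge_cm _ pG) _.
    exact: le_outer.
  apply: (@le_trans _ _ (inner setT)); first exact: outer_lb openT _.
  apply: ge_ereal_sup => _ [K [pK _] <-]; rewrite -lG1 lee_fin.
  by apply: le_lam => //; case: pK.
pose p := Measure_isProbability.Build _ _ _ compact_measure muT.
pose mu : probability (borel T) R := HB.pack compact_measure p.
exists mu => [|K cK KG]; last exact: ge_cm.
apply/eqP; rewrite eq_le; apply/andP; split; last first.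
  by rewrite -lG1; exact: ge_cm.
by rewrite -muT; exact: le_outer.
Qed.

End content_extension.

(** * Bounded measurable functions and continuous functions on compact sets *)

Section bounded_measurable.
Context d (T : measurableType d) (R : realType).
Implicit Types (D : set T) (f g : T -> R).

Definition bounded_on D f := exists M : R, forall x, D x -> `|f x| <= M.

(** Such functions are integrable against every probability, so their integrals can be taken in the
    reals, with linearity and monotonicity always available. *)
Definition bmeas D f := measurable_fun D f /\ bounded_on D f.

Lemma bmeas_cst D r : bmeas D (fun=> r).
Proof. by split; [exact: measurable_cst|exists `|r|]. Qed.

Lemma bmeasD D f g : bmeas D f -> bmeas D g -> bmeas D (fun x => f x + g x).
Proof.
move=> [mf [M fM]] [mg [N gN]]; split; first exact: measurable_funD.
by exists (M + N) => x Dx; apply: le_trans (ler_normD _ _) _; rewrite lerD ?fM ?gN.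
Qed.

Lemma bmeasZ D f r : bmeas D f -> bmeas D (fun x => r * f x).
Proof.
move=> [mf [M fM]]; split; first by apply: measurable_funM.
by exists (`|r| * M) => x Dx; rewrite normrM ler_wpM2l ?fM.
Qed.

Lemma bmeasB D f g : bmeas D f -> bmeas D g -> bmeas D (fun x => f x - g x).
Proof.
have -> : (fun x => f x - g x) = (fun x => f x + -1 * g x).
  by apply/funext => x; rewrite mulN1r.
by move=> bf bg; exact: bmeasD bf (bmeasZ _ bg).
Qed.

Lemma bmeas_indic D (A : set T) : measurable A -> bmeas D \1_A.
Proof.
move=> mA; split; first exact: measurable_indic.
by exists 1 => x _; rewrite indicE; case: (_ \in _); rewrite ?normr1 ?normr0.
Qed.

Lemma eq_bmeas D f g : measurable D -> {in D, f =1 g} -> bmeas D f -> bmeas D g.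
Proof.
move=> mD fg [mf [M fM]]; split.
  by apply: eq_measurable_fun mf => x xD; exact: fg.
by exists M => x Dx; rewrite -fg ?inE//; exact: fM.
Qed.

Lemma bmeas_sum D (I : eqType) (r : seq I) (F : I -> T -> R) : measurable D ->
  (forall i, i \in r -> bmeas D (F i)) -> bmeas D (fun x => \sum_(i <- r) F i x).
Proof.
move=> mD; elim: r => [|j s bs] bF.
  by apply: eq_bmeas (bmeas_cst D 0) => // x _; rewrite big_nil.
have bs' : bmeas D (fun x => \sum_(i <- s) F i x).
  by apply: bs => i si; apply: bF; rewrite inE si orbT.
apply: eq_bmeas (bmeasD (bF j _) bs') => //; last by rewrite mem_head.
by move=> x _; rewrite big_cons.
Qed.

Variables (mu : probability T R).

Lemma bmeas_integrable D f : measurable D -> bmeas D f ->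
  mu.-integrable D (EFin \o f).
Proof.
move=> mD [mf [M fM]]; apply: measurable_bounded_integrable => //.
  by apply: le_lt_trans (probability_le1 _ mD) _; rewrite ltry.
exists M; split=> [|r Mr x Dx]; first exact: num_real.
exact: le_trans (fM x Dx) (ltW Mr).
Qed.

Variable D : set T.
Hypotheses (mD : measurable D) (muD : mu D = 1%E).

Lemma Rintegral_cst1 r : \int[mu]_(x in D) r = r.
Proof. by rewrite Rintegral_cst// [X in fine X](_ : _ = 1%E)//= mulr1. Qed.

Lemma Rintegral_le_cst f r : bmeas D f -> (forall x, D x -> f x <= r) ->
  \int[mu]_(x in D) f x <= r.
Proof.
move=> bf fr; rewrite -[leRHS]Rintegral_cst1.
apply: le_Rintegral => //; first exact: bmeas_integrable.
by apply: bmeas_integrable => //; exact: bmeas_cst.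
Qed.

Lemma Rintegral_ge_cst f r : bmeas D f -> (forall x, D x -> r <= f x) ->
  r <= \int[mu]_(x in D) f x.
Proof.
move=> bf fr; rewrite -[leLHS]Rintegral_cst1.
apply: le_Rintegral => //; last exact: bmeas_integrable.
by apply: bmeas_integrable => //; exact: bmeas_cst.
Qed.

Lemma Rintegral_abs_le f r : bmeas D f -> (forall x, D x -> `|f x| <= r) ->
  `|\int[mu]_(x in D) f x| <= r.
Proof.
move=> bf fr; rewrite ler_norml Rintegral_ge_cst ?Rintegral_le_cst// => x Dx.
  by have := fr x Dx; rewrite ler_norml => /andP[].
by have := fr x Dx; rewrite ler_norml => /andP[].
Qed.

Lemma Rintegral_sum (I : eqType) (r : seq I) (F : I -> T -> R) :
  (forall i, i \in r -> bmeas D (F i)) ->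
  \int[mu]_(x in D) (\sum_(i <- r) F i x) = \sum_(i <- r) \int[mu]_(x in D) F i x.
Proof.
elim: r => [|i r IH] bF.
  under eq_Rintegral do rewrite big_nil.
  by rewrite Rintegral_cst1 big_nil.
under eq_Rintegral do rewrite big_cons.
have bF' j : j \in r -> bmeas D (F j) by move=> rj; apply: bF; rewrite inE rj orbT.
have bS := bmeas_sum mD bF'.
rewrite RintegralD ?big_cons ?IH//; apply: bmeas_integrable => //.
by apply: bF; rewrite mem_head.
Qed.

Lemma Rintegral_indic (A : set T) : measurable A ->
  \int[mu]_(x in D) \1_A x = fine (mu (A `&` D)).
Proof. by move=> mA; rewrite /Rintegral integral_indic. Qed.

Lemma bounded_convergence (f_ : nat -> T -> R) f (M : R) :
  (forall n, measurable_fun D (f_ n)) -> (forall n x, D x -> `|f_ n x| <= M) ->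
  (forall x, D x -> f_ ^~ x @ \oo --> f x) ->
  bmeas D f /\ \int[mu]_(x in D) f_ n x @[n --> \oo] --> \int[mu]_(x in D) f x.
Proof.
move=> mf fM cf; have bf : bmeas D f.
  split; first exact: measurable_fun_cvg mf cf.
  exists M => x Dx.
  apply: (@closed_cvg _ _ _ eventually_filter (f_ ^~ x) (fun y => `|y| <= M)) (cf x Dx).
  - apply: (@preimage_closed _ _ (fun y : R => `|y|) [set y | y <= M]); last exact: closed_le.
    by move=> y _; exact: norm_continuous.
  - by near=> n; exact: fM.
split=> //.
have [] := @dominated_convergence _ T R mu D mD (fun n => EFin \o f_ n) (EFin \o f) (EFin \o cst M).
- by move=> n; exact/measurable_EFinP.
- by case: bf => ? _; exact/measurable_EFinP.
- by apply: aeW => x Dx; apply: cvg_EFin; [exact: nearW|exact: cf].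
- exact: finite_measure_integrable_cst.
- by apply: aeW => x n Dx; rewrite lee_fin fM.
have fin := integrable_fin_num mD (bmeas_integrable mD bf).
by move=> _ _; rewrite -(fineK fin) => /fine_cvg.
Unshelve. all: by end_near. Qed.

End bounded_measurable.

Section cont_on_bounded.
Context {R : realType} {T : ptopologicalType}.
Variables (G : set T).
Hypotheses (hT : hausdorff_space T) (cG : compact G).

Lemma cont_on_bounded (phi : T -> R) : cont_on G phi -> bounded_on (G : set (borel T)) phi.
Proof.
move=> cphi; have /compact_bounded[M [_ HM]] := continuous_compact cphi cG.
exists (M + 1) => x Gx; apply: HM; first by rewrite ltrDl.
by exists x.
Qed.

Lemma cont_on_bmeas (phi : T -> R) : cont_on G phi -> bmeas (G : set (borel T)) phi.
Proof.
move=> cphi; split; last exact: cont_on_bounded.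
by apply: measurable_fun_cont_on => //; exact: compact_closed.
Qed.

Lemma cont_on_cst (r : R) : cont_on G (fun=> r).
Proof. by move=> x; exact: cvg_cst. Qed.

Lemma cont_onD (f g : T -> R) : cont_on G f -> cont_on G g ->
  cont_on G (fun x => f x + g x).
Proof. by move=> cf cg x; apply: cvgD; [exact: cf|exact: cg]. Qed.

Lemma cont_onZ (f : T -> R) r : cont_on G f -> cont_on G (fun x => r * f x).
Proof. by move=> cf x; apply: cvgM; [exact: cvg_cst|exact: cf]. Qed.

End cont_on_bounded.

(** * Limits along ultrafilters *)

(** The image ultrafilter has a cluster point in the compact segment, and an ultrafilter converges
    to each of its cluster points. *)
Lemma ultra_cvg_bounded (X : Type) (R : realType) (F : set_system X) (g : X -> R) (M : R) :
  UltraFilter F -> F [set x | `|g x| <= M] -> exists l : R, g @ F --> l.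
Proof.
move=> UF FM; have PF : ProperFilter F by exact: ultra_proper.
have [] := @segment_compact R (- M) M (g @ F).
  by apply: (@filterS _ F _ _ _ _ FM) => x; rewrite /= in_itv/= -ler_norml.
move=> l [_ gl]; exists l => B Bl.
have [//|FnB] := in_ultra_setVsetC (g @^-1` B) UF.
have [y [/= nBy By]] := gl (~` B) B FnB Bl.
by [].
Qed.

Lemma ler_cvg_to (X : Type) (R : realType) (F : set_system X) (f g : X -> R)
    (a b : R) : ProperFilter F -> f @ F --> a -> g @ F --> b ->
  F [set x | f x <= g x] -> a <= b.
Proof.
move=> PF fa gb Fle; rewrite -subr_le0; apply: (cvgr_to_le (cvgB fa gb)).
by apply: (@filterS _ F _ _ _ _ Fle) => x /= fg; rewrite subr_le0.
Qed.

Section weak_star_compactness.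
Context {R : realType} {T : ptopologicalType}.
Variable G : set T.
Hypotheses (hT : hausdorff_space T) (nT : normal_space T) (cG : compact G).

Let mG : measurable (G : set (borel T)).
Proof. by apply: closed_borel; exact: compact_closed. Qed.

(** The sum counts the integers from 1 to [N] that are at most [x], so it is the minimum of [N] and
    the integer part of [x]; the last conclusion serves the induction. *)
Lemma count_floor (N : nat) (x : R) : 0 <= x ->
  let c := \sum_(i < N) (i.+1%:R <= x)%R%:R in
  [/\ c <= x, x <= N%:R -> x <= c + 1 & N%:R <= x -> c = N%:R].
Proof.
move=> x0 /=; elim: N => [|N [IH1 IH2 IH3]].
  by rewrite big_ord0; split=> //; rewrite add0r => /le_trans; apply.
rewrite big_ord_recr/=; have [Nx|xN] := leP (N.+1%:R) x.
  have Nx' : N%:R <= x by apply: le_trans Nx; rewrite ler_nat.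
  rewrite IH3//= -natr1 in Nx *; split=> //.
  by move=> xN; rewrite -natr1; lra.
rewrite addr0; split=> // xN1.
have [/IH2//|Nx] := leP x N%:R.
by rewrite (IH3 (ltW Nx)) natr1; exact: ltW.
Qed.

(** Pointwise, [N.+1%:R * phi z] exceeds the number of integer levels that it reaches by at most 1;
    integration turns this count into masses of closed superlevel sets. *)
Lemma layer_cake_bound (phi : T -> R) (N : nat) (nu : probability (borel T) R) :
  probs_on G nu -> cont_on G phi -> (forall z, G z -> 0 <= phi z <= 1) ->
  let S := N.+1%:R^-1 *
    \sum_(i < N.+1) fine (nu (G `&` phi @^-1` [set y | i.+1%:R / N.+1%:R <= y])) in
  S <= \int[nu]_(z in G) phi z <= S + N.+1%:R^-1.
Proof.
move=> nuG cphi phi01 /=; set S := _ * \sum_(i < _) _.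
pose K i := G `&` phi @^-1` [set y | i.+1%:R / N.+1%:R <= y].
have mK i : measurable (K i : set (borel T)).
  apply: closed_borel.
  exact: (closed_preimage_within (compact_closed hT cG) cphi (@closed_ge _ _)).
pose g z : R := N.+1%:R^-1 * \sum_(i < N.+1) \1_(K i) z.
have bI (i : 'I_N.+1) : bmeas (G : set (borel T)) (\1_(K i) : T -> R) by exact: bmeas_indic.
have bS : bmeas (G : set (borel T)) (fun z => \sum_(i < N.+1) (\1_(K i) z : R)).
  exact: bmeas_sum.
have bg : bmeas (G : set (borel T)) g by exact: bmeasZ.
have bphi := cont_on_bmeas hT cG cphi.
have SE : S = \int[nu]_(z in G) g z.
  rewrite RintegralZl//; last exact: bmeas_integrable.
  rewrite Rintegral_sum//; congr (_ * _); apply: eq_bigr => i _.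
  by rewrite Rintegral_indic//; congr (fine (nu _)); rewrite setIAC setIid.
have gphi z : G z -> g z <= phi z <= g z + N.+1%:R^-1.
  move=> Gz; have /andP[p0 p1] := phi01 z Gz.
  have N0 : 0 < N.+1%:R :> R by rewrite ltr0n.
  have xN0 : 0 <= N.+1%:R * phi z by rewrite mulr_ge0// ltW.
  have [c1 c2 _] := count_floor N.+1 xN0.
  have gE : g z = N.+1%:R^-1 * \sum_(i < N.+1) (i.+1%:R <= N.+1%:R * phi z)%R%:R.
    congr (_ * _); apply: eq_bigr => i _; rewrite indicE; congr (_%:R).
    have -> : (z \in K i) = (i.+1%:R / N.+1%:R <= phi z).
      by apply/idP/idP => [|h]; rewrite inE; [case|split].
    by rewrite ler_pdivrMr// mulrC.
  rewrite gE; apply/andP; split.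
    by rewrite ler_pdivrMl//; exact: c1.
  rewrite -[X in _ <= _ + X]mulr1 -mulrDr ler_pdivlMl//; apply: c2.
  by rewrite -[leRHS]mulr1 ler_wpM2l// ltW.
rewrite SE; apply/andP; split.
  apply: le_Rintegral => //; try exact: bmeas_integrable.
  by move=> z /gphi/andP[].
have bc := bmeas_cst (G : set (borel T)) (N.+1%:R^-1 : R).
rewrite -[X in _ <= _ + X](Rintegral_cst1 mG nuG) -RintegralD//; try exact: bmeas_integrable.
apply: le_Rintegral => //; try exact: bmeas_integrable.
  by apply: bmeas_integrable => //; exact: bmeasD.
by move=> z /gphi/andP[].
Qed.

(* The limits of [nu K], [K] compact, along the ultrafilter [F] form a content on
   compact sets; the measure it generates dominates it on compact sets, and
   the layer-cake formula applied to [phi] and to [1 - phi] turns that one-sided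
   comparison into convergence of integrals. *)
Lemma weak_star_compact (F : set_system (probability (borel T) R)) :
  UltraFilter F -> F (probs_on G) ->
  exists2 mu, probs_on G mu & forall phi, cont_on G phi ->
    (fun nu : probability (borel T) R => \int[nu]_(z in G) phi z) @ F -->
    \int[mu]_(z in G) phi z.
Proof.
move=> UF FG; have PF : ProperFilter F by exact: ultra_proper.
have exl K : exists l : R, measurable (K : set (borel T)) ->
    (fun nu : probability (borel T) R => fine (nu K)) @ F --> l.
  have [mK|nK] := pselect (measurable (K : set (borel T))); last by exists 0.
  have [|l Fl] := @ultra_cvg_bounded _ R F (fun nu : probability (borel T) R => fine (nu K)) 1 UF.
    apply: nearW => nu /=; rewrite ger0_norm ?fine_ge0//.
    by rewrite -lee_fin fineK ?fin_num_measure// probability_le1.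
  by exists l.
have [lam Hlam] := choice exl.
have mc K : compact K /\ K `<=` G -> measurable (K : set (borel T)).
  by move=> [cK _]; apply: closed_borel; exact: compact_closed.
have fU (nu : probability (borel T) R) A : measurable (A : set (borel T)) ->
    nu A = (fine (nu A))%:E.
  by move=> mA; rewrite fineK// fin_num_measure.
have lam_le K K' : measurable (K : set (borel T)) -> measurable (K' : set (borel T)) ->
    K `<=` K' -> lam K <= lam K'.
  move=> mK mK' KK'; apply: (ler_cvg_to PF (Hlam K mK) (Hlam K' mK')).
  apply: nearW => nu /=; rewrite fine_le ?fin_num_measure//.
  by apply: le_measure => //; rewrite inE.
have lamG : lam G = 1.
  apply: (cvg_unique (@Rhausdorff R) (Hlam G mG)).
  apply: cvg_near_cst; apply: (@filterS _ F _ _ _ _ FG) => nu nuG.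
  by rewrite /= nuG.
have lam0 : lam set0 = 0.
  apply: (cvg_unique (@Rhausdorff R) (Hlam set0 measurable0)).
  by apply: cvg_near_cst; apply: nearW => nu; rewrite measure0.
have [K K' /mc mK /mc mK'|K K' /mc mK /mc mK'|K K' /mc mK /mc mK' KK'|mu muG muK] :=
    @content_extension R T G lam hT nT cG lam0 _ _ _ lamG.
- exact: lam_le.
- apply: (ler_cvg_to PF (Hlam _ (measurableU _ _ mK mK')) (cvgD (Hlam _ mK) (Hlam _ mK'))).
  apply: nearW => nu /=; rewrite -lee_fin EFinD -!fU//; last exact: measurableU.
  exact: measureU2.
- apply: (ler_cvg_to PF (cvgD (Hlam _ mK) (Hlam _ mK')) (Hlam _ (measurableU _ _ mK mK'))).
  apply: nearW => nu /=; rewrite -lee_fin EFinD -!fU//; last exact: measurableU.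
  by rewrite measureU.
exists mu => // .
have key phi (l : R) : cont_on G phi -> (forall z, G z -> 0 <= phi z <= 1) ->
    (fun nu : probability (borel T) R => \int[nu]_(z in G) phi z) @ F --> l ->
    l <= \int[mu]_(z in G) phi z.
  move=> cphi phi01 phil; apply/ler_addgt0Pr => e e0.
  have [N Ne] : exists N, N.+1%:R^-1 < e.
    by have [N _ /(_ N (leqnn N))] := @near_infty_natSinv_lt R (PosNum e0); exists N.
  pose K i := G `&` phi @^-1` [set y | i.+1%:R / N.+1%:R <= y].
  have cK i : closed (K i).
    exact: (closed_preimage_within (compact_closed hT cG) cphi (@closed_ge _ _)).
  have mK i : measurable (K i : set (borel T)) by exact: closed_borel.
  (* The layer-cake sum of the content: at most the sum for [mu], by domination on compact sets, and
     the limit along [F] of the sums for [nu]. *)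
  pose Sl : R := N.+1%:R^-1 * \sum_(i < N.+1) lam (K i).
  have Slmu : Sl <= \int[mu]_(z in G) phi z.
    have /andP[+ _] := layer_cake_bound N muG cphi phi01; apply: le_trans.
    apply: ler_wpM2l => //; apply: ler_sum => i _.
    rewrite -lee_fin fineK; last by apply: fin_num_measure; exact: mK.
    apply: muK; last exact: subIsetl.
    have -> : K i = G `&` K i by rewrite setIA setIid.
    exact: compact_closedI.
  apply: (@le_trans _ _ (Sl + e)); last by rewrite lerD2r.
  apply: (@le_trans _ _ (Sl + N.+1%:R^-1)); last by rewrite lerD2l ltW.
  have cS : (fun nu : probability (borel T) R => N.+1%:R^-1 *
      \sum_(i < N.+1) fine (nu (K i)) + N.+1%:R^-1) @ F --> Sl + N.+1%:R^-1.
    apply: cvgD; last exact: cvg_cst.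
    apply: cvgM; first exact: cvg_cst.
    apply: cvg_big => [|i _]; [exact: add_continuous|exact: Hlam].
  apply: (ler_cvg_to PF phil cS); apply: (@filterS _ F _ _ _ _ FG) => nu nuG.
  by have /andP[] := layer_cake_bound N nuG cphi phi01.
have key2 phi : cont_on G phi -> (forall z, G z -> 0 <= phi z <= 1) ->
    (fun nu : probability (borel T) R => \int[nu]_(z in G) phi z) @ F -->
    \int[mu]_(z in G) phi z.
  move=> cphi phi01.
  have b1 : F [set nu : probability (borel T) R | `|\int[nu]_(z in G) phi z| <= 1].
    apply: (@filterS _ F _ _ _ _ FG) => nu nuG; apply: Rintegral_abs_le => //.
      exact: cont_on_bmeas.
    by move=> z /phi01/andP[p0 p1]; rewrite ger0_norm.
  have [l phil] := ultra_cvg_bounded UF b1.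
  have c1 : cont_on G (fun z => 1 - phi z).
    have -> : (fun z => 1 - phi z) = (fun z => 1 + -1 * phi z).
      by apply/funext => z; rewrite mulN1r.
    by apply: cont_onD; [exact: cont_on_cst|exact: cont_onZ].
  have int1 (nu : probability (borel T) R) : probs_on G nu ->
      \int[nu]_(z in G) (1 - phi z) = 1 - \int[nu]_(z in G) phi z.
    move=> nuG; rewrite RintegralB// ?Rintegral_cst1//.
      by apply: bmeas_integrable => //; exact: bmeas_cst.
    by apply: bmeas_integrable => //; exact: cont_on_bmeas.
  have H2 := key phi l cphi phi01 phil.
  have H1 : 1 - l <= \int[mu]_(z in G) (1 - phi z).
    apply: key => // [z /phi01/andP[p0 p1]|]; first by apply/andP; split; lra.
    apply: (@cvg_trans _ ((fun nu : probability (borel T) R => 1 - \int[nu]_(z in G) phi z) @ F)).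
      apply: near_eq_cvg; apply: (@filterS _ F _ _ _ _ FG) => nu nuG; by rewrite int1.
    by apply: cvgB => //; exact: cvg_cst.
  rewrite int1// in H1.
  suff <- : l = \int[mu]_(z in G) phi z by [].
  lra.
move=> phi cphi; have [M phiM] := cont_on_bounded cG cphi.
(* The added 1 keeps [M'] positive, so that [psi] is an affine rescaling of [phi] into the unit
   interval. *)
pose M' := `|M| + 1.
have M'0 : 0 < M' by rewrite ltr_wpDl.
have phiM' z : G z -> `|phi z| <= M'.
  by move=> /phiM /le_trans; apply; rewrite ler_wpDr// ler_norm.
pose psi z := (2 * M')^-1 * (phi z + M').
have cpsi : cont_on G psi.
  by apply: cont_onZ; apply: cont_onD => //; exact: cont_on_cst.
have psi01 z : G z -> 0 <= psi z <= 1.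
  move=> /phiM'; rewrite ler_norml => /andP[h1 h2].
  apply/andP; split; first by apply: mulr_ge0; [rewrite invr_ge0; lra|lra].
  by rewrite ler_pdivrMl ?mulr_gt0//; lra.
have intphi (nu : probability (borel T) R) : probs_on G nu ->
    \int[nu]_(z in G) phi z = 2 * M' * \int[nu]_(z in G) psi z - M'.
  move=> nuG; rewrite /psi RintegralZl//; last first.
    apply: bmeas_integrable => //; apply: cont_on_bmeas => //.
    by apply: cont_onD => //; exact: cont_on_cst.
  rewrite mulrA divff ?mul1r; last by rewrite gt_eqF// mulr_gt0.
  rewrite RintegralD//; last 2 first.
    by apply: bmeas_integrable => //; exact: cont_on_bmeas.
    by apply: bmeas_integrable => //; exact: bmeas_cst.
  by rewrite Rintegral_cst1// addrK.
rewrite intphi//.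
apply: (@cvg_trans _
  ((fun nu : probability (borel T) R => 2 * M' * \int[nu]_(z in G) psi z - M') @ F)).
  apply: near_eq_cvg; apply: (@filterS _ F _ _ _ _ FG) => nu nuG; by rewrite intphi.
apply: cvgB; last exact: cvg_cst.
by apply: cvgM; [exact: cvg_cst|exact: key2].
Qed.
End weak_star_compactness.

(** * Convex hulls of measures *)

Section mixture.
Context d (T : measurableType d) (R : realType).
Variables (w : nat -> R) (nu : nat -> probability T R).
Hypotheses (w_ge0 : forall t, 0 <= w t) (w_sum : series w @ \oo --> (1 : R)).

Let wm t : measure T R := mscale (NngNum (w_ge0 t)) (nu t).

Let wmE t A : wm t A = ((w t)%:E * nu t A)%E.
Proof. by []. Qed.

Let eseries_cvg (u : nat -> R) (l : R) : (forall t, 0 <= u t) ->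
  series u @ \oo --> l <-> (\sum_(t <oo) (u t)%:E)%E = l%:E.
Proof.
move=> u0; have cu : ((fun n => \sum_(0 <= t < n) (u t)%:E)%E @ \oo) -->
    (\sum_(t <oo) (u t)%:E)%E.
  by apply: is_cvg_nneseries => t _ _; rewrite lee_fin.
have E : (fun n => \sum_(0 <= t < n) (u t)%:E)%E = EFin \o series u.
  by apply/funext => n; rewrite /series/= sumEFin.
split=> [ul|ul].
  apply: (cvg_unique (@ereal_hausdorff R) cu); rewrite E.
  by apply: cvg_EFin => //; exact: nearW.
by move: cu; rewrite ul E => /fine_cvg.
Qed.

Lemma mixture_exists : exists mu : probability T R,
  forall A, mu A = (\sum_(t <oo) (w t)%:E * nu t A)%E.
Proof.
have m1 : mseries wm 0 setT = 1%E.
  rewrite /mseries; under eq_eseriesr do rewrite wmE probability_setT mule1.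
  exact/eseries_cvg.
pose p := Measure_isProbability.Build _ _ _ (mseries wm 0) m1.
pose mu : probability T R := HB.pack (mseries wm 0) p.
by exists mu.
Qed.

Lemma mixture_integral (mu : probability T R) (D : set T) (phi : T -> R) :
  measurable D -> (forall t, nu t D = 1%E) -> mu D = 1%E ->
  (forall A, measurable A -> A `<=` D ->
     mu A = (\sum_(t <oo) (w t)%:E * nu t A)%E) -> bmeas D phi ->
  series (fun t => w t * \int[nu t]_(z in D) phi z) @ \oo -->
    \int[mu]_(z in D) phi z.
Proof.
move=> mD nuD muD muE [mphi [M phiM]].
have ge0 (psi : T -> R) : bmeas D psi -> (forall z, D z -> 0 <= psi z) ->
    series (fun t => w t * \int[nu t]_(z in D) psi z) @ \oo -->
    \int[mu]_(z in D) psi z.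
  move=> bpsi psi0; apply/eseries_cvg.
    by move=> t; rewrite mulr_ge0// Rintegral_ge0.
  have fin (m : probability T R) : (\int[m]_(z in D) psi z)%:E = (\int[m]_(z in D) (psi z)%:E)%E.
    by rewrite fineK//; apply: integrable_fin_num => //; exact: bmeas_integrable.
  rewrite fin (eq_measure_integral (mseries wm 0)); last first.
    by move=> A mA AD; exact: muE.
  rewrite ge0_integral_measure_series//; last by case: bpsi => /measurable_EFinP.
  apply: eq_eseriesr => t _; rewrite EFinM fin.
  by rewrite ge0_integral_mscale//; case: bpsi => /measurable_EFinP.
have bphi : bmeas D phi by split=> //; exists M.
have bM (r : R) : bmeas D (fun=> r) by exact: bmeas_cst.
have := ge0 _ (bmeasD bphi (bM `|M|)).
have intM (m : probability T R) : m D = 1%E ->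
    \int[m]_(z in D) (phi z + `|M|) = \int[m]_(z in D) phi z + `|M|.
  move=> mD1; rewrite RintegralD//; try exact: bmeas_integrable.
  by rewrite Rintegral_cst1.
rewrite intM//.
have H0 z : D z -> 0 <= phi z + `|M|.
  move=> Dz; rewrite -lerBlDr sub0r; have := phiM z Dz; rewrite ler_norml => /andP[+ _].
  by apply: le_trans; rewrite lerN2 ler_norm.
move=> /(_ H0) c1.
have c2 : (fun n => `|M| * series w n) @ \oo --> `|M| * 1.
  by apply: cvgM => //; exact: cvg_cst.
have -> : series (fun t => w t * \int[nu t]_(z in D) phi z) = (fun n =>
    series (fun t => w t * \int[nu t]_(z in D) (phi z + `|M|)) n - `|M| * series w n).
  apply/funext => k; rewrite /series/= mulr_sumr -sumrB; apply: eq_bigr => t _.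
  by rewrite intM// mulrDr (mulrC `|M|) addrK.
rewrite mulr1 in c2; rewrite -[X in _ --> X](addrK `|M|).
exact: cvgB c1 c2.
Qed.

End mixture.

Section weak_star_nbhs.
Context {R : realType} {T : ptopologicalType}.
Variable G : set T.
Local Notation prob := (probability (borel T) R).
Local Notation gint nu phi := (Rintegral (nu : prob) (G : set (borel T)) (phi : T -> R)).

(** The sets cut out by finitely many test functions and one tolerance form a filter base along
    which every coordinate of [integrals] converges; convergence in the product topology then puts
    one of them inside any given neighbourhood. *)
Lemma weak_star_nbhs (mu : prob) (B : set (weak_star G)) :
  nbhs (mu : weak_star G) B ->
  exists (l : seq (T -> R)) (e : R), [/\ 0 < e,
    (forall phi : T -> R, phi \in l -> cont_on G phi) &
    forall nu : prob, (forall phi : T -> R, phi \in l ->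
      `|gint nu phi - gint mu phi| < e) -> B nu].
Proof.
pose basis := [set le : seq (T -> R) * R | 0 < le.2 /\
  forall phi : T -> R, phi \in le.1 -> cont_on G phi].
pose near (le : seq (T -> R) * R) : set prob := [set nu : prob |
  forall phi : T -> R, phi \in le.1 -> `|gint nu phi - gint mu phi| < le.2].
pose F := filter_from basis near.
have FF : Filter F.
  apply: filter_from_filter; first by exists ([::], 1) => //=; split.
  move=> [l e] [l' e'] [/= e0 cl] [/= e0' cl']; exists (l ++ l', Num.min e e').
    split=> /=; first by rewrite lt_min e0.
    by move=> phi; rewrite mem_cat => /orP[/cl|/cl'].
  move=> nu /= H; split=> phi /= pl.
    by have := H phi; rewrite mem_cat pl lt_min => /(_ isT)/andP[].
  by have := H phi; rewrite mem_cat pl orbT lt_min => /(_ isT)/andP[].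
have cF : (@integrals R T G) @ F --> (integrals mu : {ptws set_type (cont_on G) -> R}).
  apply/cvg_sup => phi B' /= [C [[V oV <-] Vmu] CB'].
  have /nbhs_ballP[e /= e0 eV] : nbhs (integrals mu phi) V by exact: open_nbhs_nbhs.
  exists ([:: set_val phi], e).
    by split=> //= psi; rewrite inE => /eqP ->; exact: set_valP.
  move=> nu /= H; apply: CB' => /=; apply: eV; rewrite /ball/= distrC.
  by apply: H; rewrite inE.
move=> [C [[V oV <-] Vmu] CB].
have [[l e] [/= e0 cl] H] : F (@integrals R T G @^-1` V).
  by apply: cF; exact: open_nbhs_nbhs.
by exists l, e; split=> // nu Hnu; apply: CB; exact: H.
Qed.

Lemma nbhs_weak_star (mu : prob) (phi : T -> R) (e : R) : cont_on G phi -> 0 < e ->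
  nbhs (mu : weak_star G) [set nu | `|gint nu phi - gint mu phi| < e].
Proof.
move=> cphi e0; pose p : set_type (cont_on G) := SigSub (mem_set cphi).
have c1 : continuous (@integrals R T G : weak_star G -> _).
  exact: initial_continuous.
pose V : set {ptws set_type (cont_on G) -> R} :=
  [set h | `|h p - gint mu phi| < e].
suff nV : nbhs (integrals mu : {ptws set_type (cont_on G) -> R}) V by exact: (c1 mu V nV).
have : (nbhs (integrals mu : {ptws set_type (cont_on G) -> R})) -->
    (integrals mu : {ptws set_type (cont_on G) -> R}) by exact: cvg_id.
move=> /cvg_sup/(_ p)/(_ V); apply.
exists ((fun f : forall i : set_type (cont_on G), R => f p) @^-1` (ball (gint mu phi) e)).
  split; first by exists (ball (gint mu phi) e) => //; exact: ball_open.
  exact: ballxx.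
by move=> h /=; rewrite /ball/= distrC.
Qed.

End weak_star_nbhs.

Section closed_convex_hulls.
Context {R : realType} {T : ptopologicalType}.
Variables (G : set T) (A : set (probability (borel T) R)).
Hypotheses (hT : hausdorff_space T) (cG : compact G) (AG : A `<=` probs_on G).
Local Notation prob := (probability (borel T) R).
Local Notation gint nu phi := (Rintegral (nu : prob) (G : set (borel T)) (phi : T -> R)).
Local Notation bmG := (bmeas (G : set (borel T))).

Let mG : measurable (G : set (borel T)).
Proof. by apply: closed_borel; exact: compact_closed. Qed.

(** Padding with zero weights (and the arbitrary measure [nu0]) makes a finite convex combination a
    countable mixture, so one theory of mixtures serves convex hulls and occupational measures. Sums
    are recovered in the reals, for integrals, and in the extended reals, for masses. *)
Lemma finite_mixture (m : nat) (c : 'I_m -> R) (nu : 'I_m -> prob) (nu0 : prob) :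
  (forall i, 0 <= c i) -> \sum_(i < m) c i = 1 ->
  exists (w : nat -> R) (nu' : nat -> prob),
    [/\ (forall t, 0 <= w t), series w @ \oo --> (1 : R),
      (forall t, nu' t = nu0 \/ exists i, nu' t = nu i),
      (forall f : prob -> R, series (fun t => w t * f (nu' t)) @ \oo -->
         \sum_(i < m) c i * f (nu i)) &
      forall f : prob -> \bar R,
        (\sum_(t <oo) (w t)%:E * f (nu' t) = \sum_(i < m) (c i)%:E * f (nu i))%E].
Proof.
move=> c0 c1.
pose w t := if insub t is Some i then c i else 0.
pose nu' t := if insub t is Some i then nu i else nu0.
have bigE (V : nmodType) (F : nat -> V) n : (forall t, (m <= t)%N -> F t = 0) ->
    (m <= n)%N -> \sum_(0 <= t < n) F t = \sum_(i < m) F i.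
  move=> F0 mn; rewrite -(big_mkord xpredT F) (big_cat_nat _ mn)//=.
  rewrite [X in _ + X]big_nat_cond [X in _ + X]big1 ?addr0//.
  by move=> i /andP[/andP[mi _] _]; exact: F0.
have wE (i : 'I_m) : w i = c i by rewrite /w valK.
have nuE (i : 'I_m) : nu' i = nu i by rewrite /nu' valK.
have w0 t : (m <= t)%N -> w t = 0.
  by move=> mt; rewrite /w insubF//; apply/negbTE; rewrite -leqNgt.
exists w, nu'; split.
- by move=> t; rewrite /w; case: insubP.
- apply: cvg_near_cst; exists m => // n /= mn.
  by rewrite /series/= (bigE _ _ _ w0 mn) -c1; apply: eq_bigr.
- by move=> t; rewrite /nu'; case: insubP => [i _ _|_]; [right; exists i|left].
- move=> f; apply: cvg_near_cst; exists m => // n /= mn.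
  rewrite /series/= (bigE _ _ _ _ mn); last by move=> t mt; rewrite w0// mul0r.
  by apply: eq_bigr => i _; rewrite wE nuE.
- move=> f; apply/cvg_lim => //; apply: cvg_near_cst; exists m => // n /= mn.
  rewrite (bigE _ _ _ _ mn); last by move=> t mt; rewrite w0// mul0e.
  by apply: eq_bigr => i _; rewrite wE nuE.
Qed.

Lemma convex_combination_integral (m : nat) (c : 'I_m -> R) (nu : 'I_m -> prob)
    (mu : prob) : (forall i, 0 <= c i) -> \sum_(i < m) c i = 1 ->
  (forall i, probs_on G (nu i)) ->
  (forall Q : set (borel T), measurable Q -> mu Q = (\sum_(i < m) (c i)%:E * nu i Q)%E) ->
  probs_on G mu /\
  forall phi : T -> R, bmG phi -> gint mu phi = \sum_(i < m) c i * gint (nu i) phi.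
Proof.
move=> c0 c1 nuG muE.
have muG : probs_on G mu.
  rewrite /probs_on/= muE//; under eq_bigr do rewrite nuG mule1.
  by rewrite sumEFin c1.
split=> // phi bphi.
have [w [nu' [w_ge0 w_sum nu'E wR wE]]] := finite_mixture nu mu c0 c1.
have cv : series (fun t => w t * gint (nu' t) phi) @ \oo --> gint mu phi.
  apply: (mixture_integral w_ge0 w_sum) => //.
    by move=> t; case: (nu'E t) => [->//|[i ->]]; exact: nuG.
  by move=> Q mQ _; rewrite muE// (wE (fun nu => nu Q)).
exact: (cvg_unique (@Rhausdorff R) cv (wR (fun nu => gint nu phi))).
Qed.

Lemma convex_hull_le (phi : T -> R) (b : R) (mu : prob) : bmG phi ->
  (forall nu, A nu -> gint nu phi <= b) -> convex_hull A mu -> gint mu phi <= b.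
Proof.
move=> bphi Ab [m [c [nu [c0 c1 nuA muE]]]].
have [_ ->//] := convex_combination_integral c0 c1 (fun i => AG (nuA i)) muE.
rewrite -[leRHS]mul1r -c1 mulr_suml; apply: ler_sum => i _.
by apply: ler_wpM2l => //; exact: Ab.
Qed.

Lemma closed_convex_hull_le (phi : T -> R) (b : R) (mu : prob) : cont_on G phi ->
  (forall nu, A nu -> gint nu phi <= b) -> closed_convex_hull G A mu ->
  gint mu phi <= b.
Proof.
move=> cphi Ab [muG muA]; apply/ler_addgt0Pr => e e0.
have [nu [hnu /= lt]] := muA _ (nbhs_weak_star mu cphi e0).
have := convex_hull_le (cont_on_bmeas hT cG cphi) Ab hnu.
move: lt; rewrite ltr_norml => /andP[h1 h2] h3.
by move: h1 h2 h3; set a := gint mu phi; set b' := gint nu phi => *; lra.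
Qed.

(** The descent move of the separation argument, from [mu] towards [nu]; the index [ord0] carries
    the new measure [nu]. *)
Lemma convex_hull_step (mu nu : prob) (t : R) : convex_hull A mu -> A nu ->
  0 <= t <= 1 -> exists2 mu' : prob, convex_hull A mu' &
    forall phi : T -> R, bmG phi -> gint mu' phi = (1 - t) * gint mu phi + t * gint nu phi.
Proof.
move=> [m [c [nu_ [c0 c1 nuA muE]]]] Anu /andP[t0 t1].
pose c' (i : 'I_m.+1) := if unlift ord0 i is Some j then (1 - t) * c j else t.
pose nu' (i : 'I_m.+1) := if unlift ord0 i is Some j then nu_ j else nu.
have c'0 i : 0 <= c' i by rewrite /c'; case: (unlift _ _) => // j; rewrite mulr_ge0// subr_ge0.
have c'1 : \sum_i c' i = 1.
  rewrite big_ord_recl/= {1}/c' unlift_none.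
  under eq_bigr do rewrite /c' liftK.
  by rewrite -mulr_sumr c1 mulr1 addrC subrK.
have nu'A i : A (nu' i) by rewrite /nu'; case: (unlift _ _).
have [w [nuw [w_ge0 w_sum _ _ wE]]] := finite_mixture nu' mu c'0 c'1.
have [mu' mu'E] := mixture_exists nuw w_ge0 w_sum.
have mu'C (Q : set (borel T)) : mu' Q = (\sum_(i < m.+1) (c' i)%:E * nu' i Q)%E.
  by rewrite mu'E (wE (fun nu => nu Q)).
exists mu'; first by exists m.+1, c', nu'.
move=> phi bphi.
have [_ ->//] := convex_combination_integral c'0 c'1 (fun i => AG (nu'A i)) (fun Q _ => mu'C Q).
have [_ ->//] := convex_combination_integral c0 c1 (fun i => AG (nuA i)) muE.
rewrite big_ord_recl/= {1}/c' {1}/nu' unlift_none addrC; congr (_ + _).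
rewrite mulr_sumr; apply: eq_bigr => i _.
by rewrite /c' /nu' liftK mulrA.
Qed.

Lemma convex_hull_sub (nu : prob) : A nu -> convex_hull A nu.
Proof.
move=> Anu; exists 1%N, (fun=> 1), (fun=> nu); split=> //.
  by rewrite big_ord1.
by move=> Q _; rewrite big_ord1 mul1e.
Qed.

(* A near-minimiser, over the convex hull, of the squared distance to [gamma]
   (measured through finitely many test functions) yields the separating
   functional, so no closest point is needed. *)
Lemma closed_convex_hull_separation (gamma : prob) : probs_on G gamma ->
  (forall phi : T -> R, cont_on G phi -> (forall z, G z -> 0 <= phi z) ->
     forall e : R, 0 < e -> exists2 nu, A nu & gint nu phi <= gint gamma phi + e) ->
  closed_convex_hull G A gamma.
Proof.
move=> gG sep; split=> // B /weak_star_nbhs[l [e [e0 cl HB]]].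
have bl (phi : T -> R) : phi \in l -> bmG phi by move=> /cl; exact: cont_on_bmeas.
pose x (phi : T -> R) (nu : prob) : R := gint nu phi - gint gamma phi.
pose Phi (nu : prob) : R := \sum_(phi <- l) x phi nu ^+ 2.
have Phi0 nu : 0 <= Phi nu by apply: sumr_ge0 => phi _; exact: sqr_ge0.
have [nu0 Anu0] : exists nu, A nu.
  have [nu Anu _] := sep (fun=> 0) (@cont_on_cst R T G 0) (fun z _ => lexx 0) 1 ltr01.
  by exists nu.
pose E := [set Phi nu | nu in convex_hull A].
have infE : has_inf E.
  split; first by exists (Phi nu0), nu0 => //; exact: convex_hull_sub.
  by exists 0 => _ [nu _ <-].
pose D := inf E.
have DPhi nu : convex_hull A nu -> D <= Phi nu.
  by move=> hnu; apply: ge_inf; [case: infE|exists nu].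
have hG nu : convex_hull A nu -> probs_on G nu.
  move=> [m [c [nu_ [c0' c1 nuA muE]]]].
  by have [] := convex_combination_integral c0' c1 (fun i => AG (nuA i)) muE.
(* If the infimum is below [e ^+ 2], some element of the hull has every coordinate within [e] of
   [gamma] and lies in [B]; otherwise a descent step goes below the infimum. *)
have [De|eD] := ltP D (e ^+ 2).
  have [_ [nu hnu <-] Phie] := inf_lt infE.1 De.
  exists nu; split=> //; apply: HB => phi pl.
  rewrite -(@ltr_pXn2r _ 2)// ?nnegrE ?ltW// -normrX ger0_norm ?sqr_ge0//.
  apply: le_lt_trans Phie; rewrite /Phi (big_rem _ pl)/= lerDl.
  by apply: sumr_ge0 => psi _; exact: sqr_ge0.
exfalso.
have D0 : 0 < D by apply: lt_le_trans eD; rewrite exprn_gt0.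
have [Mf HMf] : exists Mf : (T -> R) -> R, forall phi : T -> R, phi \in l ->
    forall z, G z -> `|phi z| <= Mf phi.
  have ex (phi : T -> R) : exists M : R, phi \in l -> forall z, G z -> `|phi z| <= M.
    have [pl|pl] := boolP (phi \in l); last by exists 0.
    by have [M HM] := cont_on_bounded cG (cl phi pl); exists M.
  by have [Mf H] := choice ex; exists Mf.
pose K := \sum_(phi <- l) (2 * Mf phi) ^+ 2.
have K0 : 0 <= K by apply: sumr_ge0 => phi _; exact: sqr_ge0.
(* Small enough that [t ^+ 2 * K <= t * D / 2], where [K] bounds the squared distance between two
   probabilities on [G] seen through [l]; [K + 1] avoids a zero denominator. *)
pose t := Num.min 1 (D / (2 * (K + 1))).
have t0 : 0 < t by rewrite lt_min ltr01/= divr_gt0// mulr_gt0// ltr_wpDl.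
have t1 : t <= 1 by rewrite ge_min lexx.
have tK : t * K <= D / 2.
  apply: (@le_trans _ _ (D / (2 * (K + 1)) * (K + 1))).
    apply: ler_pM => //; [exact: ltW|by rewrite ge_min lexx orbT|by rewrite lerDl].
  by rewrite invfM mulrA divfK// gt_eqF// ltr_wpDl.
(* [Phi mu] is within [t * D / 4] of the infimum, and the step changes [Phi] by at most
   [- (t * D) + t * D / 2], which leaves [Phi mu' < D]. *)
have tD : 0 < t * D / 4 by rewrite divr_gt0// mulr_gt0.
have [_ [mu hmu <-] muD] := inf_adherent tD infE.
pose lam (phi : T -> R) := x phi mu.
(* [q] is, up to a factor 2, the gradient of [Phi] at [mu]; the constant [C] makes it nonnegative on
   [G] and cancels when integrals are compared. *)
pose C := \sum_(phi <- l) `|lam phi| * Mf phi.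
pose q z := \sum_(phi <- l) lam phi * phi z + C.
have cq : cont_on G q.
  apply: cont_onD; last exact: (@cont_on_cst R T G).
  rewrite /cont_on/=; elim: (l) cl => [|phi s IH] cl'.
    by under eq_fun do rewrite big_nil; exact: (@cont_on_cst R T G).
  under eq_fun do rewrite big_cons; apply: cont_onD.
    by apply: cont_onZ; apply: cl'; rewrite mem_head.
  by apply: IH => psi ps; apply: cl'; rewrite inE ps orbT.
have q0 z : G z -> 0 <= q z.
  move=> Gz; rewrite /q /C -big_split/=; rewrite big_seq; apply: sumr_ge0 => phi pl.
  rewrite -lerBlDl sub0r; apply: (@le_trans _ _ `|lam phi * phi z|).
    by rewrite -normrN ler_norm.
  by rewrite normrM ler_wpM2l// HMf.
have D2 : 0 < D / 2 by rewrite divr_gt0.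
have [nu Anu qnu] := sep q cq q0 _ D2.
have qE nu' : probs_on G nu' -> gint nu' q = \sum_(phi <- l) lam phi * gint nu' phi + C.
  move=> nuG.
  have bZ (phi : T -> R) : phi \in l -> bmG (fun z => lam phi * phi z).
    by move=> /bl; exact: bmeasZ.
  have bS := bmeas_sum mG bZ.
  rewrite RintegralD//; try exact: bmeas_integrable; last first.
    by apply: bmeas_integrable => //; exact: bmeas_cst.
  rewrite Rintegral_cst1// Rintegral_sum//; congr (_ + _).
  rewrite big_seq [RHS]big_seq; apply: eq_bigr => phi pl.
  by rewrite RintegralZl//; apply: bmeas_integrable => //; exact: bl.
rewrite !qE// in qnu; last exact: AG.
have lamy : \sum_(phi <- l) lam phi * x phi nu <= D / 2.
  move: qnu; rewrite addrAC lerD2r -lerBlDl -sumrB; congr (_ <= _).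
  by apply: eq_bigr => phi _; rewrite /x mulrBr.
have t01 : 0 <= t <= 1 by rewrite ltW.
have [mu' hmu' mu'E] := convex_hull_step hmu Anu t01.
have xE (phi : T -> R) : phi \in l -> x phi mu' = lam phi + t * (x phi nu - lam phi).
  by move=> /bl bphi; rewrite /lam /x mu'E//; ring.
have PhiE : Phi mu' <= Phi mu + 2 * t * (\sum_(phi <- l) lam phi * x phi nu - Phi mu) + t ^+ 2 * K.
  rewrite /Phi /K -sumrB !mulr_sumr -!big_split/=.
  rewrite big_seq [leRHS]big_seq; apply: ler_sum => phi pl.
  rewrite xE// -/(lam phi).
  have -> : (lam phi + t * (x phi nu - lam phi)) ^+ 2 = lam phi ^+ 2 +
      2 * t * (lam phi * x phi nu - lam phi ^+ 2) + t ^+ 2 * (x phi nu - lam phi) ^+ 2 by ring.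
  rewrite lerD2l ler_wpM2l ?sqr_ge0//.
  have -> : x phi nu - lam phi = gint nu phi - gint mu phi by rewrite /lam /x; ring.
  have M1 nu' : probs_on G nu' -> `|gint nu' phi| <= Mf phi.
    by move=> nuG; apply: Rintegral_abs_le => //; [exact: bl|exact: HMf].
  rewrite -[leLHS]ger0_norm ?sqr_ge0// normrX ler_pXn2r ?nnegrE//.
    apply: le_trans (ler_normB _ _) _; rewrite mulr_natl mulr2n lerD// M1//; first exact: AG.
    exact: hG.
  by rewrite mulr_ge0// (le_trans _ (M1 _ (hG _ hmu))).
have DPmu' := DPhi _ hmu'; have DPmu := DPhi _ hmu.
have h1 : 2 * t * (\sum_(phi <- l) lam phi * x phi nu - Phi mu) <= 2 * t * (D / 2 - D).
  by apply: ler_wpM2l; [rewrite mulr_ge0// ltW|exact: lerB].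
have h2 : t ^+ 2 * K <= t * (D / 2) by rewrite expr2 -mulrA ler_wpM2l// ltW.
move: DPmu' PhiE h1 h2 muD tD.
set a := \sum_(phi <- l) _; set b := t ^+ 2 * K => *.
have : 2 * t * (D / 2 - D) = - (t * D) by field.
move: (2 * t * (a - Phi mu)) (2 * t * (D / 2 - D)) (t * D) => *.
nra.
Qed.

End closed_convex_hulls.

(** * Finite nets and measurability in products *)

(** [idx z] is the position of the first net point whose neighbourhood contains [z]; taking the
    first makes its level sets finite Boolean combinations of Borel sets. *)
Lemma compact_net (R : realType) (T : ptopologicalType) (K : set T) (B : T -> set T) :
  hausdorff_space T -> compact K -> K !=set0 ->
  (forall c, open (B c)) -> (forall c, B c c) ->
  exists (N : nat) (c : nat -> T) (idx : T -> nat),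
    [/\ (forall i, K (c i)),
      (forall z, K z -> (idx z < N)%N /\ B (c (idx z)) z) &
      forall i, measurable (K `&` idx @^-1` [set i] : set (borel T))].
Proof.
move=> hT cK [z0 Kz0] oB Bc.
have mK : measurable (K : set (borel T)) by apply: closed_borel; exact: compact_closed.
have cov : K `<=` cover K B by move=> z Kz; exists z.
have := cK; rewrite compact_cover => /(_ _ K B (fun i _ => oB i) cov) [D' D'K KD'].
pose s : seq T := D'.
pose c i := nth z0 s i.
pose p z := fun y => `[< B y z >].
pose idx z := find (p z) s.
have idxP z : K z -> (idx z < size s)%N.
  move=> /KD'[y /= yD Byz]; rewrite -has_find; apply/hasP; exists y => //.
  exact/asboolP.
exists (size s), c, idx; split.
- move=> i; rewrite /c; have [si|si] := ltnP i (size s); last by rewrite nth_default.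
  by apply: set_mem; apply: D'K; exact: mem_nth.
- move=> z Kz; split; first exact: idxP.
  have : has (p z) s by rewrite has_find; exact: idxP.
  by move=> /(nth_find z0)/asboolP.
move=> i; have [si|si] := ltnP i (size s); last first.
  rewrite (_ : _ `&` _ = set0)//; rewrite -subset0 => z [Kz /= iz].
  by move: (idxP z Kz); rewrite iz ltnNge si.
rewrite (_ : _ `&` _ = K `&` (B (c i) `&` \bigcap_(j in `I_i) ~` B (c j))).
  apply: measurableI => //; apply: measurableI; first exact: open_borel.
  apply: bigcap_measurableType => j _; apply: measurableC; exact: open_borel.
apply/seteqP; split=> z [Kz] /=.
  move=> iz; split=> //; split.
    have hz : has (p z) s by rewrite has_find; exact: idxP.
    by have /asboolP := nth_find z0 hz; rewrite -/(idx z) iz.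
  move=> j /= ji Bj; have := @before_find _ z0 (p z) s j.
  by rewrite -/(idx z) iz => /(_ ji)/asboolP; apply.
move=> [Bi nB]; split=> //=.
have hs : has (p z) s by apply/hasP; exists (c i); [exact: mem_nth|exact/asboolP].
apply/eqP; rewrite eqn_leq; apply/andP; split.
  rewrite leqNgt; apply/negP => iz.
  by have /asboolP := before_find z0 iz; apply.
rewrite leqNgt; apply/negP => /nB /=; apply.
exact/asboolP/(nth_find z0 hs).
Qed.

Section boxes.
Context {R : realType} {n : nat} {Uhat : pmetricType R}.
Local Notation X := 'rV[R]_n.
Local Notation T := (X * Uhat)%type.

(** A product of open sets, so that its preimage under a pair of maps is an intersection of two
    preimages. *)
Definition box (k : nat) (c : T) : set T :=
  (ball c.1 (k.+1%:R^-1 : R))° `*` (ball c.2 (k.+1%:R^-1 : R))°.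

Arguments box k c : clear implicits.

Lemma box_open k c : open (box k c).
Proof.
have -> : box k c = (fst @^-1` (ball c.1 (k.+1%:R^-1 : R))°) `&`
  (snd @^-1` (ball c.2 (k.+1%:R^-1 : R))°) by [].
by apply: openI; apply: open_comp => [z _|];
  [exact: cvg_fst|exact: open_interior|exact: cvg_snd|exact: open_interior].
Qed.

Lemma box_center k c : box k c c.
Proof. by split; apply: nbhsx_ballx; rewrite invr_gt0. Qed.

Lemma box_small (z : T) (O : set T) : nbhs z O ->
  exists k0, forall k, (k0 <= k)%N -> forall c, box k c z -> box k c `<=` O.
Proof.
move=> /nbhs_ballP[e /= e0 eO].
have e2 : 0 < e / 2 by rewrite divr_gt0.
have [k0 _ Hk0] := @near_infty_natSinv_lt R (PosNum e2).
exists k0 => k /Hk0/= ke c [/= /interior_subset c1z /interior_subset c2z] z' [].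
move=> /= /interior_subset c1z' /interior_subset c2z'.
have H (V : pseudoMetricType R) (a b a' : V) : ball a (k.+1%:R^-1 : R) b ->
    ball a (k.+1%:R^-1 : R) a' -> ball b e a'.
  move=> ab aa'; rewrite (splitr e); apply: (@ball_triangle _ _ a).
    by apply: ball_sym; apply: le_ball ab; exact: ltW.
  by apply: le_ball aa'; exact: ltW.
by apply: eO; split; [exact: H c1z c1z'|exact: H c2z c2z'].
Qed.

Lemma box_cvg (z : T) (c : nat -> T) : (forall k, box k (c k) z) -> c @ \oo --> z.
Proof.
move=> cz O /box_small[k0 Hk0]; exists k0 => // k /= kk.
by apply: (Hk0 k kk (c k) (cz k)); exact: (@box_center k).
Qed.

Lemma hausdorff_pair : hausdorff_space T.
Proof.
move=> [x1 x2] [y1 y2] H; congr pair.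
  apply: norm_hausdorff => A B Ax By.
  have [||[z1 z2] [/= [? _] [? _]]] := H (A `*` setT) (B `*` setT).
  - by exists (A, setT) => //; split=> //; exact: filterT.
  - by exists (B, setT) => //; split=> //; exact: filterT.
  by exists z1.
apply: metric_hausdorff => A B Ax By.
have [||[z1 z2] [/= [_ ?] [_ ?]]] := H (setT `*` A) (setT `*` B).
- by exists (setT, A) => //; split=> //; exact: filterT.
- by exists (setT, B) => //; split=> //; exact: filterT.
by exists z2.
Qed.

Lemma normal_pair : normal_space T.
Proof. exact: pseudometric_normal. Qed.

Context d (Om : measurableType d).

(** On the compact set [K], every open set is a countable union of traces of boxes around net
    points, and preimages of boxes are measurable componentwise. *)
Lemma measurable_pair (K : set T) (a : Om -> X) (b : Om -> Uhat) : compact K ->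
  measurable_fun setT (a : Om -> borel X) ->
  measurable_fun setT (b : Om -> borel Uhat) -> (forall w, K (a w, b w)) ->
  measurable_fun setT ((fun w => (a w, b w)) : Om -> borel T).
Proof.
move=> cK ma mb Kab.
have K0 : K !=set0 by exists (a point, b point).
have net k := @compact_net R T K (box k) hausdorff_pair cK K0 (@box_open k) (@box_center k).
have [N HN] := choice net; have [c Hc] := choice HN; have {HN Hc}[idx H] := choice Hc.
apply: measurable_fun_borel => O oO; rewrite setTI.
pose Q k i := if `[< box k (c k i) `<=` O >] then box k (c k i) else set0.
rewrite (_ : _ @^-1` O = \bigcup_k \bigcup_i ((fun w => (a w, b w)) @^-1` Q k i)).
  apply: bigcupT_measurable => k; apply: bigcupT_measurable => i.
  rewrite /Q; case: ifPn => _; last by rewrite preimage_set0; exact: measurable0.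
  rewrite (_ : _ @^-1` _ = (setT `&` a @^-1` (ball (c k i).1 (k.+1%:R^-1 : R))°) `&`
     (setT `&` b @^-1` (ball (c k i).2 (k.+1%:R^-1 : R))°)); last by rewrite !setTI.
  apply: measurableI.
    by apply: ma => //; apply: open_borel; exact: open_interior.
  by apply: mb => //; apply: open_borel; exact: open_interior.
apply/seteqP; split=> w /=.
  move=> Ow; have [k0 Hk0] := box_small (open_nbhs_nbhs (conj oO Ow)).
  have [_ /(_ _ (Kab w))[_ bz] _] := H k0.
  exists k0 => //; exists (idx k0 (a w, b w)) => //=.
  by rewrite /Q asboolT//; exact: Hk0.
move=> [k _ [i _]] /=; rewrite /Q; case: asboolP => // sub; exact: sub.
Qed.

(** [F w] lies in [O] exactly when, for some [m], the values [F_ k w] eventually avoid the open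
    neighbourhood [D m] of the complement of [O]; this is a countable combination of measurable
    events. *)
Lemma measurable_fun_borel_cvg (F_ : nat -> Om -> X) (F : Om -> X) :
  (forall k, measurable_fun setT (F_ k : Om -> borel X)) ->
  (forall w, F_ ^~ w @ \oo --> F w) -> measurable_fun setT (F : Om -> borel X).
Proof.
move=> mF cF; apply: measurable_fun_borel => O oO; rewrite setTI.
pose D m : set X := \bigcup_(y in ~` O) (ball y (m.+1%:R^-1 : R))°.
have oD m : open (D m) by apply: bigcup_open => y _; exact: open_interior.
rewrite (_ : F @^-1` O =
    \bigcup_m \bigcup_N \bigcap_(k in [set k | (N <= k)%N]) (F_ k @^-1` ~` D m)).
  apply: bigcupT_measurable => m; apply: bigcupT_measurable => N.
  apply: bigcap_measurableType => k _; rewrite -[X in measurable X]setTI.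
  by apply: mF => //; apply: measurableC; exact: open_borel.
apply/seteqP; split=> w /=.
  move=> Ow; have /nbhs_ballP[e /= e0 eO] : nbhs (F w) O by exact: open_nbhs_nbhs.
  have e2 : 0 < e / 2 by rewrite divr_gt0.
  have [m _ Hm] := @near_infty_natSinv_lt R (PosNum e2).
  have [N _ HN] := cF w _ (nbhsx_ballx (F w) _ e2).
  exists m => //; exists N => // k Nk [y nOy /interior_subset yF]; apply: nOy.
  apply: eO; rewrite (splitr e); apply: (ball_triangle (HN k Nk)).
  by apply: ball_sym; apply: le_ball yF; apply: ltW; exact: (Hm m (leqnn m)).
move=> [m _ [N _ H]]; apply: contrapT => nOw.
have m0 : 0 < m.+1%:R^-1 :> R by rewrite invr_gt0.
have [N' _ HN'] := cF w _ (nbhs_interior (nbhsx_ballx (F w) _ m0)).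
apply: (H (maxn N N')); first exact: leq_maxl.
by exists (F w) => //; apply: HN'; exact: leq_maxr.
Qed.

Context {S : ptopologicalType}.

(** Replacing [z w] by its net point makes the first argument countably valued, which reduces
    measurability to that of [g c] for fixed [c]; continuity in the first argument recovers the
    original function as a pointwise limit. *)
Lemma measurable_caratheodory (K : set T) (g : T -> S -> X) (z : Om -> T) (x : Om -> borel S) :
  compact K -> (forall s, {within K, continuous (g ^~ s)}) ->
  (forall c, K c -> measurable_fun setT (g c : borel S -> borel X)) ->
  measurable_fun setT (z : Om -> borel T) -> (forall w, K (z w)) ->
  measurable_fun setT x ->
  measurable_fun setT ((fun w => g (z w) (x w)) : Om -> borel X).
Proof.
move=> cK cg mg mz Kz mx.
have K0 : K !=set0 by exists (z point).
have net k := @compact_net R T K (box k) hausdorff_pair cK K0 (@box_open k) (@box_center k).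
have [N HN] := choice net; have [c Hc] := choice HN; have {HN Hc}[idx H] := choice Hc.
apply: (@measurable_fun_borel_cvg (fun k w => g (c k (idx k (z w))) (x w))).
  move=> k; have [Kc Hidx midx] := H k.
  apply: measurable_fun_borel => O oO; rewrite setTI.
  rewrite (_ : _ @^-1` O = \bigcup_i ((setT `&` z @^-1` (K `&` idx k @^-1` [set i])) `&`
      (setT `&` x @^-1` (setT `&` g (c k i) @^-1` O)))).
    apply: bigcupT_measurable => i; apply: measurableI; first exact: mz.
    by apply: mx => //; apply: mg => //; exact: open_borel.
  apply/seteqP; split=> w /=; first by move=> Ow; exists (idx k (z w)).
  by move=> [i _ [[_ [_ <-]] [_ [_]]]].
move=> w; have /subspace_continuousP/(_ (z w) (Kz w)) cgz := cg (x w).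
have cw : (fun k => c k (idx k (z w))) @ \oo --> within K (nbhs (z w)).
  move=> B; rewrite /within/= => nB.
  have cz : (fun k => c k (idx k (z w))) @ \oo --> z w.
    by apply: box_cvg => k; have [_ /(_ _ (Kz w))[]] := H k.
  have [N0 _ HN0] := cz _ nB; exists N0 => // k /= kN.
  by apply: (HN0 k kN); have [+ _ _] := H k.
exact: (cvg_comp _ _ cw cgz).
Qed.

End boxes.

(** * Independence from the past *)

Section independence.
Context {R : realType} {d d'} {Omega : measurableType d} {E : measurableType d'}.
Variables (P : probability Omega R) (s : nat -> {RV P >-> E}).
Hypotheses (s_indep : independent_seq s) (s_id : identically_distributed s).

(** Cylinders on the variables [s i] with [i < t]: a pi-system on which [independent_seq] gives
    probabilities directly. The history before [s t] is the sigma-algebra it generates. *)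
Definition past (t : nat) : set (set Omega) :=
  [set A | exists2 B : nat -> set E, (forall i, measurable (B i)) &
    A = \bigcap_(i in `I_t) (s i @^-1` B i)].

Lemma past_setI t : setI_closed (past t).
Proof.
move=> _ _ [B mB ->] [C mC ->]; exists (fun i => B i `&` C i).
  by move=> i; exact: measurableI.
by rewrite -bigcapI.
Qed.

Lemma measurable_preim_rv (i : nat) (B : set E) : measurable B -> measurable (s i @^-1` B).
Proof. by move=> mB; rewrite -[X in measurable X]setTI; exact: measurable_funP. Qed.

Lemma past_measurable t : past t `<=` measurable.
Proof.
move=> _ [B mB ->]; apply: bigcap_measurableType => i _; exact: measurable_preim_rv.
Qed.

Lemma sigma_past_measurable t : <<s past t >> `<=` @measurable _ Omega.
Proof. by apply: smallest_sub; [exact: sigma_algebra_measurable|exact: past_measurable]. Qed.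

Lemma pastT t : past t setT.
Proof. by exists (fun=> setT) => //; apply/seteqP; split. Qed.

Lemma past_preim t i B : (i < t)%N -> measurable B -> past t (s i @^-1` B).
Proof.
move=> it mB; exists (fun j => if j == i then B else setT).
  by move=> j; case: ifP.
apply/seteqP; split=> [w Bw j /= _|w /(_ i it)/=]; last by rewrite eqxx.
by case: eqP => // ->.
Qed.

(** For fixed [B] both sides are finite measures of [A]; they agree on the pi-system [past t], hence
    on the sigma-algebra it generates. *)
Lemma past_indep t (A : set Omega) (B : set E) : <<s past t >> A -> measurable B ->
  P (A `&` s t @^-1` B) = (P A * P (s 0%N @^-1` B))%E.
Proof.
move=> sA mB; have msB := measurable_preim_rv t mB.
have -> : P (s 0%N @^-1` B) = P (s t @^-1` B) by have := s_id t mB.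
pose c := NngNum (fine_ge0 (measure_ge0 P (s t @^-1` B))).
have cE : P (s t @^-1` B) = c%:num%:E by rewrite /= fineK ?fin_num_measure.
pose m1 : measure Omega R := mrestr P msB; pose m2 : measure Omega R := mscale c P.
rewrite muleC cE; rewrite -[RHS]/(m2 A) -[LHS]/(m1 A).
apply: (@g_sigma_algebra_measure_unique _ _ _ (past t) (@past_measurable t) (fun=> setT)) sA.
- by move=> _; exact: pastT.
- by rewrite bigcup_const//; exists 0%N.
- exact: past_setI.
- move=> _ [C mC ->].
  rewrite -[LHS]/(P _) -[RHS]/(_ * P _)%E -cE muleC.
  (* Independence is used twice, for the indices below [t] and for these together with [t]; the two
     products differ by the factor of [B]. *)
  pose J := [fset i in iota 0 t]%fset.
  pose C' i := if i == t then B else C i.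
  have mC' i : measurable (C' i) by rewrite /C'; case: ifP.
  have tJ : t \notin J by rewrite !inE mem_iota/= add0n ltnn.
  have JE : [set` J] = `I_t.
    by apply/seteqP; split=> i /=; rewrite !inE mem_iota/= add0n.
  have := s_indep (t |` J)%fset mC'.
  rewrite big_fsetU1//= {2}/C' eqxx => H.
  rewrite muleC; have -> : P (\bigcap_(i < t) s i @^-1` C i) =
      (\prod_(i <- J) P (s i @^-1` C' i))%E.
    rewrite -(s_indep J mC'); congr (P _); rewrite JE; apply: eq_bigcapr => i /= it.
    by rewrite /C' ltn_eqF.
  rewrite -H; congr (P _); apply/seteqP; split=> w /=.
    move=> [Hw Bw] i /=; rewrite in_fset1U => /orP[/eqP ->|iJ]; first by rewrite /C' eqxx.
    have it : (i < t)%N by rewrite !inE mem_iota/= add0n in iJ.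
    by rewrite /C' ltn_eqF//; exact: Hw.
  move=> Hw; split; last by have := Hw t; rewrite /= fset1U1 /C' eqxx; apply.
  move=> i /= it; have := Hw i; rewrite /= in_fset1U.
  have -> : i \in J by rewrite !inE mem_iota/= add0n.
  by rewrite orbT /C' ltn_eqF//; apply.
- move=> _; rewrite /m1/= /mrestr setTI.
  by apply: le_lt_trans (probability_le1 P msB) (ltry 1).
Qed.

(** Under [P] restricted to [A], the variable [s t] has the law of [s 0] scaled by [P A]. For
    nonnegative functions this is a change of variables; a bounded [g] is first raised by [|M|]. *)
Lemma past_integral t (A : set Omega) (g : E -> R) : <<s past t >> A -> bmeas setT g ->
  \int[P]_(w in A) g (s t w) = fine (P A) * \int[P]_w g (s 0%N w).
Proof.
move=> sA bg; have mA := sigma_past_measurable sA.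
have bgs i (D : set Omega) : measurable D -> bmeas D (fun w => g (s i w)).
  case: bg => mg [M gM] mD; split; last by exists M => w _; exact: gM.
  by apply: measurable_funTS; apply: measurableT_comp.
pose c := NngNum (fine_ge0 (measure_ge0 P A)).
pose m1 : measure Omega R := mrestr P mA.
have ge0 (h : E -> R) : measurable_fun setT h -> (forall x, 0 <= h x) ->
    (\int[P]_(w in A) (h (s t w))%:E = (fine (P A))%:E * \int[P]_w (h (s 0%N w))%:E)%E.
  move=> mh h0.
  have mhs i : measurable_fun setT (fun w => (h (s i w))%:E).
    by apply/measurable_EFinP; apply: measurableT_comp.
  have m1A : m1 (~` A) = 0%E by rewrite /m1/= /mrestr setICl measure0.
  rewrite (@eq_measure_integral _ _ _ A m1); last first.
    by move=> B mB BA; rewrite /m1/= /mrestr setIidl.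
  have mAC : measurable (~` A) by exact: measurableC.
  have h0' (x : Omega) : setT x -> (0 <= (h (s t x))%:E)%E by rewrite lee_fin.
  have -> : (\int[m1]_(w in A) (h (s t w))%:E = \int[m1]_w (h (s t w))%:E)%E.
    rewrite [RHS](@ge0_negligible_integral _ _ _ m1 setT (~` A))//.
    by rewrite setTD setCK.
  have mEh : measurable_fun setT (EFin \o h) by exact/measurable_EFinP.
  have h0E : {in setT, forall y, (0 <= (EFin \o h) y)%E} by move=> y _; rewrite /= lee_fin.
  rewrite -(@ge0_integral_pushforward _ _ _ _ _ (s t) _ m1 setT (EFin \o h))//.
  rewrite (eq_measure_integral (mscale c (pushforward P (s 0%N)))); last first.
    move=> B mB _; rewrite /m1/= /pushforward /mrestr /mscale/= setIC past_indep//.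
    by rewrite fineK// fin_num_measure.
  rewrite ge0_integral_mscale//; last by move=> x _; rewrite /= lee_fin.
  by rewrite (@ge0_integral_pushforward _ _ _ _ _ (s 0%N) _ P setT (EFin \o h))//=.
case: (bg) => mg [M gM].
have fin i (D : set Omega) (r : R) : measurable D ->
    P.-integrable D (EFin \o (fun w => g (s i w) + r)).
  move=> mD; apply: bmeas_integrable => //; apply: bmeasD; first exact: bgs.
  exact: bmeas_cst.
have fin0 i (D : set Omega) : measurable D -> P.-integrable D (EFin \o (fun w => g (s i w))).
  by move=> mD; apply: bmeas_integrable => //; exact: bgs.
have finc (D : set Omega) (r : R) : measurable D -> P.-integrable D (EFin \o (fun=> r)).
  by move=> mD; apply: bmeas_integrable => //; exact: bmeas_cst.
have gM0 x : 0 <= g x + `|M|.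
  rewrite -lerBlDr sub0r; have := gM x I; rewrite ler_norml => /andP[+ _].
  by apply: le_trans; rewrite lerN2 ler_norm.
have mgM : measurable_fun setT (fun x => g x + `|M|) by exact: measurable_funD.
have : \int[P]_(w in A) (g (s t w) + `|M|) =
    fine (P A) * \int[P]_w (g (s 0%N w) + `|M|).
  rewrite {1}/Rintegral (ge0 _ mgM gM0) fineM ?fin_num_measure//.
  exact: integrable_fin_num (fin 0%N setT `|M| measurableT).
rewrite !RintegralD//; try exact: fin0; try exact: finc.
rewrite !Rintegral_cst// (_ : fine (P setT) = 1) ?mulr1; last by have -> := probability_setT P.
rewrite mulrDr (mulrC `|M|).
exact: addIr.
Qed.

End independence.

(** * State-control trajectories *)

Record standing_assumptions (R : realType) (n : nat) (Uhat : pmetricType R)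
    (S : ptopologicalType) (d : measure_display) (Omega : measurableType d)
    (P : probability Omega R) (s : nat -> {RV P >-> borel S})
    (Y : set 'rV[R]_n) (U : 'rV[R]_n -> set Uhat)
    (f : 'rV[R]_n -> Uhat -> S -> 'rV[R]_n) : Prop := StandingAssumptions {
  Y_nonempty : Y !=set0 ;
  Y_compact : compact Y ;
  Uhat_compact : compact [set: Uhat] ;
  f_continuous : forall x : S,
    {within Y `*` [set: Uhat], continuous (fun z => f z.1 z.2 x)} ;
  f_measurable : forall y u, Y y ->
    measurable_fun setT (f y u : borel S -> borel 'rV[R]_n) ;
  s_indep : independent_seq s ;
  s_id : identically_distributed s ;
  U_nonempty : forall y, Y y -> U y !=set0 ;
  U_compact : forall y, Y y -> compact (U y) ;
  U_usc : usc_multimap Y U ;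
  f_inv : forall y u x, Y y -> U y u -> Y (f y u x) }.

Arguments f_continuous {R n Uhat S d Omega P s Y U f} _ _.

Section dynamics.
Context {R : realType} {n : nat} {Uhat : pmetricType R} {S : ptopologicalType}
  {d : measure_display} {Omega : measurableType d}.
Local Notation X := 'rV[R]_n.
Local Notation T := ('rV[R]_n * Uhat)%type.
Variables (P : probability Omega R) (s : nat -> {RV P >-> borel S}).
Variables (Y : set X) (U : X -> set Uhat) (f : X -> Uhat -> S -> X).
Hypothesis H : standing_assumptions s Y U f.
Local Notation G := (graph Y U).

Lemma Y_closed : closed Y.
Proof. by apply: compact_closed; [exact: norm_hausdorff|exact: Y_compact H]. Qed.

(** An upper semicontinuous map with closed values has a closed graph: if [u] is not in [U y],
    normality gives disjoint open sets around [U y] and [u], and the sets [U y'] stay in the former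
    for [y'] near [y]. *)
Lemma graph_compact : compact G.
Proof.
have cYU : compact (Y `*` [set: Uhat]).
  by apply: compact_setX; [exact: Y_compact H|exact: Uhat_compact H].
have -> : G = (Y `*` [set: Uhat]) `&` closure G.
  apply/seteqP; split=> [z [Yz Uz]|[y u] [[/= Yy _] clz]].
    by split=> //; exact: subset_closure.
  split=> //=; apply: contrapT => nU.
  have Uc : closed (U y).
    by apply: compact_closed; [exact: metric_hausdorff|exact: (U_compact H Yy)].
  have uc : closed [set u].
    by apply: compact_closed; [exact: metric_hausdorff|exact: compact_set1].
  have Uu0 : U y `&` [set u] = set0 by rewrite -subset0 => v [Uv vu]; apply: nU; rewrite -vu.
  have [V [W [oV oW UV uW VW]]] := (@normal_openP R Uhat).1
    pseudometric_normal (U y) [set u] Uc uc Uu0.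
  have nV := U_usc H Yy oV UV.
  have nW : nbhs u W by apply: open_nbhs_nbhs; split=> //; exact: uW.
  have [|[y' u'] [[/= Yy' Uu'] [/= /(_ Yy') sub Wu']]] :=
    clz ([set y' | Y y' -> U y' `<=` V] `*` W).
    by exists ([set y' | Y y' -> U y' `<=` V], W).
  suff : set0 u' by [].
  by rewrite -VW; split=> //; exact: sub.
by apply: compact_closedI => //; exact: closed_closure.
Qed.

Lemma graph_nonempty : G !=set0.
Proof.
have [y Yy] := Y_nonempty H; have [u Uu] := U_nonempty H Yy.
by exists (y, u).
Qed.

Lemma graph_measurable : measurable (G : set (borel T)).
Proof.
by apply: closed_borel; apply: compact_closed; [exact: hausdorff_pair|exact: graph_compact].
Qed.

Lemma Y_measurable : measurable (Y : set (borel X)).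
Proof. by apply: closed_borel; exact: Y_closed. Qed.

Lemma f_within (x : S) : {within G, continuous (fun z => f z.1 z.2 x)}.
Proof. by apply: (continuous_subspaceW _ (f_continuous H x)) => z [Yz _]. Qed.

Lemma f_graph_in z x : G z -> Y (f z.1 z.2 x).
Proof. by move=> [Yz Uz]; exact: (f_inv H). Qed.

Section trajectories.
Variables (pi : @plan R n Uhat) (y0 : X).
Hypotheses (api : admissible Y U pi) (Yy0 : Y y0).
Local Notation z_ := (state_control s f pi y0).

Lemma state_in t w : Y (state s f pi y0 t w) /\ G (z_ t w).
Proof.
suff st : Y (state s f pi y0 t w) by split=> //; split=> //=; exact: (api t).2.
elim: t => [//|t IH] /=; apply: (f_inv H) => //; exact: (api t).2.
Qed.

(** The sigma-algebra is left arbitrary so that the one generated by [past s t] can be taken: the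
    state and control at time [t] are determined by the noise before [t]. *)
Lemma state_control_measurable (C : set (set Omega)) t :
  (forall i, (i < t)%N -> measurable_fun setT (s i : g_sigma_algebraType C -> borel S)) ->
  measurable_fun setT (z_ t : g_sigma_algebraType C -> borel T).
Proof.
move=> ms; suff mst : measurable_fun setT (state s f pi y0 t : g_sigma_algebraType C -> borel X).
  apply: (measurable_pair graph_compact) => //; last by move=> w; case: (state_in t w).
  apply: (@measurable_comp _ _ _ _ _ _ (Y : set (borel X))) => //.
  - exact: Y_measurable.
  - by move=> _ [w _ <-]; case: (state_in t w).
  - exact: (api t).1.
elim: t ms => [|t IH] ms; first exact: measurable_cst.
have ms' i : (i < t)%N -> measurable_fun setT (s i : g_sigma_algebraType C -> borel S).
  by move=> it; apply: ms; exact: ltnW.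
have mz : measurable_fun setT (z_ t : g_sigma_algebraType C -> borel T).
  apply: (measurable_pair graph_compact); last by move=> w; case: (state_in t w).
    exact: IH.
  apply: (@measurable_comp _ _ _ _ _ _ (Y : set (borel X))).
  - exact: Y_measurable.
  - by move=> _ [w _ <-]; case: (state_in t w).
  - exact: (api t).1.
  - exact: IH.
apply: (@measurable_caratheodory R n Uhat _ (g_sigma_algebraType C) S G
  (fun z x => f z.1 z.2 x) (z_ t) (s t)).
- exact: graph_compact.
- exact: f_within.
- by move=> c [Yc _]; exact: (f_measurable H).
- exact: mz.
- by move=> w; case: (state_in t w).
- exact: ms.
Qed.

Lemma state_control_past t :
  measurable_fun setT (z_ t : g_sigma_algebraType (past s t) -> borel T).
Proof.
apply: state_control_measurable => i it _ B mB; rewrite setTI.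
by apply: sub_sigma_algebra; exact: past_preim.
Qed.

Lemma state_control_rv t : measurable_fun setT (z_ t : Omega -> borel T).
Proof.
move=> _ B mB; have := @state_control_past t measurableT B mB.
exact: sigma_past_measurable.
Qed.

End trajectories.

Local Notation M phi := (fun z : T => mean_next s f phi z.1 z.2).

Lemma bmeas_comp_Y d' (Om : measurableType d') (F : Om -> X) (phi : X -> R) :
  measurable_fun setT (F : Om -> borel X) -> (forall w, Y (F w)) ->
  bmeas (Y : set (borel X)) phi -> bmeas setT (fun w => phi (F w)).
Proof.
move=> mF FY [mphi [B phiB]]; split; last by exists B => w _; exact: phiB.
apply: (@measurable_comp _ _ _ _ _ _ (Y : set (borel X)) phi setT (F : Om -> borel X)) => //.
  exact: Y_measurable.
by move=> _ [w _ <-].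
Qed.

Lemma f_bmeas (phi : X -> R) z : G z -> bmeas (Y : set (borel X)) phi ->
  bmeas setT (fun x : borel S => phi (f z.1 z.2 x)).
Proof.
move=> Gz; apply: (@bmeas_comp_Y _ (borel S) (f z.1 z.2)).
  by case: Gz => Yz _; exact: (f_measurable H).
by move=> x; exact: f_graph_in.
Qed.

Lemma f_bmeas_rv (phi : X -> R) z i : G z -> bmeas (Y : set (borel X)) phi ->
  bmeas setT (fun w => phi (f z.1 z.2 (s i w))).
Proof.
move=> Gz /(f_bmeas Gz)[mphi [B phiB]]; split; last first.
  by exists B => w _; exact: (phiB (s i w)).
by apply: (measurableT_comp mphi).
Qed.

Lemma cont_on_Y_bmeas (phi : X -> R) : cont_on Y phi -> bmeas (Y : set (borel X)) phi.
Proof.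
apply: cont_on_bmeas; [exact: norm_hausdorff|exact: Y_compact H].
Qed.

Lemma cont_on_graph_bmeas (phi : T -> R) : cont_on G phi -> bmeas (G : set (borel T)) phi.
Proof.
apply: cont_on_bmeas; [exact: hausdorff_pair|exact: graph_compact].
Qed.

(** Boxes form a countable neighbourhood basis, so sequences detect continuity; in this form
    continuity of [mean_next] follows from bounded convergence. *)
Lemma cont_onP (D : set T) (h : T -> R) :
  (forall z (c : nat -> T), D z -> (forall k, D (c k)) -> c @ \oo --> z ->
     h \o c @ \oo --> h z) -> cont_on D h.
Proof.
move=> seq; apply/subspace_continuousP => z Dz; apply: contrapT => ncvg.
have [e e0 He] : exists2 e, 0 < e &
    ~ (\forall z' \near within D (nbhs z), ball (h z) e (h z')).
  apply: contrapT => He; apply: ncvg; apply/cvg_ballP => e e0.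
  by apply: contrapT => He'; apply: He; exists e.
have ex k : exists c, [/\ D c, box k z c & ~ ball (h z) e (h c)].
  apply: contrapT => nex; apply: He; rewrite /within/= nearE.
  have : nbhs z (box k z).
    by apply: open_nbhs_nbhs; split; [exact: box_open|exact: (@box_center _ _ _ k)].
  apply: filterS => c zc Dc; apply: contrapT => nb; apply: nex; by exists c.
have [c Hc] := choice ex.
have cz : c @ \oo --> z.
  move=> B /box_small[k0 Hk0]; exists k0 => // k /= kk.
  apply: (Hk0 k kk z); [exact: (@box_center _ _ _ k)|by case: (Hc k)].
have Dc k : D (c k) by case: (Hc k).
have [N _ /(_ N (leqnn N))] := seq z c Dz Dc cz _ (nbhsx_ballx (h z) e e0).
by case: (Hc N).
Qed.

Lemma cvg_within_seq (D : set T) (V : topologicalType) (h : T -> V) z (c : nat -> T) :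
  {within D, continuous h} -> D z -> (forall k, D (c k)) -> c @ \oo --> z ->
  h \o c @ \oo --> h z.
Proof.
move=> /subspace_continuousP/(_ z) ch Dz Dc cz.
apply: (cvg_comp _ _ _ (ch Dz)) => B; rewrite /within/= => nB.
have [N _ HN] := cz _ nB; exists N => // k /= Nk.
by apply: (HN k Nk); exact: Dc.
Qed.

Lemma cont_on_Y_seq (phi : X -> R) y (c : nat -> X) : cont_on Y phi -> Y y ->
  (forall k, Y (c k)) -> c @ \oo --> y -> phi \o c @ \oo --> phi y.
Proof.
move=> /subspace_continuousP/(_ y) ch Yy Yc cy.
apply: (cvg_comp _ _ _ (ch Yy)) => B; rewrite /within/= => nB.
have [N _ HN] := cy _ nB; exists N => // k /= Nk.
by apply: (HN k Nk); exact: Yc.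
Qed.

Lemma f_cvg (phi : X -> R) x z (c : nat -> T) : cont_on Y phi -> G z ->
  (forall k, G (c k)) -> c @ \oo --> z ->
  (fun k => phi (f (c k).1 (c k).2 x)) @ \oo --> phi (f z.1 z.2 x).
Proof.
move=> cphi Gz Gc cz; apply: (cont_on_Y_seq cphi) => [||].
- exact: f_graph_in.
- by move=> k; exact: f_graph_in.
- exact: (@cvg_within_seq G _ (fun z => f z.1 z.2 x) z c (@f_within x) Gz Gc cz).
Qed.

Lemma mean_next_cont (phi : X -> R) : cont_on Y phi -> cont_on G (M phi).
Proof.
move=> cphi; apply: cont_onP => z c Gz Gc cz.
have bphi := cont_on_Y_bmeas cphi; have [_ [B phiB]] := bphi.
have [] := @bounded_convergence _ Omega R P setT measurableT
  (fun k w => phi (f (c k).1 (c k).2 (s 0%N w))) (fun w => phi (f z.1 z.2 (s 0%N w))) B.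
- by move=> k; case: (f_bmeas_rv 0%N (Gc k) bphi).
- by move=> k w _; apply: phiB; exact: f_graph_in.
- by move=> w _; exact: f_cvg.
- by [].
Qed.

Lemma mean_next_abs (phi : X -> R) B z : G z -> bmeas (Y : set (borel X)) phi ->
  (forall y, Y y -> `|phi y| <= B) -> `|M phi z| <= B.
Proof.
move=> Gz bphi phiB; apply: Rintegral_abs_le => //; first exact: probability_setT.
  exact: f_bmeas_rv.
by move=> w _; apply: phiB; exact: f_graph_in.
Qed.

(* [z] is approximated by functions of the past with finitely many values, for
   which the identity is independence of [s t] from the past. *)
Lemma markov_cont t (z : Omega -> T) (phi : X -> R) :
  measurable_fun setT (z : g_sigma_algebraType (past s t) -> borel T) ->
  (forall w, G (z w)) -> cont_on Y phi ->
  \int[P]_w phi (f (z w).1 (z w).2 (s t w)) = \int[P]_w M phi (z w).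
Proof.
move=> mz Gz cphi.
have bphi := cont_on_Y_bmeas cphi; have [_ [B phiB]] := bphi.
have cM := mean_next_cont cphi.
have net k := @compact_net R T G (@box _ _ _ k) hausdorff_pair graph_compact
  graph_nonempty (@box_open _ _ _ k) (@box_center _ _ _ k).
have [N HN] := choice net; have [c Hc] := choice HN; have {HN Hc}[idx Hidx] := choice Hc.
pose zk k w := c k (idx k (z w)).
have Gzk k w : G (zk k w) by have [+ _ _] := Hidx k; exact.
have zkz w : zk^~ w @ \oo --> z w.
  by apply: box_cvg => k; have [_ /(_ _ (Gz w))[]] := Hidx k.
pose A k i := z @^-1` (G `&` idx k @^-1` [set i]).
have sA k i : <<s past s t >> (A k i).
  have [_ _ /(_ i) mi] := Hidx k; have := mz measurableT _ mi; rewrite setTI.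
  exact.
have mA k i : measurable (A k i) by exact: sigma_past_measurable (sA k i).
have Gc k i : G (c k i) by have [+ _ _] := Hidx k; exact.
have AE k w i : (w \in A k i) = (idx k (z w) == i).
  by apply/idP/eqP => [/set_mem[]//|e]; apply/mem_set; split.
have split_sum k (h : T -> Omega -> R) w :
    h (zk k w) w = \sum_(i < N k) (\1_(A k i) w * h (c k i) w).
  have [_ /(_ _ (Gz w))[iN _] _] := Hidx k.
  rewrite (bigD1 (Ordinal iN))//= big1 ?addr0; last first.
    move=> i ni; rewrite indicE AE; case: eqP => [e|_]; last by rewrite mul0r.
    by move: ni; rewrite -val_eqE/= e eqxx.
  by rewrite indicE AE eqxx mul1r.
have bprod k i (h : Omega -> R) : bmeas setT h -> bmeas setT (fun w => \1_(A k i) w * h w).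
  move=> [mh [B' hB']]; split; first by apply: measurable_funM => //; exact: measurable_indic.
  exists B' => w _; rewrite normrM; apply: le_trans (hB' w I).
  rewrite ler_piMl// indicE; by case: (_ \in _); rewrite ?normr1 ?normr0.
have simple k (h : T -> Omega -> R) : (forall i, bmeas setT (h (c k i))) ->
    bmeas setT (fun w => h (zk k w) w) /\
    \int[P]_w h (zk k w) w = \sum_(i < N k) \int[P]_(w in A k i) h (c k i) w.
  move=> bh.
  have -> : (fun w => h (zk k w) w) =
      (fun w => \sum_(i < N k) (\1_(A k i) w * h (c k i) w)).
    by apply/funext => w; rewrite split_sum.
  split; first by apply: bmeas_sum => // i _; exact: bprod.
  rewrite Rintegral_sum//; last 2 first.
    exact: probability_setT.
    by move=> i _; exact: bprod.
  apply: eq_bigr => i _; rewrite [RHS]Rintegral_mkcond; apply: eq_Rintegral => w _.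
  by rewrite patchE indicE; case: ifP => _; rewrite ?mul1r ?mul0r.
have [] := @bounded_convergence _ Omega R P setT measurableT
  (fun k w => phi (f (zk k w).1 (zk k w).2 (s t w)))
  (fun w => phi (f (z w).1 (z w).2 (s t w))) B.
- move=> k; have [[mk _] _] := simple k (fun c w => phi (f c.1 c.2 (s t w)))
    (fun i => f_bmeas_rv t (Gc k i) bphi).
  exact: mk.
- by move=> k w _; apply: phiB; exact: f_graph_in.
- move=> w _; exact: (@f_cvg phi (s t w) (z w) (zk^~ w) cphi (Gz w) (Gzk^~ w) (zkz w)).
move=> _ c1.
have [] := @bounded_convergence _ Omega R P setT measurableT
  (fun k w => M phi (zk k w)) (fun w => M phi (z w)) B.
- by move=> k; have [[mk _] _] := simple k (fun c w => M phi c) (fun i => bmeas_cst _ _).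
- by move=> k w _; exact: mean_next_abs.
- move=> w _; exact: (@cvg_within_seq G _ (M phi) (z w) (zk^~ w) cM (Gz w) (Gzk^~ w) (zkz w)).
move=> _ c2.
apply: (cvg_unique (@Rhausdorff R) c1); apply: cvg_trans c2; apply: near_eq_cvg.
apply: nearW => k.
have [_ ->] := simple k (fun c w => M phi c) (fun i => bmeas_cst _ _).
have [_ ->] := simple k (fun c w => phi (f c.1 c.2 (s t w))) (fun i => f_bmeas_rv t (Gc k i) bphi).
apply: eq_bigr => i _; rewrite Rintegral_cst// mulrC.
rewrite (@past_integral _ _ _ _ _ P s (s_indep H) (s_id H) t _
  (fun x => phi (f (c k i).1 (c k i).2 x)))//.
exact: f_bmeas.
Qed.

End dynamics.

(** * Dynamic programming *)

Section measurable_selection.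
Context {R : realType} {Uhat : pmetricType R} {d : measure_display} {X : measurableType d}.
Variables (Y : set X) (K : X -> set Uhat).
Hypotheses (mY : measurable Y) (cU : compact [set: Uhat])
  (K0 : forall y, Y y -> K y !=set0) (cK : forall y, Y y -> closed (K y))
  (mK : forall C, closed C -> measurable (Y `&` [set y | K y `&` C !=set0])).

Lemma close_radius (u v : Uhat) :
  (forall j, exists c, closure (ball c (j.+1%:R^-1 : R)) u /\
     closure (ball c (j.+1%:R^-1 : R)) v) -> u = v.
Proof.
move=> uv; apply: (close_eq (@metric_hausdorff R Uhat)); rewrite ball_close => e.
have e4 : 0 < e%:num / 4 by rewrite divr_gt0.
have [N _ /(_ N (leqnn N))/= Ne] := @near_infty_natSinv_lt R (PosNum e4).
have N0 : 0 < N.+1%:R^-1 :> R by rewrite invr_gt0.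
have [c [cu cv]] := uv N.
have half w : closure (ball c (N.+1%:R^-1 : R)) w -> ball c (e%:num / 2) w.
  move=> /(_ _ (nbhsx_ballx w _ N0))[x [cx wx]].
  have -> : e%:num / 2 = e%:num / 4 + e%:num / 4 by field.
  apply: (@ball_triangle _ _ x); first exact: le_ball (ltW Ne) _ cx.
  by apply: ball_sym; exact: le_ball (ltW Ne) _ wx.
rewrite (splitr e%:num); apply: (@ball_triangle _ _ c); last exact: half.
by apply: ball_sym; exact: half.
Qed.

(* [K y] is cut down successively to the first ball of a finite [1/(j+1)]-net
   that it hits; the remaining point depends measurably on [y]. *)
Lemma measurable_selection : exists sigma : X -> Uhat,
  measurable_fun Y (sigma : X -> borel Uhat) /\ forall y, Y y -> K y (sigma y).
Proof.
have hU := @metric_hausdorff R Uhat.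
have j0 j : 0 < j.+1%:R^-1 :> R by rewrite invr_gt0.
have net j := @compact_net R Uhat setT (fun c => (ball c (j.+1%:R^-1 : R))°) hU cU
  (ex_intro _ point I) (fun c => @open_interior _ _)
  (fun c => nbhsx_ballx c _ (j0 j)).
have [N HN] := choice net; have [c Hc] := choice HN; have {HN Hc net}[idx Hidx] := choice Hc.
pose B j i := closure (ball (c j i) (j.+1%:R^-1 : R)).
have cB j i : closed (B j i) by exact: closed_closure.
have covB j u : exists i, B j i u.
  have [_ /(_ u I)[_ Bu] _] := Hidx j; exists (idx j u).
  by apply: subset_closure; exact: interior_subset Bu.
pose hit (L : set Uhat) j i := L `&` B j i !=set0 /\
  forall i', (i' < i)%N -> ~ (L `&` B j i' !=set0).
pose refine j (L : set Uhat) := L `&` [set u | exists2 i, hit L j i & B j i u].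
pose Kj := fix Kj j y := if j is j'.+1 then refine j' (Kj j' y) else K y.
have hit_ex L j : L !=set0 -> exists i, hit L j i.
  move=> [u Lu]; have [i0 Biu] := covB j u.
  have ex : exists i, `[< L `&` B j i !=set0 >] by exists i0; apply/asboolP; exists u.
  exists (ex_minn ex); case: ex_minnP => i /asboolP Li mini; split=> // i' i'i /asboolP Li'.
  by have := mini _ Li'; rewrite leqNgt i'i.
have hit_uniq L j i i' : hit L j i -> hit L j i' -> i = i'.
  move=> [Li mi] [Li' mi']; apply/eqP; rewrite eqn_leq; apply/andP; split; rewrite leqNgt;
    apply/negP => lt; [exact: mi lt Li'|exact: mi' lt Li].
have refineE L j i : hit L j i -> refine j L = L `&` B j i.
  move=> hi; apply/seteqP; split=> u [Lu].
    by move=> [i' hi' Bu]; split=> //; rewrite (hit_uniq _ _ _ _ hi hi').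
  by move=> Bu; split=> //; exists i.
have KjP j y : Y y -> Kj j y !=set0 /\ closed (Kj j y).
  move=> Yy; elim: j => [|j [n0 cl]] /=; first by split; [exact: K0|exact: cK].
  have [i hi] := hit_ex _ j n0; rewrite (refineE _ _ _ hi); split; first by case: hi.
  exact: closedI.
have mKj j C : closed C -> measurable (Y `&` [set y | Kj j y `&` C !=set0]).
  elim: j C => [|j IH] C cC; first exact: mK.
  (* The points [y] are sorted by the first ball that [Kj j y] meets; if it is ball [i], the refined
     set meets [C] exactly when [Kj j y], [B j i] and [C] have a common point. *)
  rewrite (_ : _ `&` _ = \bigcup_i ((Y `&` [set y | Kj j y `&` (B j i `&` C) !=set0]) `&`
      \bigcap_(i' in `I_i) (Y `\` (Y `&` [set y | Kj j y `&` B j i' !=set0])))).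
    apply: bigcupT_measurable => i; apply: measurableI; first by apply: IH; exact: closedI.
    by apply: bigcap_measurableType => i' _; apply: measurableD => //; exact: IH.
  apply/seteqP; split=> y /=.
    move=> [Yy [u [[Ku [i hi Bu]] Cu]]]; exists i => //; split.
      by split=> //; exists u.
    move=> i' /= i'i; split=> //; case: hi => _ /(_ _ i'i) ni' [_]; exact: ni'.
  move=> [i _ [[Yy [u [Ku [Bu Cu]]]] Hi]]; split=> //; exists u; split=> //; split=> //.
  exists i => //; split; first by exists u.
  by move=> i' /Hi[_ nY] Ki'; exact: nY.
have KS j y : Kj j.+1 y `<=` Kj j y by move=> u [].
have ex y : exists u, Y y -> forall j, Kj j y u.
  have [Yy|nY] := pselect (Y y); last by exists point.
  have [||||u Hu] := @compact_nested Uhat (fun j => Kj j y).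
  - by apply: (subclosed_compact _ cU) => //; case: (KjP 0%N y Yy).
  - by move=> j; case: (KjP j y Yy).
  - by move=> j; exact: KS.
  - by move=> j; case: (KjP j y Yy).
  by exists u => _ j; exact: Hu.
have [sigma Hsigma] := choice ex.
exists sigma; split; last by move=> y Yy; exact: (Hsigma y Yy 0%N).
have uniq y u v : Y y -> (forall j, Kj j y u) -> (forall j, Kj j y v) -> u = v.
  move=> Yy Ku Kv; apply: close_radius => j.
  have [n0 _] := KjP j y Yy; have [i hi] := hit_ex _ j n0.
  have := Ku j.+1; have := Kv j.+1; rewrite /= (refineE _ _ _ hi) => -[_ Bv] [_ Bu].
  by exists (c j i).
(* The sets [Kj j y] shrink to the single point [sigma y], so by compactness this point is in [C] as
   soon as every [Kj j y] meets [C]. *)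
have closed_pre C : closed C -> measurable (Y `&` sigma @^-1` C).
  move=> cC; rewrite (_ : _ `&` _ = \bigcap_j (Y `&` [set y | Kj j y `&` C !=set0])).
    by apply: bigcap_measurableType => j _; exact: mKj.
  apply/seteqP; split=> y /=.
    by move=> [Yy Cy] j _; split=> //; exists (sigma y); split=> //; exact: Hsigma.
  move=> HC; have Yy : Y y by have [] := HC 0%N I.
  split=> //=.
  have [||||u Hu] := @compact_nested Uhat (fun j => Kj j y `&` C).
  - apply: (subclosed_compact _ cU) => //; apply: closedI => //.
    by case: (KjP 0%N y Yy).
  - by move=> j; apply: closedI => //; case: (KjP j y Yy).
  - by move=> j; apply: setSI; exact: KS.
  - by move=> j; have [] := HC j I.
  rewrite (uniq y (sigma y) u)//; [by have [] := Hu 0%N I|exact: Hsigma|].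
  by move=> j; have [] := Hu j I.
apply: measurable_fun_borel => O oO.
have -> : Y `&` sigma @^-1` O = Y `\` (Y `&` sigma @^-1` (~` O)).
  apply/seteqP; split=> y /= [Yy]; first by move=> Oy; split=> // -[].
  by move=> nO; split=> //; apply: contrapT => nOy; exact: nO.
by apply: measurableD => //; apply: closed_pre; exact: open_closedC.
Qed.

End measurable_selection.

Section monotone_limits.
Context {R : realType} {T : ptopologicalType}.
Implicit Types (D : set T) (V : T -> R).

(* Bounded lower semicontinuous functions, encoded as limits of increasing
   uniformly bounded sequences of continuous functions. *)
Definition lsc_bounded D V := exists phi : nat -> T -> R,
  [/\ forall k, cont_on D (phi k),
      exists M : R, forall k x, D x -> `|phi k x| <= M,
      forall k x, D x -> phi k x <= phi k.+1 x &
      forall x, D x -> phi ^~ x @ \oo --> V x].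

Lemma lsc_bounded_le D V r : closed D -> lsc_bounded D V ->
  closed (D `&` [set x | V x <= r]).
Proof.
move=> cD [phi [cphi _ dphi phiV]].
have -> : D `&` [set x | V x <= r] = \bigcap_k (D `&` phi k @^-1` [set y | y <= r]).
  apply/seteqP; split=> [x [Dx Vr] k _|x Dphi].
    split=> //=; apply: le_trans Vr.
    have nd : nondecreasing_seq (phi ^~ x) by apply/nondecreasing_seqP => i; exact: dphi.
    have := nondecreasing_cvgn_le nd (cvgP _ (phiV x Dx)) k.
    by rewrite (cvg_lim (@Rhausdorff R) (phiV x Dx)).
  have Dx : D x by have [] := Dphi 0%N I.
  split=> //=; apply: (cvgr_to_le (phiV x Dx)); apply: nearW => k.
  by have [] := Dphi k I.
apply: closed_bigI => k _.
exact: (closed_preimage_within cD (cphi k) (@closed_le _ r)).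
Qed.

Lemma lsc_bounded_bmeas D V : closed D -> lsc_bounded D V -> bmeas (D : set (borel T)) V.
Proof.
move=> cD lV; split.
  apply: measurable_fun_sublevel; first exact: closed_borel.
  by move=> r; apply: closed_borel; exact: lsc_bounded_le.
have [phi [_ [M phiM] _ phiV]] := lV.
exists M => x Dx; rewrite ler_norml; apply/andP; split.
  apply: (cvgr_to_ge (phiV x Dx)); apply: nearW => k.
  by have := phiM k x Dx; rewrite ler_norml => /andP[].
apply: (cvgr_to_le (phiV x Dx)); apply: nearW => k.
by have := phiM k x Dx; rewrite ler_norml => /andP[].
Qed.

End monotone_limits.

(* Baire's inf-convolutions [inf_y' V y' + k |y - y'|] increase to [V]. *)
Lemma lsc_bounded_of_sublevel (R : realType) (n : nat) (Y : set 'rV[R]_n) (V : 'rV[R]_n -> R) :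
  Y !=set0 -> (forall r, closed (Y `&` [set y | V y <= r])) ->
  (exists M : R, forall y, Y y -> `|V y| <= M) -> lsc_bounded Y V.
Proof.
move=> [y1 Yy1] cV [M VM].
pose E k (y : 'rV[R]_n) := [set V y' + k%:R * `|y - y'| | y' in Y].
pose phi k (y : 'rV[R]_n) := inf (E k y).
have lbE k y : lbound (E k y) (- M).
  move=> _ [y' Yy' <-]; apply: (@le_trans _ _ (V y')).
    by have := VM y' Yy'; rewrite ler_norml => /andP[].
  by rewrite lerDl mulr_ge0.
have infE k y : has_inf (E k y).
  by split; [exists (V y1 + k%:R * `|y - y1|), y1|exists (- M)].
have phi_le k y y' : Y y' -> phi k y <= V y' + k%:R * `|y - y'|.
  by move=> Yy'; apply: ge_inf; [case: (infE k y)|exists y'].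
have phiV k y : Y y -> phi k y <= V y.
  by move=> /(phi_le k y); rewrite subrr normr0 mulr0 addr0.
have phi_lip k y z : phi k y <= phi k z + k%:R * `|y - z|.
  rewrite -lerBlDr; apply: lb_le_inf; first by case: (infE k z).
  move=> _ [y' Yy' <-]; rewrite lerBlDr -addrA -mulrDr.
  apply: le_trans (phi_le k y y' Yy') _; rewrite lerD2l ler_wpM2l//.
  by rewrite [leRHS]addrC; exact: ler_distD.
have phiM k y : Y y -> `|phi k y| <= M.
  move=> Yy; rewrite ler_norml; apply/andP; split.
    by apply: lb_le_inf; [case: (infE k y)|exact: lbE].
  apply: le_trans (phiV k y Yy) _.
  by have := VM y Yy; rewrite ler_norml => /andP[].
exists phi; split.
- move=> k; apply/continuous_subspaceT => y B /nbhs_ballP[e /= e0 eB].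
  have k1 : 0 < k%:R + 1 :> R by rewrite ltr_wpDl.
  apply/nbhs_ballP; exists (e / (k%:R + 1)); first exact: divr_gt0.
  move=> z; rewrite -ball_normE/= ltr_pdivlMr// mulrC => yz.
  apply: eB; rewrite /ball/=; apply: le_lt_trans yz.
  apply: (@le_trans _ _ (k%:R * `|y - z|)); last by rewrite ler_wpM2r// lerDl.
  have h1 := phi_lip k y z; have h2 := phi_lip k z y; rewrite distrC in h2.
  by rewrite ler_norml; apply/andP; split; lra.
- by exists M => k y; exact: phiM.
- move=> k y Yy; apply: lb_le_inf; first by case: (infE k.+1 y).
  move=> _ [y' Yy' <-]; apply: le_trans (phi_le k y y' Yy') _.
  by rewrite lerD2l ler_wpM2r// ler_nat.
move=> y Yy; apply/cvgrPdist_le => e e0.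
have M0 : 0 <= M by exact: le_trans (normr_ge0 _) (VM y Yy).
have [r r0 Hr] : exists2 r : R, 0 < r & forall y', Y y' -> `|y - y'| < r -> V y - e < V y'.
  have : open (~` (Y `&` [set y' | V y' <= V y - e])) by exact: closed_openC.
  have : (~` (Y `&` [set y' | V y' <= V y - e])) y.
    by move=> [_ /=]; rewrite leNgt ltrBlDr ltrDl e0.
  move=> ny oN; have /nbhs_ballP[r /= r0 Hr] := open_nbhs_nbhs (conj oN ny).
  exists r => // y' Yy' yr; rewrite ltNge; apply/negP => le.
  by apply: (Hr y'); first by rewrite -ball_normE.
near=> k; rewrite ger0_norm ?subr_ge0 ?phiV// lerBlDr -lerBlDl.
apply: lb_le_inf; first by case: (infE k y).
move=> _ [y' Yy' <-]; have [yr|ry] := ltP `|y - y'| r.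
  by apply: ltW; apply: lt_le_trans (Hr y' Yy' yr) _; rewrite lerDl mulr_ge0.
(* At distance [r] or more the penalty is at least [2 * M], the largest possible oscillation of [V];
   closer points were handled by lower semicontinuity. *)
have kr : 2 * M / r <= k%:R by near: k; exact: nbhs_infty_ger.
have : 2 * M <= k%:R * `|y - y'|.
  apply: le_trans (_ : k%:R * r <= _); last by rewrite ler_wpM2l.
  by rewrite -ler_pdivrMr.
have := VM y Yy; have := VM y' Yy'; rewrite !ler_norml => /andP[? _] /andP[_ ?] ?.
lra.
Unshelve. all: by end_near. Qed.

Section value_iteration.
Context {R : realType} {n : nat} {Uhat : pmetricType R} {S : ptopologicalType}
  {d : measure_display} {Omega : measurableType d}.
Local Notation X := 'rV[R]_n.
Local Notation T := ('rV[R]_n * Uhat)%type.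
Variables (P : probability Omega R) (s : nat -> {RV P >-> borel S}).
Variables (Y : set X) (U : X -> set Uhat) (f : X -> Uhat -> S -> X).
Hypothesis H : standing_assumptions s Y U f.
Local Notation G := (graph Y U).
Local Notation M phi := (fun z : T => mean_next s f phi z.1 z.2).

Lemma lsc_bmeas_Y (V : X -> R) : lsc_bounded Y V -> bmeas (Y : set (borel X)) V.
Proof. by apply: lsc_bounded_bmeas; exact: (Y_closed H). Qed.

Lemma lsc_bmeas_graph (h : T -> R) : lsc_bounded G h -> bmeas (G : set (borel T)) h.
Proof.
apply: lsc_bounded_bmeas; apply: compact_closed; first exact: hausdorff_pair.
exact: graph_compact H.
Qed.

Lemma mean_next_cvg (phi : nat -> X -> R) (V : X -> R) (B : R) z : G z ->
  (forall k, cont_on Y (phi k)) -> (forall k x, Y x -> `|phi k x| <= B) ->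
  (forall x, Y x -> phi ^~ x @ \oo --> V x) ->
  (fun k => M (phi k) z) @ \oo --> M V z.
Proof.
move=> Gz cphi phiB phiV.
have [] := @bounded_convergence _ Omega R P setT measurableT
  (fun k w => phi k (f z.1 z.2 (s 0%N w))) (fun w => V (f z.1 z.2 (s 0%N w))) B.
- by move=> k; case: (f_bmeas_rv H 0%N Gz (cont_on_Y_bmeas H (cphi k))).
- by move=> k w _; apply: phiB; exact: (f_graph_in H).
- by move=> w _; apply: phiV; exact: (f_graph_in H).
- by [].
Qed.

Lemma mean_next_le (V W : X -> R) z : G z -> bmeas (Y : set (borel X)) V ->
  bmeas (Y : set (borel X)) W -> (forall x, Y x -> V x <= W x) -> M V z <= M W z.
Proof.
move=> Gz bV bW VW; apply: le_Rintegral => //.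
- by apply: bmeas_integrable => //; exact: (f_bmeas_rv H).
- by apply: bmeas_integrable => //; exact: (f_bmeas_rv H).
- by move=> w _; apply: VW; exact: (f_graph_in H).
Qed.

(** Expectations of an increasing bounded sequence increase and converge by domination; [0 <= b]
    preserves the direction. *)
Lemma bellman_lsc (q : T -> R) (a b : R) (V : X -> R) : cont_on G q -> 0 <= b ->
  lsc_bounded Y V -> lsc_bounded G (fun z => a * q z + b * M V z).
Proof.
move=> cq b0 [phi [cphi [B phiB] dphi phiV]].
exists (fun k z => a * q z + b * M (phi k) z); split.
- by move=> k; apply: cont_onD; apply: cont_onZ => //; exact: (mean_next_cont H).
- have [Bq qB] := cont_on_bounded (graph_compact H) cq.
  exists (`|a| * Bq + b * B) => k z Gz.
  apply: le_trans (ler_normD _ _) _; rewrite !normrM (ger0_norm b0).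
  apply: lerD; apply: ler_wpM2l => //; first exact: qB.
  by apply: (mean_next_abs H) => //; [exact: (cont_on_Y_bmeas H)|exact: phiB].
- move=> k z Gz; rewrite lerD2l ler_wpM2l//.
  by apply: mean_next_le => //; [exact: (cont_on_Y_bmeas H)|exact: (cont_on_Y_bmeas H)|exact: dphi].
move=> z Gz; apply: cvgD; first exact: cvg_cst.
by apply: cvgM; [exact: cvg_cst|exact: (@mean_next_cvg phi V B)].
Qed.

Lemma mean_next_bmeas (V : X -> R) : lsc_bounded Y V -> bmeas (G : set (borel T)) (M V).
Proof.
move=> lV; apply: lsc_bmeas_graph.
have := bellman_lsc 0 (@cont_on_cst R T G 0) ler01 lV.
by under eq_fun do rewrite mul0r add0r mul1r.
Qed.

Lemma fst_lsc (V : X -> R) : lsc_bounded Y V -> lsc_bounded G (fun z : T => V z.1).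
Proof.
move=> [phi [cphi [B phiB] dphi phiV]]; exists (fun k z => phi k z.1); split.
- move=> k; apply: cont_onP => z c [Yz _] Gc cz.
  apply: (@cont_on_Y_seq _ _ Y (phi k) z.1 (fun k => (c k).1)) => //.
    by move=> i; case: (Gc i).
  exact: (cvg_comp _ _ cz cvg_fst).
- by exists B => k z [Yz _]; exact: phiB.
- by move=> k z [Yz _]; exact: dphi.
- by move=> z [Yz _]; exact: phiV.
Qed.

Lemma fst_bmeas (V : X -> R) : lsc_bounded Y V ->
  bmeas (G : set (borel T)) (fun z => V z.1).
Proof. by move=> /fst_lsc; exact: lsc_bmeas_graph. Qed.

Lemma cont_on_lsc (D : set X) (phi : X -> R) : compact D -> cont_on D phi -> lsc_bounded D phi.
Proof.
move=> cD cphi; exists (fun=> phi); split=> //.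
- by have [B HB] := cont_on_bounded cD cphi; exists B => _; exact: HB.
- by move=> x _; exact: cvg_cst.
Qed.

Lemma markov_lsc t (z : Omega -> T) (V : X -> R) :
  measurable_fun setT (z : g_sigma_algebraType (past s t) -> borel T) ->
  (forall w, G (z w)) -> lsc_bounded Y V ->
  \int[P]_w V (f (z w).1 (z w).2 (s t w)) = \int[P]_w M V (z w).
Proof.
move=> mz Gz [phi [cphi [B phiB] dphi phiV]].
have mz' : measurable_fun setT (z : Omega -> borel T).
  move=> _ A mA; exact: sigma_past_measurable (mz measurableT A mA).
have mf k : measurable_fun setT (fun w => phi k (f (z w).1 (z w).2 (s t w))).
  have [] // := @bmeas_comp_Y _ _ _ _ _ _ _ _ _ _ _ H _ Omega
    (fun w => f (z w).1 (z w).2 (s t w)) (phi k).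
  - apply: (@measurable_caratheodory R n Uhat _ Omega S G (fun z x => f z.1 z.2 x) z (s t)) => //.
    + exact: graph_compact H.
    + exact: (f_within H).
    + by move=> c [Yc _]; exact: (f_measurable H).
  - by move=> w; exact: (f_graph_in H).
  - exact: (cont_on_Y_bmeas H).
have mM k : measurable_fun setT (fun w => M (phi k) (z w)).
  have [mMk _] := cont_on_graph_bmeas H (mean_next_cont H (cphi k)).
  apply: (@measurable_comp _ _ _ _ _ _ (G : set (borel T)) (M (phi k)) setT
    (z : Omega -> borel T)) => //.
    exact: graph_measurable H.
  by move=> _ [w _ <-].
have [_ c1] := @bounded_convergence _ Omega R P setT measurableT
  (fun k w => phi k (f (z w).1 (z w).2 (s t w))) (fun w => V (f (z w).1 (z w).2 (s t w))) B
  mf (fun k w _ => phiB k _ (f_graph_in H _ (Gz w))) (fun w _ => phiV _ (f_graph_in H _ (Gz w))).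
have [_ c2] := @bounded_convergence _ Omega R P setT measurableT
  (fun k w => M (phi k) (z w)) (fun w => M V (z w)) B
  mM (fun k w _ => mean_next_abs H (Gz w) (cont_on_Y_bmeas H (cphi k)) (phiB k))
  (fun w _ => mean_next_cvg (Gz w) cphi phiB phiV).
apply: (cvg_unique (@Rhausdorff R) c1); apply: cvg_trans c2; apply: near_eq_cvg.
by apply: nearW => k; rewrite (markov_cont H mz Gz (cphi k)).
Qed.

(* Membership in [W_disc] ([b = 1 - eps], [e = eps]) or in [W] ([b = 1], [e = 0]),
   extended from continuous to lower semicontinuous test functions. *)
Lemma transition_identity (gamma : probability (borel T) R) (b e : R) y0 : Y y0 ->
  probs_on G gamma ->
  (forall phi, cont_on Y phi -> b * \int[gamma]_(z in (G : set (borel T))) M phi z + e * phi y0 =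
     \int[gamma]_(z in (G : set (borel T))) phi z.1) ->
  forall V, lsc_bounded Y V -> b * \int[gamma]_(z in (G : set (borel T))) M V z + e * V y0 =
     \int[gamma]_(z in (G : set (borel T))) V z.1.
Proof.
move=> Yy0 gG id V [phi [cphi [B phiB] dphi phiV]].
have lphi k : lsc_bounded Y (phi k) by apply: cont_on_lsc => //; exact: Y_compact H.
have mG := graph_measurable H.
have [_ c1] := @bounded_convergence _ (borel T) R gamma G mG
  (fun k z => M (phi k) z) (M V) B (fun k => (mean_next_bmeas (lphi k)).1)
  (fun k z Gz => mean_next_abs H Gz (cont_on_Y_bmeas H (cphi k)) (phiB k))
  (fun z Gz => mean_next_cvg Gz cphi phiB phiV).
have [_ c2] := @bounded_convergence _ (borel T) R gamma G mG
  (fun k z => phi k z.1) (fun z => V z.1) B (fun k => (fst_bmeas (lphi k)).1)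
  (fun k z Gz => phiB k z.1 Gz.1) (fun z Gz => phiV z.1 Gz.1).
apply: (cvg_unique (@Rhausdorff R) _ c2).
rewrite (_ : (fun k => _) =
  (fun k => b * \int[gamma]_(z in (G : set (borel T))) M (phi k) z + e * phi k y0)).
  apply: cvgD; apply: cvgM; try exact: cvg_cst; first exact: c1.
  exact: phiV.
by apply/funext => k; rewrite id.
Qed.

End value_iteration.

Section optimal_plans.
Context {R : realType} {n : nat} {Uhat : pmetricType R} {S : ptopologicalType}
  {d : measure_display} {Omega : measurableType d}.
Local Notation X := 'rV[R]_n.
Local Notation T := ('rV[R]_n * Uhat)%type.
Variables (P : probability Omega R) (s : nat -> {RV P >-> borel S}).
Variables (Y : set X) (U : X -> set Uhat) (f : X -> Uhat -> S -> X).
Hypothesis H : standing_assumptions s Y U f.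
Local Notation G := (graph Y U).
Local Notation M phi := (fun z : T => mean_next s f phi z.1 z.2).

(** The set where the minimum is at most [r] is the projection of the compact set where [h <= r],
    hence closed. The minimisers at each [y] form a nonempty closed set, from which a Borel selector
    is drawn. *)
Lemma lsc_minimum (h : T -> R) : lsc_bounded G h ->
  exists (V : X -> R) (sigma : X -> Uhat), [/\ lsc_bounded Y V,
    measurable_fun (Y : set (borel X)) (sigma : borel X -> borel Uhat),
    (forall y, Y y -> U y (sigma y)),
    (forall y, Y y -> V y = h (y, sigma y)) &
    (forall y u, Y y -> U y u -> V y <= h (y, u))].
Proof.
move=> lh; have cG := graph_compact H.
have hT := @hausdorff_pair R n Uhat.
have cGh r : closed (G `&` [set z | h z <= r]).
  by apply: lsc_bounded_le => //; exact: compact_closed.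
have [_ [B hB]] := lsc_bmeas_graph H lh.
pose E y := [set h (y, u) | u in U y].
pose V y := inf (E y).
have infE y : Y y -> has_inf (E y).
  move=> Yy; split; first by have [u Uu] := U_nonempty H Yy; exists (h (y, u)), u.
  exists (- B) => _ [u Uu <-]; have := hB (y, u) (conj Yy Uu).
  by rewrite ler_norml => /andP[].
have Vle y u : Y y -> U y u -> V y <= h (y, u).
  by move=> Yy Uu; apply: ge_inf; [case: (infE y Yy)|exists u].
have Vm0 (m : nat) : 0 < m.+1%:R^-1 :> R by rewrite invr_gt0.
pose sec y r := [set u | U y u /\ h (y, u) <= r].
have sec_closed y r : Y y -> closed (sec y r).
  move=> Yy; have -> : sec y r = (fun u => (y, u)) @^-1` (G `&` [set z | h z <= r]).
    by apply/seteqP; split=> u /=; [move=> [Uu hu]; split|move=> [[_ Uu] hu]; split].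
  apply: (@preimage_closed _ _ (fun u : Uhat => (y, u))); last exact: cGh.
  move=> u _ N [[B1 B2] [/= n1 n2] sub]; apply: filterS n2 => v Bv.
  by apply: sub; split=> //=; exact: nbhs_singleton n1.
have attained y C : Y y -> closed C ->
    (forall m, sec y (V y + m.+1%:R^-1) `&` C !=set0) -> sec y (V y) `&` C !=set0.
  move=> Yy cC ne.
  have cl m : closed (sec y (V y + m.+1%:R^-1) `&` C) by apply: closedI => //; exact: sec_closed.
  have [|m|m|m|u Hu] := @compact_nested Uhat (fun m => sec y (V y + m.+1%:R^-1) `&` C).
  - by apply: (subclosed_compact (cl 0%N) (Uhat_compact H)).
  - exact: cl.
  - move=> u [[Uu hu] Cu]; split=> //; split=> //; apply: le_trans hu _.
    by rewrite lerD2l lef_pV2 ?posrE// ler_nat.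
  - exact: ne.
  exists u; split; last by have [] := Hu 0%N I.
  split; first by have [[]] := Hu 0%N I.
  apply/ler_addgt0Pr => e e0.
  have [m _ /(_ m (leqnn m))/= me] := @near_infty_natSinv_lt R (PosNum e0).
  have [[_ hu] _] := Hu m I; apply: le_trans hu _; rewrite lerD2l; exact: ltW.
have min_ex y : Y y -> sec y (V y) !=set0.
  move=> Yy; suff : sec y (V y) `&` setT !=set0 by rewrite setIT.
  apply: attained => //.
  move=> m; have [_ [u Uu <-] lt] := inf_adherent (Vm0 m) (infE y Yy).
  by exists u; split=> //; split=> //; exact: ltW.
pose proj C r := Y `&` [set y | sec y r `&` C !=set0].
have proj_closed C r : closed C -> closed (proj C r).
  move=> cC; have -> : proj C r = fst @` ((G `&` [set z | h z <= r]) `&` (snd @^-1` C)).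
    apply/seteqP; split=> [y [Yy [u [[Uu hu] Cu]]]|_ [[y u] [[[/= Yy Uu] hu] Cu] <-]].
      by exists (y, u).
    by split=> //; exists u.
  apply: compact_closed; first exact: norm_hausdorff.
  apply: continuous_compact.
    by apply: continuous_subspaceT => z; exact: cvg_fst.
  apply: (subclosed_compact _ cG); last by move=> z [[]].
  apply: closedI; first exact: cGh.
  by apply: preimage_closed => // z _; exact: cvg_snd.
have V_sub r : Y `&` [set y | V y <= r] = proj setT r.
  apply/seteqP; split=> y [Yy].
    move=> /= Vr; have [u [Uu hu]] := min_ex y Yy.
    by split=> //; exists u; split=> //; split=> //; exact: le_trans Vr.
  by move=> [u [[Uu hu] _]]; split=> //=; apply: le_trans hu; exact: Vle.
have [sigma [msigma Ksigma]] : exists sigma : X -> Uhat,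
    measurable_fun (Y : set (borel X)) (sigma : borel X -> borel Uhat) /\
    forall y, Y y -> sec y (V y) (sigma y).
  apply: (@measurable_selection R Uhat _ (borel X) Y (fun y => sec y (V y))).
  - exact: (Y_measurable H).
  - exact: (Uhat_compact H).
  - exact: min_ex.
  - by move=> y Yy; exact: sec_closed.
  move=> C cC.
  (* The minimisers at [y] miss [C] exactly when some rational at or above [V y] is below all values
     of [h] at controls in [U y] and [C]; closed projections make this a countable union of Borel
     sets. *)
  have -> : Y `&` [set y | sec y (V y) `&` C !=set0] =
      Y `\` \bigcup_(q : rat) ((Y `&` [set y | V y <= ratr q]) `\` proj C (ratr q)).
    apply/seteqP; split=> y [Yy].
      move=> [u [[Uu hu] Cu]]; split=> // -[q _ [[_ /= Vq] np]]; apply: np.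
      by split=> //; exists u; split=> //; split=> //; exact: le_trans Vq.
    move=> nU; split=> //; apply: attained => // m.
    have [q] := rat_in_itvoo (ltr_pwDr (Vm0 m) (lexx (V y))).
    rewrite in_itv/= => /andP[Vq qV]; apply: contrapT => nex; apply: nU.
    exists q => //; split; first by split=> //=; exact: ltW.
    move=> [_ [u [[Uu hu] Cu]]]; apply: nex; exists u; split=> //; split=> //.
    by apply: le_trans hu _; exact: ltW.
  apply: measurableD; first exact: (Y_measurable H).
  apply: bigcupT_measurable_rat => q; apply: measurableD.
    by rewrite V_sub; apply: closed_borel; apply: proj_closed; exact: closedT.
  by apply: closed_borel; exact: proj_closed.
exists V, sigma; split=> //.
- apply: lsc_bounded_of_sublevel; first exact: (Y_nonempty H).
    by move=> r; rewrite V_sub; apply: proj_closed; exact: closedT.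
  exists B => y Yy; rewrite ler_norml; apply/andP; split.
    apply: lb_le_inf; first by case: (infE y Yy).
    by move=> _ [u Uu <-]; have := hB (y, u) (conj Yy Uu); rewrite ler_norml => /andP[].
  have [u [Uu hu]] := min_ex y Yy; apply: le_trans (Vle y u Yy Uu) _.
  by have := hB (y, u) (conj Yy Uu); rewrite ler_norml => /andP[].
- by move=> y Yy; case: (Ksigma y Yy).
- move=> y Yy; case: (Ksigma y Yy) => Us hs; apply/eqP; rewrite eq_le hs andbT.
  exact: Vle.
Qed.

(* [a = eps], [b = 1 - eps] is the discounted problem and [a = b = 1] the
   finite-horizon one. *)
Lemma value_iteration (q : T -> R) (a b : R) : cont_on G q -> 0 <= b ->
  exists (V : nat -> X -> R) (sigma : nat -> X -> Uhat),
  [/\ V 0%N = (fun=> 0), forall k, lsc_bounded Y (V k),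
    (forall k, measurable_fun (Y : set (borel X)) (sigma k : borel X -> borel Uhat) /\
       forall y, Y y -> U y (sigma k y)),
    (forall k y, Y y -> V k.+1 y = a * q (y, sigma k y) + b * M (V k) (y, sigma k y)) &
    (forall k z, G z -> V k.+1 z.1 <= a * q z + b * M (V k) z)].
Proof.
move=> cq b0.
have step V : exists p : (X -> R) * (X -> Uhat), lsc_bounded Y V ->
    [/\ lsc_bounded Y p.1,
    measurable_fun (Y : set (borel X)) (p.2 : borel X -> borel Uhat),
    (forall y, Y y -> U y (p.2 y)),
    (forall y, Y y -> p.1 y = a * q (y, p.2 y) + b * M V (y, p.2 y)) &
    (forall y u, Y y -> U y u -> p.1 y <= a * q (y, u) + b * M V (y, u))].
  (* Choice needs a pair for every [V]; the one given outside the class is arbitrary, as the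
     iteration never leaves the class. *)
  have [lV|nV] := pselect (lsc_bounded Y V); last by exists (V, fun=> point).
  have [V' [sigma HV]] := lsc_minimum (bellman_lsc H a cq b0 lV).
  by exists (V', sigma).
have [st Hst] := choice step.
pose V k := iter k (fun V => (st V).1) (fun=> 0).
have lV k : lsc_bounded Y (V k).
  elim: k => [|k IH]; last by have [] := Hst _ IH.
  by apply: cont_on_lsc; [exact: Y_compact H|exact: cont_on_cst].
exists V, (fun k => (st (V k)).2); split=> //.
- by move=> k; have [] := Hst _ (lV k).
- by move=> k y Yy; have [_ _ _ + _] := Hst _ (lV k); exact.
- by move=> k [y u] [Yy Uu]; have [_ _ _ _] := Hst _ (lV k); exact.
Qed.

(** With nonnegative costs one more stage cannot lower the value. The Bellman inequality linking
    [V k.+1] to [V k] thereby becomes one for [V k] alone. *)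
Lemma value_iteration_ge0 (q : T -> R) (a b : R) (V : nat -> X -> R) (sigma : nat -> X -> Uhat) :
  0 <= a -> 0 <= b -> (forall z, G z -> 0 <= q z) ->
  V 0%N = (fun=> 0) -> (forall k, lsc_bounded Y (V k)) ->
  (forall k y, Y y -> U y (sigma k y)) ->
  (forall k y, Y y -> V k.+1 y = a * q (y, sigma k y) + b * M (V k) (y, sigma k y)) ->
  (forall k z, G z -> V k.+1 z.1 <= a * q z + b * M (V k) z) ->
  forall k y, Y y -> V k y <= V k.+1 y.
Proof.
move=> a0 b0 q0 V0 lV Us VE Vle; elim=> [|k IH] y Yy.
  rewrite VE// V0; have Gz : G (y, sigma 0%N y) by split=> //; exact: Us.
  by rewrite addr_ge0// mulr_ge0// ?q0//; apply: Rintegral_ge0.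
rewrite [leRHS]VE//; have Gz : G (y, sigma k.+1 y) by split=> //; exact: Us.
apply: le_trans (Vle k _ Gz) _; rewrite lerD2l ler_wpM2l//.
by apply: (mean_next_le H) => //; exact: (lsc_bmeas_Y H).
Qed.

Lemma optimal_plan (q : T -> R) (a b : R) (V : nat -> X -> R) (sigma : nat -> X -> Uhat) N :
  cont_on G q ->
  V 0%N = (fun=> 0) -> (forall k, lsc_bounded Y (V k)) ->
  (forall k, measurable_fun (Y : set (borel X)) (sigma k : borel X -> borel Uhat) /\
       forall y, Y y -> U y (sigma k y)) ->
  (forall k y, Y y -> V k.+1 y = a * q (y, sigma k y) + b * M (V k) (y, sigma k y)) ->
  exists2 pi, admissible Y U pi & forall y0, Y y0 ->
    V N y0 = \sum_(0 <= t < N) a * b ^+ t * \int[P]_w q (state_control s f pi y0 t w).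
Proof.
move=> cq V0 lV ms VE.
(* At time [t] there remain [N - t] stages, and the minimiser for them has index one less. From time
   [N] on the truncated subtraction gives [sigma 0%N], which keeps the plan admissible. *)
pose pi t := sigma (N.-1 - t)%N.
have api : admissible Y U pi by move=> t; exact: ms.
exists pi => // y0 Yy0.
have bcomp (phi : T -> R) t : bmeas (G : set (borel T)) phi ->
    bmeas setT (fun w => phi (state_control s f pi y0 t w)).
  move=> [mphi [B phiB]]; have Gs w := (state_in H api Yy0 t w).2; split.
    apply: (@measurable_comp _ _ _ _ _ _ (G : set (borel T)) phi setT
      (state_control s f pi y0 t : Omega -> borel T)) => //.
    - exact: graph_measurable H.
    - by move=> _ [w _ <-].
    - exact: (state_control_rv H).
  by exists B => w _; exact: phiB.
(* The value is split at time [j] into the expected cost so far and the discounted expected cost to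
   go; the Bellman equation and independence of [s j] from the past advance the split. *)
suff key j : (j <= N)%N -> V N y0 =
    \sum_(0 <= t < j) a * b ^+ t * \int[P]_w q (state_control s f pi y0 t w) +
    b ^+ j * \int[P]_w V (N - j)%N (state s f pi y0 j w).
  rewrite (key N (leqnn N)) subnn V0 Rintegral_cst// mul0r mulr0 addr0.
  by [].
elim: j => [_|j IH jN].
  by rewrite big_nil add0r expr0 mul1r subn0/= Rintegral_cst1//; exact: probability_setT.
rewrite (IH (ltnW jN)) [in RHS]big_nat_recr; last exact: leq0n.
rewrite -addrA; congr (_ + _).
have NjE : (N - j = (N - j.+1).+1)%N by rewrite subnS prednK// subn_gt0.
have piE : pi j = sigma (N - j.+1)%N by rewrite /pi -subn1 -subnDA add1n.
have Gs w := (state_in H api Yy0 j w).2.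
have -> : \int[P]_w V (N - j)%N (state s f pi y0 j w) =
    \int[P]_w (a * q (state_control s f pi y0 j w) +
       b * M (V (N - j.+1)%N) (state_control s f pi y0 j w)).
  apply: eq_Rintegral => w _; rewrite NjE VE; last by case: (Gs w).
  by rewrite -piE.
have bq := bcomp q j (cont_on_graph_bmeas H cq).
have bM := bcomp (M (V (N - j.+1)%N)) j (mean_next_bmeas H (lV _)).
have iq := bmeas_integrable P measurableT bq.
have iM := bmeas_integrable P measurableT bM.
have iaq := bmeas_integrable P measurableT (bmeasZ a bq).
have ibM := bmeas_integrable P measurableT (bmeasZ b bM).
rewrite (RintegralD measurableT iaq ibM) (RintegralZl a measurableT iq)
  (RintegralZl b measurableT iM).
rewrite -(markov_lsc H (state_control_past H api Yy0 (t := j)) Gs (lV _)) mulrDr exprSr; ring.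
Qed.

End optimal_plans.

(** * Occupational measures *)

Section occupation_measures.
Context {R : realType} {n : nat} {Uhat : pmetricType R} {S : ptopologicalType}
  {d : measure_display} {Omega : measurableType d}.
Local Notation X := 'rV[R]_n.
Local Notation T := ('rV[R]_n * Uhat)%type.
Variables (P : probability Omega R) (s : nat -> {RV P >-> borel S}).
Variables (Y : set X) (U : X -> set Uhat) (f : X -> Uhat -> S -> X).
Hypothesis H : standing_assumptions s Y U f.
Local Notation G := (graph Y U).
Local Notation M phi := (fun z : T => mean_next s f phi z.1 z.2).
Local Notation prob := (probability (borel T) R).
Local Notation gint nu phi := (Rintegral (nu : prob) (G : set (borel T)) (phi : T -> R)).
Local Notation bmG := (bmeas (G : set (borel T))).

Lemma bmeas_comp_graph (z : Omega -> T) (phi : T -> R) :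
  measurable_fun setT (z : Omega -> borel T) -> (forall w, G (z w)) ->
  bmG phi -> bmeas setT (fun w => phi (z w)).
Proof.
move=> mz Gz [mphi [B phiB]]; split; last by exists B => w _; exact: phiB.
apply: (@measurable_comp _ _ _ _ _ _ (G : set (borel T)) phi setT (z : Omega -> borel T)) => //.
  exact: graph_measurable H.
by move=> _ [w _ <-].
Qed.

Lemma law_exists (z : Omega -> T) : measurable_fun setT (z : Omega -> borel T) ->
  (forall w, G (z w)) -> exists nu : prob, [/\ forall Q, nu Q = P (z @^-1` Q),
    probs_on G nu & forall phi, bmG phi -> gint nu phi = \int[P]_w phi (z w)].
Proof.
move=> mz Gz.
pose zf := isMeasurableFun.Build _ _ _ (borel T) z mz.
pose Z : {RV P >-> borel T} := HB.pack (z : Omega -> borel T) zf.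
have preG : z @^-1` G = setT by apply/seteqP; split=> w _ //; exact: Gz.
have nuG : distribution P Z G = 1%E by rewrite /distribution /pushforward /= preG probability_setT.
exists (distribution P Z); split=> // phi bphi.
have mG := graph_measurable H.
pose g : borel T -> R := phi \_ G.
have mpatch : measurable_fun setT g.
  by apply/(measurable_restrictT _ _).1 => //; case: bphi.
rewrite Rintegral_mkcond /Rintegral integral_distribution//.
- by congr fine; apply: eq_integral => w _ /=; rewrite patchE mem_set.
- exact/measurable_EFinP.
have [_ [B phiB]] := bphi.
have bp : bmeas setT (fun w => g (z w)).
  split; first exact: (measurableT_comp mpatch mz).
  by exists B => w _; rewrite /g patchE mem_set//; exact: phiB.
exact: (bmeas_integrable P measurableT bp).
Qed.

Section fixed_plan.
Variables (pi : @plan R n Uhat) (y0 : X).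
Hypotheses (api : admissible Y U pi) (Yy0 : Y y0).
Local Notation z_ := (state_control s f pi y0).
Variable w : nat -> R.
Hypotheses (w_ge0 : forall t, 0 <= w t) (w_sum : series w @ \oo --> (1 : R)).

Let laws : exists nu : nat -> prob, forall t, [/\ forall Q, nu t Q = P (z_ t @^-1` Q),
    probs_on G (nu t) & forall phi, bmG phi -> gint (nu t) phi = \int[P]_w phi (z_ t w)].
Proof.
have ex t := law_exists (@state_control_rv _ _ _ _ _ _ _ _ _ _ _ H _ _ api Yy0 t)
  (fun w => (state_in H api Yy0 t w).2).
by have [nu Hnu] := choice ex; exists nu.
Qed.

Lemma occupation_exists : exists gamma : prob, probs_on G gamma /\
  forall Q, gamma Q = (\sum_(t <oo) (w t)%:E * P (z_ t @^-1` Q))%E.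
Proof.
have [nu Hnu] := laws.
have [gamma gE] := mixture_exists nu w_ge0 w_sum.
have gE' Q : gamma Q = (\sum_(t <oo) (w t)%:E * P (z_ t @^-1` Q))%E.
  by rewrite gE; apply: eq_eseriesr => t _; have [-> _ _] := Hnu t.
exists gamma; split=> //; rewrite /probs_on/= gE'.
rewrite -(probability_setT gamma) gE'; apply: eq_eseriesr => t _.
congr (_ * P _)%E; apply/seteqP; split=> // x _.
exact: (state_in H api Yy0 t x).2.
Qed.

Lemma occupation_integral (gamma : prob) : probs_on G gamma ->
  (forall Q : set (borel T), measurable Q -> Q `<=` G ->
     gamma Q = (\sum_(t <oo) (w t)%:E * P (z_ t @^-1` Q))%E) ->
  forall phi, bmG phi ->
  series (fun t => w t * \int[P]_w phi (z_ t w)) @ \oo --> gint gamma phi.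
Proof.
move=> gG gE phi bphi; have [nu Hnu] := laws.
have := @mixture_integral _ (borel T) R w nu w_ge0 w_sum gamma G phi (graph_measurable H).
have -> : (fun t => w t * \int[P]_w phi (z_ t w)) = (fun t => w t * gint (nu t) phi).
  by apply/funext => t; have [_ _ ->] := Hnu t.
apply=> //; first by move=> t; have [_ + _] := Hnu t.
move=> A mA AG; rewrite gE//; apply: eq_eseriesr => t _.
by have [-> _ _] := Hnu t.
Qed.

End fixed_plan.

(** A discounted occupational measure is the mixture of the laws of the state-control pairs with
    these geometric weights; [unif_weight] plays the same part over a finite horizon. *)
Definition disc_weight (eps : R) (t : nat) : R := eps * (1 - eps) ^+ t.

Lemma disc_weight_series eps N : series (disc_weight eps) N = 1 - (1 - eps) ^+ N.
Proof.
elim: N => [|N IH]; first by rewrite /series/= big_nil expr0 subrr.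
rewrite seriesSr IH /disc_weight exprS; ring.
Qed.

Lemma disc_pow_cvg (eps : R) : 0 < eps < 1 -> (fun N => (1 - eps) ^+ N) @ \oo --> (0 : R).
Proof.
move=> /andP[e0 e1]; apply: cvg_expr; rewrite ger0_norm; lra.
Qed.

Lemma disc_weight_sum eps : 0 < eps < 1 -> series (disc_weight eps) @ \oo --> (1 : R).
Proof.
move=> e01; have -> : series (disc_weight eps) = (fun N => 1 - (1 - eps) ^+ N).
  by apply/funext => N; exact: disc_weight_series.
rewrite -[X in _ --> X]subr0; apply: cvgB; first exact: cvg_cst.
exact: disc_pow_cvg.
Qed.

Lemma disc_weight_ge0 eps t : 0 < eps < 1 -> 0 <= disc_weight eps t.
Proof. by move=> /andP[e0 e1]; rewrite mulr_ge0 ?exprn_ge0//; lra. Qed.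

Definition unif_weight (N : nat) (t : nat) : R := if (t < N)%N then N%:R^-1 else 0.

Lemma unif_weight_ge0 N t : 0 <= unif_weight N t.
Proof. by rewrite /unif_weight; case: ifP. Qed.

Lemma unif_weight_series N (a : nat -> R) k : (N <= k)%N ->
  series (fun t => unif_weight N t * a t) k = N%:R^-1 * \sum_(0 <= t < N) a t.
Proof.
move=> Nk; rewrite /series/= (big_cat_nat _ Nk)//= [X in _ + X]big_nat_cond.
rewrite [X in _ + X]big1 ?addr0; last first.
  by move=> t /andP[/andP[Nt _] _]; rewrite /unif_weight ltnNge Nt mul0r.
rewrite mulr_sumr; apply: eq_big_nat => t /andP[_ tN].
by rewrite /unif_weight tN.
Qed.

Lemma unif_weight_sum N : (0 < N)%N -> series (unif_weight N) @ \oo --> (1 : R).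
Proof.
move=> N0; apply: cvg_near_cst; exists N => // k /= Nk.
have -> : unif_weight N = (fun t => unif_weight N t * 1) by apply/funext => t; rewrite mulr1.
by rewrite unif_weight_series// big_const_nat subn0 iter_addr_0 mulVf// pnatr_eq0 -lt0n.
Qed.

Section occ_weights.
Variables (pi : @plan R n Uhat) (y0 : X).
Hypotheses (api : admissible Y U pi) (Yy0 : Y y0).
Local Notation z_ := (state_control s f pi y0).

Let mpre t (Q : set (borel T)) : measurable Q -> measurable (z_ t @^-1` Q).
Proof. by move=> mQ; rewrite -[X in measurable X]setTI; exact: (state_control_rv H). Qed.

Let ind t (Q : set T) : (fun w => \1_Q (z_ t w) : R) = \1_(z_ t @^-1` Q).
Proof. by apply/funext => w; rewrite !indicE. Qed.

Lemma disc_occE eps (Q : set (borel T)) : 0 < eps < 1 -> measurable Q ->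
  disc_occ s f pi y0 eps Q = (\sum_(t <oo) (disc_weight eps t)%:E * P (z_ t @^-1` Q))%E.
Proof.
move=> /andP[e0 e1] mQ; have p0 t : 0 <= (1 - eps) ^+ t by rewrite exprn_ge0//; lra.
have mi t : measurable_fun setT (fun w => (\1_Q (z_ t w) : R)).
  by rewrite ind; apply: measurable_indic; exact: mpre.
rewrite /disc_occ integral_nneseries//; last 2 first.
- by move=> t; apply/measurable_EFinP; apply: measurable_funM => //.
- by move=> t w _; rewrite lee_fin mulr_ge0.
rewrite -nneseriesZl//; last first.
  by move=> t _; apply: integral_ge0 => w _; rewrite lee_fin mulr_ge0.
apply: eq_eseriesr => t _; under eq_integral do rewrite EFinM.
have mi' : measurable_fun setT (fun w => (\1_Q (z_ t w) : R)%:E) by exact/measurable_EFinP.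
have i0 w : setT w -> (0 <= (\1_Q (z_ t w) : R)%:E)%E by rewrite lee_fin.
have pe0 : (0 <= ((1 - eps) ^+ t)%:E)%E by rewrite lee_fin.
rewrite ge0_integralZl//.
rewrite muleA -EFinM; congr (_ * _)%E.
have -> : (fun w => (\1_Q (z_ t w))%:E : \bar R) = (fun w => (\1_(z_ t @^-1` Q) w)%:E).
  by apply/funext => w; rewrite !indicE.
by rewrite integral_indic ?setIT//; exact: mpre.
Qed.

Lemma occE N (Q : set (borel T)) : (0 < N)%N -> measurable Q ->
  occ s f pi y0 N Q = (\sum_(t <oo) (unif_weight N t)%:E * P (z_ t @^-1` Q))%E.
Proof.
move=> N0 mQ.
have mi t : measurable_fun setT (fun w => (\1_Q (z_ t w) : R)).
  by rewrite ind; apply: measurable_indic; exact: mpre.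
rewrite /occ; under eq_integral do rewrite -sumEFin.
rewrite ge0_integral_sum//; last first.
  by move=> t; apply/measurable_EFinP.
rewrite ge0_sume_distrr; last by move=> t _; apply: integral_ge0 => w _; rewrite lee_fin.
apply/esym/cvg_lim => //; apply: cvg_near_cst; exists N => // k /= Nk.
rewrite (big_cat_nat _ Nk)//= [X in (_ + X)%E]big_nat_cond.
rewrite [X in (_ + X)%E]big1 ?adde0; last first.
  by move=> t /andP[/andP[Nt _] _]; rewrite /unif_weight ltnNge Nt mul0e.
apply: eq_big_nat => t /andP[_ tN]; rewrite /unif_weight tN; congr (_ * _)%E.
have -> : (fun w => (\1_Q (z_ t w))%:E : \bar R) = (fun w => (\1_(z_ t @^-1` Q) w)%:E).
  by apply/funext => w; rewrite !indicE.
by rewrite integral_indic ?setIT//; exact: mpre.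
Qed.

End occ_weights.

End occupation_measures.

(** * Drift identities for occupational measures *)

Section characterization.
Context {R : realType} {n : nat} {Uhat : pmetricType R} {S : ptopologicalType}
  {d : measure_display} {Omega : measurableType d}.
Local Notation X := 'rV[R]_n.
Local Notation T := ('rV[R]_n * Uhat)%type.
Variables (P : probability Omega R) (s : nat -> {RV P >-> borel S}).
Variables (Y : set X) (U : X -> set Uhat) (f : X -> Uhat -> S -> X).
Hypothesis H : standing_assumptions s Y U f.
Local Notation G := (graph Y U).
Local Notation M phi := (fun z : T => mean_next s f phi z.1 z.2).
Local Notation prob := (probability (borel T) R).
Local Notation gint nu phi := (Rintegral (nu : prob) (G : set (borel T)) (phi : T -> R)).
Local Notation bmG := (bmeas (G : set (borel T))).

Let mG := graph_measurable H.

Lemma cont_on_Y_lsc (phi : X -> R) : cont_on Y phi -> lsc_bounded Y phi.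
Proof. by apply: cont_on_lsc; exact: Y_compact H. Qed.

(** One expression covers both sets: [a = 1 - eps], [b = eps], [c = phi y0] for [W_disc], and
    [a = 1], [b = c = 0] for [W]. *)
Lemma drift_bmeas (phi : X -> R) (a b c : R) : lsc_bounded Y phi ->
  bmG (fun z => a * (M phi z - phi z.1) + b * (c - phi z.1)).
Proof.
move=> lphi; apply: bmeasD; apply: bmeasZ; apply: bmeasB.
- exact: (mean_next_bmeas H).
- exact: (fst_bmeas H).
- exact: bmeas_cst.
- exact: (fst_bmeas H).
Qed.

Lemma drift_integral (gamma : prob) (phi : X -> R) (a b c : R) : probs_on G gamma ->
  lsc_bounded Y phi -> gint gamma (fun z => a * (M phi z - phi z.1) + b * (c - phi z.1)) =
    a * (gint gamma (M phi) - gint gamma (fun z => phi z.1)) +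
    b * (c - gint gamma (fun z => phi z.1)).
Proof.
move=> gG lphi.
have b1 := mean_next_bmeas H lphi; have b2 := fst_bmeas H lphi.
have b3 := bmeas_cst (G : set (borel T)) c.
have i1 := bmeas_integrable gamma mG b1; have i2 := bmeas_integrable gamma mG b2.
have i3 := bmeas_integrable gamma mG b3.
have i12 := bmeas_integrable gamma mG (bmeasB b1 b2).
have i32 := bmeas_integrable gamma mG (bmeasB b3 b2).
have ia := bmeas_integrable gamma mG (bmeasZ a (bmeasB b1 b2)).
have ib := bmeas_integrable gamma mG (bmeasZ b (bmeasB b3 b2)).
rewrite (RintegralD mG ia ib) (RintegralZl a mG i12) (RintegralZl b mG i32).
by rewrite (RintegralB mG i1 i2) (RintegralB mG i3 i2) (Rintegral_cst1 mG gG).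
Qed.

Lemma ereal_integral0 (gamma : prob) (h : T -> R) : bmG h ->
  (\int[gamma]_(z in (G : set (borel T))) (h z)%:E = 0)%E <-> gint gamma h = 0.
Proof.
move=> bh; have fin := integrable_fin_num mG (bmeas_integrable gamma mG bh).
rewrite /Rintegral; split; first by move=> ->.
by move=> h0; rewrite -(fineK fin) h0.
Qed.

Lemma W_discP eps y0 (gamma : prob) : W_disc s Y U f eps y0 gamma <->
  probs_on G gamma /\ forall phi, cont_on Y phi ->
    (1 - eps) * gint gamma (M phi) + eps * phi y0 = gint gamma (fun z => phi z.1).
Proof.
split=> -[gG Hg]; split=> // phi cphi; have lphi := cont_on_Y_lsc cphi.
  have /(ereal_integral0 gamma (drift_bmeas _ _ _ lphi)) := Hg phi cphi.
  rewrite drift_integral// => h0; lra.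
apply/(ereal_integral0 gamma (drift_bmeas _ _ _ lphi)); rewrite drift_integral//.
have := Hg phi cphi; lra.
Qed.

Lemma WP (gamma : prob) : W s Y U f gamma <->
  probs_on G gamma /\ forall phi, cont_on Y phi ->
    gint gamma (M phi) = gint gamma (fun z => phi z.1).
Proof.
have E phi : (fun z : T => (M phi z - phi z.1)%:E) =
    (fun z => (1 * (M phi z - phi z.1) + 0 * (0 - phi z.1))%:E).
  by apply/funext => z; rewrite mul1r mul0r addr0.
split=> -[gG Hg]; split=> // phi cphi; have lphi := cont_on_Y_lsc cphi.
  have := Hg phi cphi; rewrite E.
  move=> /(ereal_integral0 gamma (drift_bmeas 1 0 0 lphi)).
  rewrite drift_integral// => h0; lra.
rewrite E; apply/(ereal_integral0 gamma (drift_bmeas 1 0 0 lphi)); rewrite drift_integral//.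
have := Hg phi cphi; lra.
Qed.

Section along_a_plan.
Variables (pi : @plan R n Uhat) (y0 : X) (phi : X -> R).
Hypotheses (api : admissible Y U pi) (Yy0 : Y y0) (cphi : cont_on Y phi).
Let a t : R := \int[P]_w phi (state s f pi y0 t w).
Let lphi := cont_on_Y_lsc cphi.

Let bz (h : T -> R) t : bmG h -> bmeas setT (fun w => h (state_control s f pi y0 t w)).
Proof.
apply: (bmeas_comp_graph H); first exact: (state_control_rv H api Yy0).
by move=> w; case: (state_in H api Yy0 t w).
Qed.

(** The pair at time [t] is a function of the past, so independence of [s t] makes the mean of
    [M phi] at time [t] equal to the mean of [phi] at time [t.+1]. *)
Lemma expected_drift t (b e c : R) :
  \int[P]_w (b * (M phi (state_control s f pi y0 t w) - phi (state s f pi y0 t w)) +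
    e * (c - phi (state s f pi y0 t w))) = b * (a t.+1 - a t) + e * (c - a t).
Proof.
have b1 := bz t (mean_next_bmeas H lphi); have b2 := bz t (fst_bmeas H lphi).
have b3 := bmeas_cst (setT : set Omega) c.
have mT := @measurableT _ Omega.
have i1 := bmeas_integrable P mT b1; have i2 := bmeas_integrable P mT b2.
have i3 := bmeas_integrable P mT b3.
have i12 := bmeas_integrable P mT (bmeasB b1 b2).
have i32 := bmeas_integrable P mT (bmeasB b3 b2).
have ia := bmeas_integrable P mT (bmeasZ b (bmeasB b1 b2)).
have ib := bmeas_integrable P mT (bmeasZ e (bmeasB b3 b2)).
rewrite (RintegralD mT ia ib) (RintegralZl b mT i12) (RintegralZl e mT i32).
rewrite (RintegralB mT i1 i2) (RintegralB mT i3 i2).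
rewrite (Rintegral_cst1 mT (probability_setT P)).
rewrite -(markov_lsc H (@state_control_past _ _ _ _ _ _ _ _ _ _ _ H _ _ api Yy0 t) _ lphi)//.
by move=> w; case: (state_in H api Yy0 t w).
Qed.

Lemma expected_abs B t : (forall y, Y y -> `|phi y| <= B) -> `|a t| <= B.
Proof.
move=> phiB; apply: Rintegral_abs_le => //; first exact: probability_setT.
  exact: (bz t (fst_bmeas H lphi)).
by move=> w _; apply: phiB; case: (state_in H api Yy0 t w).
Qed.

Lemma expected0 : a 0%N = phi y0.
Proof. by rewrite /a/= Rintegral_cst1//; exact: probability_setT. Qed.

End along_a_plan.

Lemma Theta_sub_W_disc eps y0 : Y y0 -> 0 < eps < 1 ->
  Theta s Y U f eps y0 `<=` W_disc s Y U f eps y0.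
Proof.
move=> Yy0 e01 gamma [gG [pi api gE]]; split=> // phi cphi.
have lphi := cont_on_Y_lsc cphi; apply/(ereal_integral0 gamma (drift_bmeas _ _ _ lphi)).
have gE' Q : measurable (Q : set (borel T)) -> Q `<=` G -> gamma Q =
    (\sum_(t <oo) (disc_weight eps t)%:E * P (state_control s f pi y0 t @^-1` Q))%E.
  by move=> mQ QG; rewrite gE// (disc_occE H api Yy0 e01 mQ).
have c1 := occupation_integral H api Yy0 (fun t => disc_weight_ge0 t e01)
  (disc_weight_sum e01) gG gE' (drift_bmeas (1 - eps) eps (phi y0) lphi).
pose a t : R := \int[P]_w phi (state s f pi y0 t w).
(* The weighted drifts telescope exactly: the loss by the discount factor is compensated by the term
   that returns to [y0]. The remainder tends to 0 because [phi] is bounded. *)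
have E N : series (fun t => disc_weight eps t * \int[P]_w
    ((1 - eps) * (M phi (state_control s f pi y0 t w) - phi (state_control s f pi y0 t w).1) +
    eps * (phi y0 - phi (state_control s f pi y0 t w).1))) N =
    eps * (1 - eps) ^+ N * (a N - phi y0).
  elim: N => [|N IH].
    by rewrite /series/= big_nil /a expected0 subrr mulr0.
  rewrite seriesSr IH (expected_drift api Yy0 cphi) -!/(a _) /disc_weight exprS; ring.
apply: (cvg_unique (@Rhausdorff R) c1).
have [B phiB] := cont_on_bounded (Y_compact H) cphi.
have -> : series (fun t => disc_weight eps t * \int[P]_w
    ((1 - eps) * (M phi (state_control s f pi y0 t w) - phi (state_control s f pi y0 t w).1) +
    eps * (phi y0 - phi (state_control s f pi y0 t w).1))) =
    (fun N => eps * (1 - eps) ^+ N * (a N - phi y0)) by apply/funext.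
have cK (K : R) : (fun N => K * (1 - eps) ^+ N) @ \oo --> (0 : R).
  by rewrite -[X in _ --> X](mulr0 K); apply: cvgM; [exact: cvg_cst|exact: disc_pow_cvg].
apply: (squeeze_cvgr _ (cK (- (2 * B))) (cK (2 * B))).
apply: nearW => N; rewrite mulNr -ler_norml.
have /andP[e0 e1] := e01.
have p0 : 0 <= (1 - eps) ^+ N by rewrite exprn_ge0//; lra.
rewrite normrM ger0_norm ?mulr_ge0 ?(ltW e0)//.
have h : `|a N - phi y0| <= 2 * B.
  apply: le_trans (ler_normB _ _) _; rewrite mulr_natl mulr2n lerD ?phiB//.
  exact: expected_abs.
apply: (@le_trans _ _ (1 * (1 - eps) ^+ N * (2 * B))); last by rewrite mul1r mulrC.
by apply: ler_pM => //; [rewrite mulr_ge0// ltW|rewrite ler_wpM2r// ltW].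
Qed.

(** The defining identity rearranges to [(1 - eps) * (I1 - I2) = eps * (I2 - phi y0)], with [I1] and
    [I2] the integrals of [M phi] and of [phi]. An upper bound is enough, as [- phi] is a test
    function too. *)
Lemma W_disc_drift_le eps y0 (gamma : prob) (phi : X -> R) (B : R) : Y y0 ->
  0 < eps < 1 -> W_disc s Y U f eps y0 gamma -> cont_on Y phi ->
  (forall y, Y y -> `|phi y| <= B) ->
  gint gamma (M phi) - gint gamma (fun z => phi z.1) <= eps * (2 * B) / (1 - eps).
Proof.
move=> Yy0 /andP[e0 e1] /W_discP[gG Hg] cphi phiB.
have h := Hg phi cphi.
have h1 : `|gint gamma (fun z => phi z.1)| <= B.
  apply: Rintegral_abs_le => //; first exact: (fst_bmeas H (cont_on_Y_lsc cphi)).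
  by move=> z [Yz _]; exact: phiB.
have h2 := phiB y0 Yy0; move: h1 h2; rewrite !ler_norml => /andP[h1 h1'] /andP[h2 h2'].
have e1' : 0 < 1 - eps by lra.
rewrite ler_pdivlMr//.
move: h h1 h1'; set I1 := gint gamma (M phi); set I2 := gint gamma _ => h h1 h1'.
have -> : (I1 - I2) * (1 - eps) = eps * (I2 - phi y0).
  transitivity (((1 - eps) * I1 + eps * phi y0) - I2 + eps * (I2 - phi y0)); first by ring.
  by rewrite h subrr add0r.
by apply: ler_wpM2l; [exact: ltW|lra].
Qed.

(** The expected increments over [N] steps telescope to a difference of two means of [phi], which is
    at most [2 * B]. *)
Lemma Gamma_drift_le N y0 (gamma : prob) (phi : X -> R) (B : R) : Y y0 -> (0 < N)%N ->
  Gamma s Y U f N y0 gamma -> cont_on Y phi -> (forall y, Y y -> `|phi y| <= B) ->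
  gint gamma (M phi) - gint gamma (fun z => phi z.1) <= 2 * B / N%:R.
Proof.
move=> Yy0 N0 [gG [pi api gE]] cphi phiB.
have lphi := cont_on_Y_lsc cphi.
have gE' Q : measurable (Q : set (borel T)) -> Q `<=` G -> gamma Q =
    (\sum_(t <oo) (unif_weight N t)%:E * P (state_control s f pi y0 t @^-1` Q))%E.
  by move=> mQ QG; rewrite gE// (occE H api Yy0 N0 mQ).
have c1 := occupation_integral H api Yy0 (unif_weight_ge0 N)
  (unif_weight_sum N0) gG gE' (drift_bmeas 1 0 0 lphi).
pose a t : R := \int[P]_w phi (state s f pi y0 t w).
have DE := drift_integral 1 0 0 gG lphi.
rewrite mul1r mul0r addr0 in DE; rewrite -DE.
apply: (cvgr_to_le c1); exists N => // k /= Nk.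
rewrite unif_weight_series// mulrC ler_wpM2r ?invr_ge0//.
have -> : \sum_(0 <= t < N) \int[P]_w
    (1 * (M phi (state_control s f pi y0 t w) - phi (state_control s f pi y0 t w).1) +
    0 * (0 - phi (state_control s f pi y0 t w).1)) = a N - a 0%N.
  rewrite -telescope_sumr//; apply: eq_bigr => t _.
  by rewrite (expected_drift api Yy0 cphi) mul1r mul0r addr0.
apply: le_trans (ler_norm _) _; apply: le_trans (ler_normB _ _) _.
by rewrite mulr_natl mulr2n lerD//; exact: expected_abs.
Qed.

End characterization.

(** * Inclusions between the closed convex hulls and [W_disc], [W] *)

Section hull_inclusions.
Context {R : realType} {n : nat} {Uhat : pmetricType R} {S : ptopologicalType}
  {d : measure_display} {Omega : measurableType d}.
Local Notation X := 'rV[R]_n.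
Local Notation T := ('rV[R]_n * Uhat)%type.
Variables (P : probability Omega R) (s : nat -> {RV P >-> borel S}).
Variables (Y : set X) (U : X -> set Uhat) (f : X -> Uhat -> S -> X).
Hypothesis H : standing_assumptions s Y U f.
Local Notation G := (graph Y U).
Local Notation M phi := (fun z : T => mean_next s f phi z.1 z.2).
Local Notation prob := (probability (borel T) R).
Local Notation gint nu phi := (Rintegral (nu : prob) (G : set (borel T)) (phi : T -> R)).
Local Notation bmG := (bmeas (G : set (borel T))).
Local Notation co := (closed_convex_hull G).

Let mG := graph_measurable H.
Let cG := graph_compact H.
Let hT := @hausdorff_pair R n Uhat.

Lemma fst_cont (phi : X -> R) : cont_on Y phi -> cont_on G (fun z : T => phi z.1).
Proof.
move=> cphi; apply: cont_onP => z c [Yz _] Gc cz.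
apply: (@cont_on_Y_seq _ _ Y phi z.1 (fun k => (c k).1)) => //.
  by move=> i; case: (Gc i).
exact: (cvg_comp _ _ cz cvg_fst).
Qed.

Lemma drift_cont (phi : X -> R) (a b c : R) : cont_on Y phi ->
  cont_on G (fun z : T => a * (M phi z - phi z.1) + b * (c - phi z.1)).
Proof.
move=> cphi; have c1 := mean_next_cont H cphi; have c2 := fst_cont cphi.
have E (g h : T -> R) : (fun z => g z - h z) = (fun z => g z + -1 * h z).
  by apply/funext => z; rewrite mulN1r.
apply: cont_onD; apply: cont_onZ; rewrite E; apply: cont_onD => //.
- exact: cont_onZ.
- exact: cont_on_cst.
- exact: cont_onZ.
Qed.

(** A function cannot exceed its mean by [e] everywhere. The point found serves as initial state in
    the unions over [y0]. *)
Lemma lsc_low_point (gamma : prob) (V : X -> R) (e : R) : probs_on G gamma ->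
  lsc_bounded Y V -> 0 < e -> exists2 y0, Y y0 & V y0 <= gint gamma (fun z => V z.1) + e.
Proof.
move=> gG lV e0; apply: contrapT => nex.
have : gint gamma (fun z => V z.1) + e <= gint gamma (fun z => V z.1).
  apply: Rintegral_ge_cst => //; first exact: (fst_bmeas H).
  move=> z [Yz _]; rewrite leNgt; apply/negP => lt; apply: nex; exists z.1 => //.
  exact: ltW.
by rewrite gerDl leNgt e0.
Qed.

Lemma bellman_integral (gamma : prob) (q : T -> R) (a b : R) (V W : X -> R) :
  probs_on G gamma -> cont_on G q -> lsc_bounded Y V -> lsc_bounded Y W ->
  (forall z, G z -> W z.1 <= a * q z + b * M V z) ->
  gint gamma (fun z => W z.1) <= a * gint gamma q + b * gint gamma (M V).
Proof.
move=> gG cq lV lW le.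
have bq := cont_on_graph_bmeas H cq; have bM := mean_next_bmeas H lV.
have iq := bmeas_integrable gamma mG bq; have iM := bmeas_integrable gamma mG bM.
have iaq := bmeas_integrable gamma mG (bmeasZ a bq).
have ibM := bmeas_integrable gamma mG (bmeasZ b bM).
rewrite -(RintegralZl a mG iq) -(RintegralZl b mG iM) -(RintegralD mG iaq ibM).
apply: le_Rintegral => //.
  exact: (bmeas_integrable gamma mG (fst_bmeas H lW)).
exact: (bmeas_integrable gamma mG (bmeasD (bmeasZ a bq) (bmeasZ b bM))).
Qed.

(** [V] is the value over a long horizon [N]. The plan optimal for it, continued forever, adds only
    the discounted cost after [N]; the last clause integrates a pointwise inequality and so holds
    for every [gamma] on [G]. *)
Lemma disc_near_optimal (eps : R) (q : T -> R) (e : R) : 0 < eps < 1 -> cont_on G q ->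
  (forall z, G z -> 0 <= q z) -> 0 < e ->
  exists V : X -> R, [/\ lsc_bounded Y V,
    forall y0, Y y0 -> exists2 nu, Theta s Y U f eps y0 nu & gint nu q <= V y0 + e &
    forall gamma, probs_on G gamma ->
      gint gamma (fun z => V z.1) <= eps * gint gamma q + (1 - eps) * gint gamma (M V)].
Proof.
move=> e01 cq q0 e0; have /andP[eps0 eps1] := e01.
have b0 : 0 <= 1 - eps by lra.
have [V [sigma [V0 lV ms VE Vle]]] := value_iteration H eps cq b0.
have [B qB] := cont_on_bounded cG cq.
(* The weights from [N] on sum to at most [(1 - eps) ^+ N], and [|B|] bounds the cost. *)
have [N NB] : exists N, (1 - eps) ^+ N * `|B| <= e.
  have cK : (fun N => (1 - eps) ^+ N * `|B|) @ \oo --> (0 : R).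
    by rewrite -[X in _ --> X](mul0r `|B|); apply: cvgM; [exact: disc_pow_cvg|exact: cvg_cst].
  have [N _ /(_ N (leqnn N))] := cvgr_le _ cK _ e0; by exists N.
have [pi api VNE] := optimal_plan H N cq V0 lV ms VE.
exists (V N); split=> //; last first.
  move=> gamma gG; apply: le_trans (bellman_integral gG cq (lV N) (lV N.+1) (Vle N)).
  apply: le_Rintegral => //.
  - exact: (bmeas_integrable gamma mG (fst_bmeas H (lV N))).
  - exact: (bmeas_integrable gamma mG (fst_bmeas H (lV N.+1))).
  move=> z [Yz _]; apply: (value_iteration_ge0 H (ltW eps0) b0 q0 V0 lV _ VE Vle) => //.
  by move=> k y Yy; apply: (ms k).2.
move=> y0 Yy0.
have w0 t := disc_weight_ge0 t e01; have w1 := disc_weight_sum e01.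
have [nu [nuG nuE]] := occupation_exists H api Yy0 w0 w1.
exists nu.
  split=> //; exists pi => // Q mQ QG; by rewrite nuE (disc_occE H api Yy0 e01 mQ).
have c1 := occupation_integral H api Yy0 w0 w1 nuG (fun Q _ _ => nuE Q) (cont_on_graph_bmeas H cq).
apply: (cvgr_to_le c1); exists N => // k /= Nk.
rewrite /series/= (big_cat_nat _ Nk)//= VNE// lerD2l.
apply: (@le_trans _ _ (\sum_(N <= t < k) disc_weight eps t * `|B|)).
  apply: ler_sum => t _; apply: ler_wpM2l => //.
  apply: Rintegral_le_cst => //; first exact: probability_setT.
    apply: (bmeas_comp_graph H); first exact: (state_control_rv H api Yy0).
      by move=> w; case: (state_in H api Yy0 t w).
    exact: (cont_on_graph_bmeas H).
  move=> w _; apply: le_trans (ler_norm _) _; apply: le_trans (qB _ _) (ler_norm _).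
  by case: (state_in H api Yy0 t w).
rewrite -mulr_suml; apply: le_trans NB; apply: ler_wpM2r => //.
have := disc_weight_series eps k; rewrite /series/= (big_cat_nat _ Nk)//=.
have := disc_weight_series eps N; rewrite /series/= => -> h.
have -> : \sum_(N <= t < k) disc_weight eps t = (1 - eps) ^+ N - (1 - eps) ^+ k by lra.
by rewrite gerBl exprn_ge0.
Qed.

(** [V] is the minimal undiscounted total cost over [N] stages. For [gamma] in [W], invariance
    replaces [M (V k)] by [V k] under the integral, so each stage adds at most one integral of
    [q]. *)
Lemma unif_near_optimal (N : nat) (q : T -> R) : (0 < N)%N -> cont_on G q ->
  exists V : X -> R, [/\ lsc_bounded Y V,
    forall y0, Y y0 -> exists2 nu, Gamma s Y U f N y0 nu & gint nu q = N%:R^-1 * V y0 &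
    forall gamma, W s Y U f gamma -> gint gamma (fun z => V z.1) <= N%:R * gint gamma q].
Proof.
move=> N0 cq.
have [V [sigma [V0 lV ms VE Vle]]] := value_iteration H 1 cq ler01.
have [pi api VNE] := optimal_plan H N cq V0 lV ms VE.
have [y1 Yy1] := Y_nonempty H.
exists (V N); split=> //; last first.
  move=> gamma /(WP H)[gG gE].
  have id k : gint gamma (M (V k)) = gint gamma (fun z => V k z.1).
    have := @transition_identity _ _ _ _ _ _ _ _ _ _ _ H gamma 1 0 y1 Yy1 gG _ (V k) (lV k).
    rewrite mul1r mul0r addr0; apply=> phi cphi.
    by rewrite mul1r mul0r addr0; exact: gE.
  elim: (N) => [|k IH].
    by rewrite V0 mul0r Rintegral_cst1.
  apply: le_trans (bellman_integral gG cq (lV k) (lV k.+1) (Vle k)) _.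
  by rewrite !mul1r id -natr1 mulrDl mul1r addrC lerD2r.
move=> y0 Yy0.
have w0 t := @unif_weight_ge0 R N t; have w1 := @unif_weight_sum R N N0.
have [nu [nuG nuE]] := occupation_exists H api Yy0 w0 w1.
exists nu.
  split=> //; exists pi => // Q mQ QG; by rewrite nuE (occE H api Yy0 N0 mQ).
have c1 := occupation_integral H api Yy0 w0 w1 nuG (fun Q _ _ => nuE Q) (cont_on_graph_bmeas H cq).
apply: (cvg_unique (@Rhausdorff R) c1); apply: cvg_near_cst; exists N => // k /= Nk.
rewrite unif_weight_series// VNE//; congr (_ * _).
by apply: eq_bigr => t _; rewrite expr1n !mul1r.
Qed.

Lemma Theta_probs eps y0 : Theta s Y U f eps y0 `<=` probs_on G.
Proof. by move=> ? []. Qed.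

Lemma Gamma_probs N y0 : Gamma s Y U f N y0 `<=` probs_on G.
Proof. by move=> ? []. Qed.

Lemma W_disc_sub_co eps y0 : Y y0 -> 0 < eps < 1 ->
  W_disc s Y U f eps y0 `<=` co (Theta s Y U f eps y0).
Proof.
move=> Yy0 e01 gamma /(W_discP H)[gG gE]; have /andP[eps0 eps1] := e01.
apply: (closed_convex_hull_separation hT cG (@Theta_probs eps y0)) => // q cq q0 e e0.
have [V [lV nuV Vg]] := disc_near_optimal e01 cq q0 e0.
have [nu Tnu nuq] := nuV y0 Yy0; exists nu => //; apply: le_trans nuq _.
(* Comparing the Bellman inequality with the identity for [W_disc] leaves
   [eps * V y0 <= eps * gint gamma q]. *)
rewrite lerD2r -(ler_pM2l eps0).
have := transition_identity H Yy0 gG gE lV; have := Vg gamma gG; lra.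
Qed.

Lemma W_sub_co_Theta eps : 0 < eps < 1 ->
  W s Y U f `<=` co (\bigcup_(y0 in Y) Theta s Y U f eps y0).
Proof.
move=> e01 gamma /(WP H)[gG gE]; have /andP[eps0 eps1] := e01.
have [y1 Yy1] := Y_nonempty H.
apply: (closed_convex_hull_separation hT cG) => //.
  by move=> nu [y0 _]; exact: Theta_probs.
move=> q cq q0 e e0; have e2 : 0 < e / 2 by rewrite divr_gt0.
have [V [lV nuV Vg]] := disc_near_optimal e01 cq q0 e2.
have [y0 Yy0 Vy0] := lsc_low_point gG lV e2.
have [nu Tnu nuq] := nuV y0 Yy0; exists nu; first by exists y0.
have id : gint gamma (M V) = gint gamma (fun z => V z.1).
  have := @transition_identity _ _ _ _ _ _ _ _ _ _ _ H gamma 1 0 y1 Yy1 gG _ V lV.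
  rewrite mul1r mul0r addr0; apply=> phi cphi.
  by rewrite mul1r mul0r addr0; exact: gE.
(* Invariance cancels a share [1 - eps] of the integral of [V] on both sides, and [eps] remains as a
   common factor. *)
have : gint gamma (fun z => V z.1) <= gint gamma q.
  by rewrite -(ler_pM2l eps0); have := Vg gamma gG; rewrite id; lra.
lra.
Qed.

Lemma W_sub_co_Gamma N : (0 < N)%N ->
  W s Y U f `<=` co (\bigcup_(y0 in Y) Gamma s Y U f N y0).
Proof.
move=> N0 gamma gW; have [gG _] := gW.
apply: (closed_convex_hull_separation hT cG) => //.
  by move=> nu [y0 _]; exact: Gamma_probs.
move=> q cq q0 e e0.
have [V [lV nuV Vg]] := unif_near_optimal N0 cq.
have [y0 Yy0 Vy0] := lsc_low_point gG lV e0.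
have [nu Tnu nuq] := nuV y0 Yy0; exists nu; first by exists y0.
have N1 : 1 <= N%:R :> R by rewrite ler1n.
rewrite nuq ler_pdivrMl ?ltr0n// mulrDr.
apply: le_trans Vy0 _; apply: lerD; first exact: Vg.
by rewrite ler_peMl// ltW.
Qed.

(** Each defining identity is a pair of opposite linear inequalities on integrals of continuous
    functions, hence survives convex combinations and weak-star limits. *)
Lemma co_Theta_W_disc eps y0 : Y y0 -> 0 < eps < 1 ->
  co (Theta s Y U f eps y0) `<=` W_disc s Y U f eps y0.
Proof.
move=> Yy0 e01 gamma gco; have [gG _] := gco; apply/(W_discP H); split=> // phi cphi.
have lphi := cont_on_Y_lsc H cphi.
have D0 nu : Theta s Y U f eps y0 nu -> forall a b c,
    a = 1 - eps -> b = eps -> c = phi y0 ->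
    gint nu (fun z => a * (M phi z - phi z.1) + b * (c - phi z.1)) = 0.
  move=> /(Theta_sub_W_disc H Yy0 e01)/(W_discP H)[nuG nuE] a b c -> -> ->.
  by rewrite (drift_integral H)//; have := nuE phi cphi; lra.
have le1 : gint gamma (fun z => (1 - eps) * (M phi z - phi z.1) + eps * (phi y0 - phi z.1)) <= 0.
  apply: (closed_convex_hull_le hT cG (@Theta_probs eps y0) _ _ gco).
    exact: drift_cont.
  by move=> nu Tnu; rewrite (D0 nu Tnu).
have le2 : gint gamma (fun z => - (1 - eps) * (M phi z - phi z.1) + - eps * (phi y0 - phi z.1)) <= 0.
  apply: (closed_convex_hull_le hT cG (@Theta_probs eps y0) _ _ gco).
    exact: drift_cont.
  move=> nu Tnu; have := D0 nu Tnu _ _ _ erefl erefl erefl.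
  by rewrite !(drift_integral H)//; [lra|case: Tnu|case: Tnu].
move: le1 le2; rewrite !(drift_integral H)//; lra.
Qed.

Lemma co_drift_le (A : set prob) (gamma : prob) (phi : X -> R) (b : R) :
  A `<=` probs_on G -> cont_on Y phi ->
  (forall nu, A nu -> gint nu (M phi) - gint nu (fun z => phi z.1) <= b) ->
  co A gamma -> gint gamma (M phi) - gint gamma (fun z => phi z.1) <= b.
Proof.
move=> AG cphi Ab gco; have lphi := cont_on_Y_lsc H cphi.
have E nu : probs_on G nu -> gint nu (fun z => 1 * (M phi z - phi z.1) + 0 * (0 - phi z.1)) =
    gint nu (M phi) - gint nu (fun z => phi z.1).
  by move=> nuG; rewrite (drift_integral H)// mul1r mul0r addr0.
rewrite -E; last by case: gco.
apply: (closed_convex_hull_le hT cG AG _ _ gco); first exact: drift_cont.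
by move=> nu Anu; rewrite E; [exact: Ab|exact: AG].
Qed.

End hull_inclusions.

(** * Convergence in the Hausdorff distance *)

Section weak_star_metric.
Context {R : realType} {T : ptopologicalType}.
Variables (G : set T) (q : nat -> T -> R).
Hypotheses (hT : hausdorff_space T) (cG : compact G).
Hypotheses (cq : forall j, cont_on G (q j)) (q1 : forall j z, G z -> `|q j z| <= 1).
Local Notation prob := (probability (borel T) R).
Local Notation gint nu phi := (Rintegral (nu : prob) (G : set (borel T)) (phi : T -> R)).

Let mG : measurable (G : set (borel T)).
Proof. by apply: closed_borel; exact: compact_closed. Qed.

Let term (mu nu : prob) j : R := 2^-1 ^+ j.+1 * `|gint mu (q j) - gint nu (q j)|.

Let term_ge0 mu nu j : 0 <= term mu nu j.
Proof. by rewrite mulr_ge0. Qed.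

Lemma rho_ge0 (mu nu : prob) : (0 <= rho G q mu nu)%E.
Proof. by apply: nneseries_ge0 => j _ _; rewrite lee_fin; exact: term_ge0. Qed.

Lemma rhoxx (mu : prob) : rho G q mu mu = 0%E.
Proof. by apply: eseries0 => j _ _; rewrite subrr normr0 mulr0. Qed.

(** The integrals of [q j] lie between -1 and 1, so the terms from [J] on contribute at most
    [2 * 2^-1 ^+ J]; the weights of the first [J] terms sum to at most 1. *)
Lemma rho_small (e : R) : 0 < e -> exists (J : nat) (dl : R), 0 < dl /\
  forall mu nu : prob, probs_on G mu -> probs_on G nu ->
    (forall j, (j < J)%N -> `|gint mu (q j) - gint nu (q j)| <= dl) ->
    (rho G q mu nu <= e%:E)%E.
Proof.
move=> e0; have h01 : 0 < (2^-1 : R) < 1 by apply/andP; split; lra.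
have hE : 1 - (2^-1 : R) = 2^-1 by lra.
have [J HJ] : exists J, 2 * (2^-1 : R) ^+ J <= e / 2.
  have cK : (fun J => 2 * (2^-1 : R) ^+ J) @ \oo --> (0 : R).
    rewrite -[X in _ --> X](mulr0 2); apply: cvgM; first exact: cvg_cst.
    by have := disc_pow_cvg h01; rewrite hE.
  have e2 : 0 < e / 2 by rewrite divr_gt0.
  have [J _ /(_ J (leqnn J))] := cvgr_le _ cK _ e2; by exists J.
have wE j : disc_weight 2^-1 j = (2^-1 : R) ^+ j.+1 by rewrite /disc_weight hE -exprS.
have wS k : \sum_(0 <= j < k) (2^-1 : R) ^+ j.+1 = 1 - 2^-1 ^+ k.
  have := disc_weight_series (2^-1 : R) k; rewrite hE => <-.
  by rewrite /series/=; apply: eq_bigr => j _.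
exists J, (e / 2); split; first by rewrite divr_gt0.
move=> mu nu muG nuG Hj; apply: lime_le.
  by apply: is_cvg_nneseries => j _ _; rewrite lee_fin; exact: term_ge0.
apply: nearW => k; rewrite sumEFin lee_fin.
apply: (@le_trans _ _ (\sum_(0 <= j < maxn J k) term mu nu j)).
  rewrite [leRHS](big_cat_nat _ (leq_maxr J k))//= lerDl.
  by apply: sumr_ge0 => j _; exact: term_ge0.
rewrite (big_cat_nat _ (leq_maxl J k))//=.
have -> : e = e / 2 + e / 2 by field.
apply: lerD.
  apply: (@le_trans _ _ (\sum_(0 <= j < J) 2^-1 ^+ j.+1 * (e / 2))).
    rewrite !big_nat; apply: ler_sum => j /andP[_ jJ].
    by rewrite /term ler_wpM2l// ?exprn_ge0//; exact: Hj.
  rewrite -mulr_suml wS; have : 0 <= (2^-1 : R) ^+ J by rewrite exprn_ge0.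
  by move=> p0; rewrite ler_piMl// ?divr_ge0 ?ltW//; lra.
have b1 (m : prob) j : probs_on G m -> `|gint m (q j)| <= 1.
  move=> mG1; apply: Rintegral_abs_le => //; first exact: cont_on_bmeas.
  exact: q1.
apply: (@le_trans _ _ (\sum_(J <= j < maxn J k) 2^-1 ^+ j.+1 * 2)).
  apply: ler_sum => j _; rewrite /term ler_wpM2l// ?exprn_ge0//.
  by apply: le_trans (ler_normB _ _) _; have := b1 mu j muG; have := b1 nu j nuG; lra.
rewrite -mulr_suml; apply: le_trans HJ; rewrite mulrC ler_wpM2l//.
have := wS (maxn J k); rewrite (big_cat_nat _ (leq_maxl J k))//= wS => h.
have : 0 <= (2^-1 : R) ^+ maxn J k by rewrite exprn_ge0.
lra.
Qed.

(** As [B] is contained in [A i], only distances from points of [A i] to [B] count. Nonemptiness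
    keeps the suprema, taken in the extended reals, from being [-oo]. *)
Lemma rho_H_cvg0 (I : Type) (F : set_system I) (A : I -> set prob) (B : set prob) :
  ProperFilter F ->
  (forall e : R, 0 < e -> \forall i \near F, [/\ A i !=set0, B `<=` A i &
     forall gamma, A i gamma -> exists2 mu, B mu & (rho G q gamma mu <= e%:E)%E]) ->
  rho_H G q (A i) B @[i --> F] --> 0%E.
Proof.
move=> PF HAB.
have bound (e : R) : 0 < e -> \forall i \near F, (0 <= rho_H G q (A i) B <= e%:E)%E.
  move=> e0; apply: filterS (HAB e e0) => i [[gamma0 Agamma0] BA near_B].
  apply/andP; split.
    rewrite /rho_H le_max; apply/orP; left.
    apply: (@le_trans _ _ (rho_to G q gamma0 B)).
      by apply: le_ereal_inf_tmp => _ [nu _ <-]; exact: rho_ge0.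
    by apply: ereal_sup_ubound; exists gamma0.
  rewrite /rho_H ge_max; apply/andP; split; apply: ge_ereal_sup => _ [gamma Hg <-].
    have [mu Bmu le] := near_B gamma Hg; apply: le_trans le.
    by apply: ereal_inf_lbound; exists mu.
  apply: (@le_trans _ _ 0%E); last by rewrite lee_fin ltW.
  by rewrite -(rhoxx gamma); apply: ereal_inf_lbound; exists gamma => //; exact: BA.
apply/fine_cvgP; split.
  apply: filterS (bound 1 ltr01) => i /andP[h0 h1].
  by rewrite ge0_fin_numE//; apply: le_lt_trans h1 (ltry _).
apply/cvgr0Pnorm_le => e e0; apply: filterS (bound e e0) => i /andP[h0 h1] /=.
have fin : rho_H G q (A i) B \is a fin_num.
  by rewrite ge0_fin_numE//; apply: le_lt_trans h1 (ltry _).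
by rewrite ger0_norm ?fine_ge0// -lee_fin fineK.
Qed.

End weak_star_metric.

Section limits.
Context {R : realType} {n : nat} {Uhat : pmetricType R} {S : ptopologicalType}
  {d : measure_display} {Omega : measurableType d}.
Local Notation X := 'rV[R]_n.
Local Notation T := ('rV[R]_n * Uhat)%type.
Variables (P : probability Omega R) (s : nat -> {RV P >-> borel S}).
Variables (Y : set X) (U : X -> set Uhat) (f : X -> Uhat -> S -> X) (q : nat -> T -> R).
Hypothesis H : standing_assumptions s Y U f.
Local Notation G := (graph Y U).
Local Notation M phi := (fun z : T => mean_next s f phi z.1 z.2).
Local Notation prob := (probability (borel T) R).
Local Notation gint nu phi := (Rintegral (nu : prob) (G : set (borel T)) (phi : T -> R)).
Hypotheses (cq : forall j, cont_on G (q j)) (q1 : forall j z, G z -> `|q j z| <= 1).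

Lemma lipschitz_cont_on (h : T -> R) : lipschitz_in G h -> cont_on G h.
Proof.
move=> [L HL]; apply: cont_onP => z c Gz Gc cz.
have L0 : 0 < `|L| + 1 by rewrite ltr_wpDl.
apply/cvgrPdist_le => e e0.
have e2 : 0 < e / (`|L| + 1) / 2 by rewrite !divr_gt0.
have [N _ HN] := cz _ (nbhsx_ballx z _ e2).
exists N => // k /= Nk; have [/= b1 b2] := HN k Nk.
apply: le_trans (HL z (c k) Gz (Gc k)) _.
move: b1 b2; rewrite -ball_normE ballEmdist/= => b1 b2.
have d0 : 0 <= `|z.1 - (c k).1| + mdist z.2 (c k).2 by rewrite addr_ge0// mdist_ge0.
apply: (@le_trans _ _ ((`|L| + 1) * (`|z.1 - (c k).1| + mdist z.2 (c k).2))).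
  by apply: ler_wpM2r => //; apply: le_trans (ler_norm L) _; rewrite lerDl.
rewrite mulrC -ler_pdivlMr//; apply: ltW.
have -> : e / (`|L| + 1) = e / (`|L| + 1) / 2 + e / (`|L| + 1) / 2 by rewrite -splitr.
exact: ltrD.
Qed.

Lemma mean_nextN (phi : X -> R) z : G z -> cont_on Y phi ->
  M (fun y => -1 * phi y) z = -1 * M phi z.
Proof.
move=> Gz cphi; apply: RintegralZl => //.
by apply: bmeas_integrable => //; apply: (f_bmeas_rv H) => //; exact: (cont_on_Y_bmeas H).
Qed.

(* Otherwise some ultrafilter contains all the tails of the bad elements of
   [A i]; its weak-star limit belongs to [W], a contradiction. *)
Lemma near_W (I : Type) (F : set_system I) (A : I -> set prob) (e : R) :
  ProperFilter F -> (\forall i \near F, A i `<=` probs_on G) ->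
  (forall (phi : X -> R) (b : R), cont_on Y phi -> 0 < b -> \forall i \near F,
     forall gamma, A i gamma -> gint gamma (M phi) - gint gamma (fun z => phi z.1) <= b) ->
  0 < e -> \forall i \near F, forall gamma, A i gamma ->
    exists2 mu, W s Y U f mu & (rho G q gamma mu <= e%:E)%E.
Proof.
move=> PF AG Adrift e0; apply: contrapT => nnear.
have hT := @hausdorff_pair R n Uhat; have cG := graph_compact H.
have mG := graph_measurable H.
pose bad i := A i `&` [set gamma | ~ exists2 mu, W s Y U f mu & (rho G q gamma mu <= e%:E)%E].
pose Fb : set_system prob := [set B | \forall i \near F, bad i `<=` B].
have PFb : ProperFilter Fb.
  split.
    move=> F0; apply: nnear; apply: (@filterS _ F _ _ _ _ F0) => i bi gamma Ai.
    by apply: contrapT => nex; exact: (bi gamma (conj Ai nex)).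
  split.
  - by apply: nearW.
  - move=> B C FB FC; suff: F (fun i => bad i `<=` B `&` C) by [].
    apply: (@filterS _ F _ _ _ _ (@filterI _ F _ _ _ FB FC)) => i [bB bC] gamma bg.
    by split; [exact: bB|exact: bC].
  - move=> B C BC FB; suff: F (fun i => bad i `<=` C) by [].
    by apply: (@filterS _ F _ _ _ _ FB) => i bB gamma bg; exact: (BC _ (bB _ bg)).
have [F' [UF' FF']] := ultraFilterLemma PFb.
have PF' : ProperFilter F' by exact: ultra_proper.
have F'G : F' (probs_on G).
  by apply: FF'; apply: (@filterS _ F _ _ _ _ AG) => i AiG gamma [/AiG].
have [mu muG cmu] := weak_star_compact hT (@normal_pair R n Uhat) cG UF' F'G.
have limdrift (phi : X -> R) : cont_on Y phi ->
    gint mu (M phi) - gint mu (fun z => phi z.1) <= 0.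
  move=> cphi; apply/ler_addgt0Pr => b b0; rewrite add0r.
  have c := @cvgB _ _ _ _ (@filter_filter _ _ PF') _ _ _ _
    (cmu _ (mean_next_cont H cphi)) (cmu _ (fst_cont cphi)).
  apply: (cvgr_to_le c); apply: FF'.
  by apply: (@filterS _ F _ _ _ _ (Adrift phi b cphi b0)) => i Hi gamma [Ai _]; exact: Hi.
have muW : W s Y U f mu.
  apply/(WP H); split=> // phi cphi; apply/eqP; rewrite -subr_eq0 eq_le limdrift//=.
  (* The one-sided bound for [- phi] is the reverse inequality for [phi]. *)
  have cN : cont_on Y (fun y => -1 * phi y) by exact: cont_onZ.
  have := limdrift _ cN.
  have -> : gint mu (M (fun y => -1 * phi y)) = -1 * gint mu (M phi).
    have bM := cont_on_graph_bmeas H (mean_next_cont H cphi).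
    rewrite -(RintegralZl (-1) mG (bmeas_integrable mu mG bM)).
    by apply: eq_Rintegral => z /set_mem Gz; exact: mean_nextN.
  have bf := cont_on_graph_bmeas H (fst_cont cphi).
  rewrite (RintegralZl (-1) mG (bmeas_integrable mu mG bf)); lra.
have [J [dl [dl0 Hdl]]] := rho_small hT cG cq q1 e0.
have near_mu : F' [set gamma : prob | forall j : 'I_J, `|gint gamma (q j) - gint mu (q j)| <= dl].
  apply: filter_forall => j.
  move: (cmu _ (@cq j)) => /cvgrPdist_le/(_ dl dl0).
  by apply: filterS => gamma; rewrite distrC.
have F'bad : F' [set gamma | ~ exists2 mu, W s Y U f mu & (rho G q gamma mu <= e%:E)%E].
  by apply: FF'; apply: nearW => i gamma [].
have [gamma [[gG gmu] gbad]] := filter_ex (filterI (filterI F'G near_mu) F'bad).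
apply: gbad; exists mu => //; apply: Hdl => // j jJ.
exact: (gmu (Ordinal jJ)).
Qed.

End limits.

Theorem theorem3p2 (R : realType) (n : nat) (Uhat : pmetricType R)
    (S : ptopologicalType) (d : measure_display) (Omega : measurableType d)
    (P : probability Omega R) (s : nat -> {RV P >-> borel S})
    (Y : set 'rV[R]_n) (U : 'rV[R]_n -> set Uhat)
    (f : 'rV[R]_n -> Uhat -> S -> 'rV[R]_n)
    (q : nat -> 'rV[R]_n * Uhat -> R)
    (Y_nonempty : Y !=set0) (Y_compact : compact Y)
    (Uhat_compact : compact [set: Uhat])
    (S_polish : polish_space R S)
    (f_bounded : exists M : R, forall y u x, Y y -> `|f y u x| <= M)
    (f_continuous : forall x : S,
       {within Y `*` [set: Uhat], continuous (fun z => f z.1 z.2 x)})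
    (f_measurable : forall y u, Y y ->
       measurable_fun setT (f y u : borel S -> borel 'rV[R]_n))
    (s_indep : independent_seq s) (s_id : identically_distributed s)
    (U_nonempty : forall y, Y y -> U y !=set0)
    (U_compact : forall y, Y y -> compact (U y))
    (U_usc : usc_multimap Y U)
    (f_inv : forall y u x, Y y -> U y u -> Y (f y u x))
    (q_lipschitz : forall j, lipschitz_in (graph Y U) (q j))
    (q_dense : dense_in_unit_ball (graph Y U) q) :
  let G := graph Y U in
  let co := closed_convex_hull G in
  let Gamma_ T := \bigcup_(y0 in Y) Gamma s Y U f T y0 in
  let Theta_ eps := \bigcup_(y0 in Y) Theta s Y U f eps y0 in
  [/\ (forall y0 eps, Y y0 -> 0 < eps < 1 ->
         co (Theta s Y U f eps y0) = W_disc s Y U f eps y0),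
      rho_H G q (co (Theta_ eps)) (W s Y U f) @[eps --> 0^'+] --> 0%E &
      rho_H G q (co (Gamma_ T)) (W s Y U f) @[T --> \oo] --> 0%E].
Proof.
have H := StandingAssumptions Y_nonempty Y_compact Uhat_compact f_continuous
  f_measurable s_indep s_id U_nonempty U_compact U_usc f_inv.
move=> G co Gamma_ Theta_.
have hT := @hausdorff_pair R n Uhat; have cG : compact G := graph_compact H.
have cq j : cont_on G (q j) := lipschitz_cont_on (q_lipschitz j).
have [q1 _] := q_dense; have [y0 Yy0] := Y_nonempty.
have cst0 : cont_on G (fun=> 0 : R) by exact: cont_on_cst.
have ThetaG eps : Theta_ eps `<=` probs_on G by move=> nu [y _] /Theta_probs.
have GammaG N : Gamma_ N `<=` probs_on G by move=> nu [y _] /Gamma_probs.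
have in_co A nu : A nu -> A `<=` probs_on G -> co A nu.
  move=> Anu AG; split; first exact: AG.
  exact/subset_closure/convex_hull_sub.
split.
- move=> y eps Yy e01; rewrite eqEsubset; split.
    exact: (co_Theta_W_disc H).
  exact: (W_disc_sub_co H).
(* [eps < 1/2] keeps the denominator [1 - eps] of the drift bound above one half. *)
- have near01 (b : R) : 0 < b -> \forall eps \near 0^'+, [/\ 0 < eps, eps < 1/2 & eps <= b].
    move=> b0; near=> eps; split; near: eps.
    + exact: nbhs_right_gt.
    + by apply: nbhs_right_lt; lra.
    + exact: nbhs_right_le.
  apply: rho_H_cvg0 => e e0.
  have drift (phi : 'rV[R]_n -> R) (b : R) : cont_on Y phi -> 0 < b ->
      \forall eps \near 0^'+, forall gamma, co (Theta_ eps) gamma ->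
      \int[gamma]_(z in G) mean_next s f phi z.1 z.2 - \int[gamma]_(z in G) phi z.1 <= b.
    move=> cphi b0; have [B HB] := cont_on_bounded Y_compact cphi.
    have B0 : 0 <= B by apply: le_trans (HB y0 Yy0).
    (* The drift bound is at most [4 * B * eps] when [eps < 1/2]; the added 1 covers [B = 0]. *)
    have bB : 0 < b / (4 * B + 1) by rewrite divr_gt0//; lra.
    apply: filterS (near01 _ bB) => eps [eps0 eps1 epsb] gamma.
    apply: (co_drift_le H) => // nu [y Yy Tnu].
    have e01 : 0 < eps < 1 by rewrite eps0; lra.
    apply: le_trans (W_disc_drift_le H Yy e01 _ cphi HB) _.
      exact: (Theta_sub_W_disc H).
    rewrite ler_pdivrMr; last lra.
    move: epsb; rewrite ler_pdivlMr; last lra.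
    nra.
  have co_probs : \forall eps \near 0^'+, co (Theta_ eps) `<=` probs_on G.
    by apply: nearW => eps nu [].
  have He1 := near_W H cq q1 (at_right_proper_filter 0) co_probs drift e0.
  apply: filterS2 (near01 1 ltr01) He1 => eps [eps0 eps1 _] He.
  have e01 : 0 < eps < 1 by rewrite eps0; lra.
  split=> //.
  (* The hull is nonempty: a near-optimal measure for the zero cost is an element of
     [Theta_ eps]. *)
  + have [V [_ nuV _]] := disc_near_optimal H e01 cst0 (fun _ _ => lexx 0) ltr01.
    by have [nu Tnu _] := nuV y0 Yy0; exists nu; apply: in_co => //; exists y0.
  + exact: (W_sub_co_Theta H).
- apply: rho_H_cvg0 => e e0.
  have drift (phi : 'rV[R]_n -> R) (b : R) : cont_on Y phi -> 0 < b ->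
      \forall N \near \oo, forall gamma, co (Gamma_ N) gamma ->
      \int[gamma]_(z in G) mean_next s f phi z.1 z.2 - \int[gamma]_(z in G) phi z.1 <= b.
    move=> cphi b0; have [B HB] := cont_on_bounded Y_compact cphi.
    have B0 : 0 <= B by apply: le_trans (HB y0 Yy0).
    near=> N => gamma.
    have N0 : (0 < N)%N by near: N; exact: nbhs_infty_gt.
    apply: (co_drift_le H) => // nu [y Yy Tnu].
    apply: le_trans (Gamma_drift_le H Yy N0 Tnu cphi HB) _.
    rewrite ler_pdivrMr ?ltr0n// [b * _]mulrC -ler_pdivrMr//.
    by near: N; exact: nbhs_infty_ger.
  have co_probs : \forall N \near \oo, co (Gamma_ N) `<=` probs_on G.
    by apply: nearW => N nu [].
  have He1 := near_W H cq q1 eventually_filter co_probs drift e0.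
  near=> N; have N0 : (0 < N)%N by near: N; exact: nbhs_infty_gt.
  split.
  + have [V [_ nuV _]] := unif_near_optimal H N0 cst0.
    by have [nu Tnu _] := nuV y0 Yy0; exists nu; apply: in_co => //; exists y0.
  + exact: (W_sub_co_Gamma H).
  + by near: N.
Unshelve. all: by end_near.
Qed.
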